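(* Assume the setting and hypotheses described in the context, and let $\mathbf u^{(1)},\dots,\mathbf u^{(N)}$ be normalized eigenvectors of $H$ associated with its eigenvalues $\lambda_1\ge\dots\ge\lambda_N$. Then $$|\langle\mathbf u^{(\alpha)},\mathbf v\rangle|^2\prec N^{-1}$$ uniformly for all $\alpha=1,\dots,N$ and all deterministic unit vectors $\mathbf v\in\mathbb C^N$.
   Context: Let $H=H^*$ be a random $N\times N$ Hermitian matrix whose entries $H_{ij}$, $i\le j$, are independent complex random variables with $\mathbb E H_{ij}=0$, whose variances $S_{ij}=\mathbb E|H_{ij}|^2$ satisfy $C^{-1}\le NS_{ij}\le C$ and $\sum_jS_{ij}=1$ for all $i$ (for a constant $C>0$), and such that for every $p\in\mathbb N$ there is a constant $C_p$ with $\mathbb E|\sqrt N H_{ij}|^p\le C_p$ for all $N,i,j$. Stochastic domination: for families of nonnegative random variables $\xi=(\xi^{(N)}(u))$, $\zeta=(\zeta^{(N)}(u))$, we write $\xi\prec\zeta$ (uniformly in $u$) if for every $\varepsilon>0$, $D>0$, $\sup_u\mathbb P[\xi^{(N)}(u)>N^\varepsilon\zeta^{(N)}(u)]\le N^{-D}$ for $N\ge N_0(\varepsilon,D)$, with $N_0$ depending only on the constants in the hypotheses. *)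

(* Defs.v *)
From mathcomp Require Import all_boot all_algebra.
From mathcomp Require Import all_classical all_reals all_analysis.
From mathcomp Require Export complex.
Set Implicit Arguments. Unset Strict Implicit. Unset Printing Implicit Defensive.
Import GRing.Theory Num.Theory ComplexField.
Local Open Scope ring_scope.
Local Open Scope classical_set_scope.

Section GenWigner.
Context (R : realType).

(* real and imaginary part, as a point of R x R (Borel product sigma-algebra) *)
Definition reim (z : R[i]) : R * R := (complex.Re z, complex.Im z).

(* |z|^2 *)
Definition abs2 (z : R[i]) : R := complex.Re z ^+ 2 + complex.Im z ^+ 2.

(* <u, v> = sum_i conj(u_i) v_i *)
Definition cinner (N : nat) (u v : 'cV[R[i]]_N) : R[i] :=
  \sum_(i < N) (u i ord0)^* * v i ord0.

Definition unit_cvec (N : nat) (v : 'cV[R[i]]_N) : Prop :=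
  \sum_(i < N) abs2 (v i ord0) = 1.

(* the matrix H(w) *)
Definition rmat (d : measure_display) (T : measurableType d) (N : nat)
  (H : 'I_N -> 'I_N -> T -> R[i]) (w : T) : 'M[R[i]]_N :=
  \matrix_(i, j) H i j w.

(* mutual independence of the family (H_ij)_{i <= j} of complex random variables
   (each viewed as an R x R-valued random variable): product rule for every choice of
   measurable sets (taking B = setT for some indices gives all subfamilies). *)
Definition entries_independent (d : measure_display) (T : measurableType d)
  (P : probability T R) (N : nat) (H : 'I_N -> 'I_N -> T -> R[i]) : Prop :=
  forall B : 'I_N -> 'I_N -> set (R * R),
    (forall i j, measurable (B i j)) ->
    P [set w | forall i j : 'I_N, (i <= j)%N -> B i j (reim (H i j w))]
    = (\prod_(k : 'I_N * 'I_N | (k.1 <= k.2)%N)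
         P [set w | B k.1 k.2 (reim (H k.1 k.2 w))])%E.

(* The standing hypotheses of the context, with constants C and (C_p)_p. *)
Definition gen_wigner (C : R) (Cp : nat -> R) (d : measure_display)
  (T : measurableType d) (P : probability T R) (N : nat)
  (H : 'I_N -> 'I_N -> T -> R[i]) : Prop :=
  [/\ (forall i j, measurable_fun setT (fun w => reim (H i j w))) /\
      (forall i j w, H j i w = (H i j w)^*),
      entries_independent P H,
      (forall i j, (\int[P]_w (complex.Re (H i j w))%:E = 0)%E /\
                   (\int[P]_w (complex.Im (H i j w))%:E = 0)%E),
      (exists S : 'I_N -> 'I_N -> R,
         [/\ (forall i j, (\int[P]_w (abs2 (H i j w))%:E = (S i j)%:E)%E),
             (forall i j, C^-1 <= N%:R * S i j <= C)
           & (forall i, \sum_(j < N) S i j = 1)])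
    & forall (p : nat) i j,
        (\int[P]_w ((Num.sqrt (N%:R * abs2 (H i j w))) ^+ p)%:E <= (Cp p)%:E)%E].

(* lam_1(w) >= ... >= lam_N(w) are the eigenvalues of H(w) and u^(1)(w),...,u^(N)(w)
   associated normalized (orthonormal) eigenvectors *)
Definition eigen_decomp (d : measure_display) (T : measurableType d) (N : nat)
  (H : 'I_N -> 'I_N -> T -> R[i]) (lam : 'I_N -> T -> R)
  (u : 'I_N -> T -> 'cV[R[i]]_N) : Prop :=
  [/\ (forall w (a b : 'I_N), (a <= b)%N -> lam b w <= lam a w),
      (forall w a, rmat H w *m u a w = ((lam a w)%:C)%C *: u a w)
    & (forall w a b, cinner (u a w) (u b w) = (a == b)%:R)].

End GenWigner.

(* Main.v *)
Require Import Defs.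
From mathcomp Require Import all_boot all_order all_algebra.
From mathcomp Require Import all_classical all_reals all_analysis measurable_realfun.
From mathcomp Require Import complex ring lra zify.
From HB Require Import structures.
Set Implicit Arguments.
Unset Strict Implicit.
Unset Printing Implicit Defensive.
Import Order.TTheory GRing.Theory Num.Theory ComplexField Normc.
Local Open Scope ring_scope.
Local Open Scope classical_set_scope.

(** With (M - z) u = (lam - z) u, Cauchy-Schwarz and Ward's identity |G v|^2 = Im G_vv / Im z give
    |<u,v>|^2 <= (|lam - z|^2 / Im z) Im G_vv, so it is enough to bound the resolvent entries
    G_vw(z), for deterministic unit vectors, down to Im z = N^(-1+eps).
    With t = N^(1/q), the bound |G_vw(z)| (1 + |z|) <= 4 is propagated from Im z = N^2 by decreasing
    Im z by factors t. One factor costs at most a factor 1 + t in the resolvent entries. Given this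
    rough bound, high moments of the error D = <v, (1 + z G + S[G] G) w> in the self-consistent equation
    are small: E[H_ij Phi(H)] is computed by resampling the entry H_ij, which replaces the cumulant
    expansion by E[H_ij (Phi(H) - Phi(H'))] and needs only a first-order expansion of the resolvent; the
    linear terms cancel S[G] G, and Ward's identity makes the remainder small. Finally D determines G:
    for the diagonal entries by stability of the vector equation m_i (z + (S m)_i) = -1 (S contracts
    fluctuations around the mean because S_ij >= 1/(C N); the mean solves a perturbed quadratic
    equation whose root is followed continuously in Im z, also near the edges), and then for
    G_vw, which is approximately <v,w> m(z). *)

(** * Hermitian matrices and their resolvents *)

(** Why a first-order expansion suffices: after the cancellation, the remainder for the pair (i, j)
    is a third power of the entries, about N^(-3/2), times |v_i| (|G_iw| + |G_jw|). There are N^2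
    pairs, but Cauchy-Schwarz and Ward's identity bound the sum of these weights by about N (K / Im
    z)^(1/2) instead of N^2, where K bounds the resolvent entries. The total is then a negative
    power of t as soon as N Im z >= t^96. The terms quadratic in the entries gain in the same way,
    once a sum over i against v_i is read as a single resolvent entry at a new deterministic vector.
    This is why the rough bound is needed on O(N) test vectors, not only on v and w. The weight 1 +
    |z| is there because D contains z G and the descent starts at Im z = N^2, where all bounds are
    trivial. The exponent q depends on eps only, and at most 3 q levels are visited, however large N
    is. Each level may therefore spend fixed powers of t in probability: statements are made for
    every rate t^-n, with a threshold for t that may depend on n. *)

Section ComplexTools.
Variable R : rcfType.
Implicit Types (x y z : R[i]) (a b : R).

Lemma normc_ge0 x : 0 <= normc x.
Proof. by case: x => a b; exact: sqrtr_ge0. Qed.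

Lemma normc_sq x : normc x ^+ 2 = complex.Re x ^+ 2 + complex.Im x ^+ 2.
Proof. by case: x => a b /=; rewrite sqr_sqrtr ?addr_ge0 ?sqr_ge0. Qed.

Lemma normcD x y : normc (x + y) <= normc x + normc y.
Proof. exact: le_normcD. Qed.

Lemma normcNE x : normc (- x) = normc x.
Proof. exact: normcN. Qed.

Lemma normcB x y : normc (x - y) <= normc x + normc y.
Proof. by rewrite -[normc y]normcNE; exact: normcD. Qed.

Lemma normcBC x y : normc (x - y) = normc (y - x).
Proof. by rewrite -normcNE opprB. Qed.

Lemma normc_real a : normc (a%:C%C) = `|a|.
Proof. by rewrite /= expr0n /= addr0 sqrtr_sqr. Qed.

Lemma normc_conj x : normc (conjc x) = normc x.
Proof. by case: x => a b /=; rewrite sqrrN. Qed.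

Lemma normcX x n : normc (x ^+ n) = normc x ^+ n.
Proof. by elim: n => [|n IH]; rewrite ?expr0 ?normc1 // !exprS normcM IH. Qed.

Lemma normc_sum (I : Type) (r : seq I) (P : pred I) (F : I -> R[i]) :
  normc (\sum_(i <- r | P i) F i) <= \sum_(i <- r | P i) normc (F i).
Proof.
elim/big_ind2: _ => [|x1 x2 y1 y2 h1 h2|i _]; [by rewrite normc0| |exact: lexx].
by apply: le_trans (normcD _ _) _; apply: lerD.
Qed.

Lemma Re_le_normc x : `|complex.Re x| <= normc x.
Proof.
rewrite -(ler_pXn2r (n := 2)) ?nnegrE ?normc_ge0 // normc_sq.
by rewrite real_normK ?num_real // lerDl sqr_ge0.
Qed.

Lemma Im_le_normc x : `|complex.Im x| <= normc x.
Proof.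
rewrite -(ler_pXn2r (n := 2)) ?nnegrE ?normc_ge0 // normc_sq.
by rewrite real_normK ?num_real // lerDr sqr_ge0.
Qed.

Lemma normc_le_ReIm x : normc x <= `|complex.Re x| + `|complex.Im x|.
Proof.
rewrite -(ler_pXn2r (n := 2)) ?nnegrE ?normc_ge0 ?addr_ge0 // normc_sq.
rewrite -(real_normK (num_real (complex.Re x))) -(real_normK (num_real (complex.Im x))).
by rewrite sqrrD -addrA [_ *+ 2 + _]addrC addrA lerDl mulrn_wge0 // mulr_ge0.
Qed.

Lemma ReD x y : complex.Re (x + y) = complex.Re x + complex.Re y.
Proof. by case: x; case: y. Qed.

Lemma ImD x y : complex.Im (x + y) = complex.Im x + complex.Im y.
Proof. by case: x; case: y. Qed.

Lemma ReN x : complex.Re (- x) = - complex.Re x. Proof. by case: x. Qed.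
Lemma ImN x : complex.Im (- x) = - complex.Im x. Proof. by case: x. Qed.

Lemma ReM x y : complex.Re (x * y) =
  complex.Re x * complex.Re y - complex.Im x * complex.Im y.
Proof. by case: x; case: y. Qed.

Lemma ImM x y : complex.Im (x * y) =
  complex.Re x * complex.Im y + complex.Im x * complex.Re y.
Proof. by case: x; case: y. Qed.

Lemma Re_conj x : complex.Re (conjc x) = complex.Re x. Proof. by case: x. Qed.
Lemma Im_conj x : complex.Im (conjc x) = - complex.Im x. Proof. by case: x. Qed.

Lemma Re_sum (I : Type) (r : seq I) (P : pred I) (F : I -> R[i]) :
  complex.Re (\sum_(i <- r | P i) F i) = \sum_(i <- r | P i) complex.Re (F i).
Proof. exact: (big_morph _ ReD (erefl : complex.Re 0 = 0)). Qed.

Lemma conjcD x y : conjc (x + y) = conjc x + conjc y. Proof. exact: rmorphD. Qed.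
Lemma conjcM x y : conjc (x * y) = conjc x * conjc y. Proof. exact: rmorphM. Qed.
Lemma conjcN x : conjc (- x) = - conjc x. Proof. exact: rmorphN. Qed.

Lemma mul_conjc x : x * conjc x = ((normc x) ^+ 2)%:C%C.
Proof.
by rewrite normc_sq; case: x => a b; simpc; congr (_ +i* _)%C; ring.
Qed.

(** Lagrange's identity: the difference of the two sides is half the double sum of the squares of
    a_i b_j - a_j b_i. *)
Lemma CS_sum (I : finType) (a b : I -> R) :
  (\sum_i a i * b i) ^+ 2 <= (\sum_i a i ^+ 2) * (\sum_i b i ^+ 2).
Proof.
have h : 0 <= \sum_i \sum_j (a i * b j - a j * b i) ^+ 2.
  by apply: sumr_ge0 => i _; apply: sumr_ge0 => j _; rewrite sqr_ge0.
have e : \sum_i \sum_j (a i * b j - a j * b i) ^+ 2 =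
   2 * ((\sum_i a i ^+ 2) * (\sum_i b i ^+ 2) - (\sum_i a i * b i) ^+ 2).
  transitivity (\sum_i \sum_j (a i ^+ 2 * b j ^+ 2 + a j ^+ 2 * b i ^+ 2
                 - 2 * ((a i * b i) * (a j * b j)))).
    by apply: eq_bigr => i _; apply: eq_bigr => j _; ring.
  under eq_bigr => i _.
    rewrite sumrB big_split /= -mulr_sumr -mulr_suml -mulr_sumr -mulr_sumr.
    over.
  rewrite sumrB big_split /= -mulr_suml -mulr_sumr -mulr_sumr -mulr_suml expr2.
  ring.
by move: h; rewrite e pmulr_rge0 ?ltr0n // subr_ge0.
Qed.

Lemma CS_sqrt (I : finType) (a b : I -> R) :
  \sum_i a i * b i <= Num.sqrt (\sum_i a i ^+ 2) * Num.sqrt (\sum_i b i ^+ 2).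
Proof.
apply: le_trans (ler_norm _) _.
rewrite -sqrtrM ?sumr_ge0 // => [|i _]; last exact: sqr_ge0.
by rewrite -sqrtr_sqr; apply: ler_wsqrtr; exact: CS_sum.
Qed.

End ComplexTools.

(** * Adjoints, sesquilinear forms and coordinate vectors *)

Section Adjoint.
Variable R : rcfType.
Local Notation C := R[i].

Definition adjm m n (A : 'M[C]_(m, n)) : 'M[C]_(n, m) := map_mx conjc A^T.

Lemma adjmE m n (A : 'M[C]_(m, n)) i j : adjm A i j = conjc (A j i).
Proof. by rewrite !mxE. Qed.

Lemma adjmK m n (A : 'M[C]_(m, n)) : adjm (adjm A) = A.
Proof. by apply/matrixP => i j; rewrite !adjmE conjcK. Qed.

Lemma adjmM m n p (A : 'M[C]_(m, n)) (B : 'M[C]_(n, p)) :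
  adjm (A *m B) = adjm B *m adjm A.
Proof. by rewrite /adjm trmx_mul map_mxM. Qed.

Lemma adjmD m n (A B : 'M[C]_(m, n)) : adjm (A + B) = adjm A + adjm B.
Proof. by apply/matrixP => i j; rewrite !(adjmE, mxE) rmorphD. Qed.

Lemma adjmN m n (A : 'M[C]_(m, n)) : adjm (- A) = - adjm A.
Proof. by apply/matrixP => i j; rewrite !(adjmE, mxE) rmorphN. Qed.

Lemma adjmZ m n a (A : 'M[C]_(m, n)) : adjm (a *: A) = conjc a *: adjm A.
Proof. by apply/matrixP => i j; rewrite !(adjmE, mxE) rmorphM. Qed.

Lemma adjm_scalar n a : adjm (a%:M : 'M[C]_n) = (conjc a)%:M.
Proof. by rewrite /adjm tr_scalar_mx map_scalar_mx. Qed.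

Lemma adjm1 n : adjm (1%:M : 'M[C]_n) = 1%:M.
Proof. by rewrite adjm_scalar rmorph1. Qed.

Definition hermm n (A : 'M[C]_n) := adjm A = A.

Definition sqn n (v : 'cV[C]_n) : R := \sum_i normc (v i 0) ^+ 2.

Fact sesq_key : unit. Proof. by []. Qed.
(* Locked: otherwise unification unfolds matrix products down to big sums. *)
Definition sesq n : 'cV[C]_n -> 'M[C]_n -> 'cV[C]_n -> C :=
  locked_with sesq_key (fun v A w => (adjm v *m A *m w) 0 0).

Lemma sesqE n (v : 'cV[C]_n) (A : 'M[C]_n) (w : 'cV[C]_n) :
  sesq v A w = (adjm v *m A *m w) 0 0.
Proof. by rewrite /sesq unlock. Qed.

Lemma sqn_ge0 n (v : 'cV[C]_n) : 0 <= sqn v.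
Proof. by apply: sumr_ge0 => i _; rewrite exprn_ge0 ?normc_ge0. Qed.

Lemma sqn_eq0 n (v : 'cV[C]_n) : sqn v = 0 -> v = 0.
Proof.
move=> h; apply/matrixP => i j; rewrite (ord1 j) mxE; apply: eq0_normc.
move/eqP: h; rewrite psumr_eq0 => [/allP /(_ i)|k _]; last by rewrite exprn_ge0 ?normc_ge0.
by rewrite mem_index_enum /= sqrf_eq0 => /(_ isT) /eqP.
Qed.

Lemma sqnE n (v : 'cV[C]_n) : (adjm v *m v) 0 0 = (sqn v)%:C%C.
Proof.
rewrite mxE rmorph_sum; apply: eq_bigr => i _.
by rewrite adjmE mulrC mul_conjc.
Qed.

Lemma dot_le n (v w : 'cV[C]_n) :
  normc ((adjm v *m w) 0 0) <= Num.sqrt (sqn v) * Num.sqrt (sqn w).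
Proof.
rewrite mxE; apply: le_trans (normc_sum _ _ _) _.
under eq_bigr do rewrite adjmE normcM normc_conj.
exact: CS_sqrt.
Qed.

Lemma sqnZ n a (v : 'cV[C]_n) : sqn (a *: v) = normc a ^+ 2 * sqn v.
Proof.
by rewrite /sqn mulr_sumr; apply: eq_bigr => i _; rewrite mxE normcM exprMn.
Qed.

Lemma sesqDm n v (A B : 'M[C]_n) w : sesq v (A + B) w = sesq v A w + sesq v B w.
Proof. by rewrite !sesqE mulmxDr mulmxDl mxE. Qed.

Lemma sesqNm n v (A : 'M[C]_n) w : sesq v (- A) w = - sesq v A w.
Proof. by rewrite !sesqE mulmxN mulNmx mxE. Qed.

Lemma sesqBm n v (A B : 'M[C]_n) w : sesq v (A - B) w = sesq v A w - sesq v B w.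
Proof. by rewrite sesqDm sesqNm. Qed.

Lemma sesqZm n v a (A : 'M[C]_n) w : sesq v (a *: A) w = a * sesq v A w.
Proof. by rewrite !sesqE -scalemxAr -scalemxAl mxE. Qed.

Lemma sesqZr n v (A : 'M[C]_n) a w : sesq v A (a *: w) = a * sesq v A w.
Proof. by rewrite !sesqE -scalemxAr mxE. Qed.

Lemma sesqZl n v (A : 'M[C]_n) a w : sesq (a *: v) A w = conjc a * sesq v A w.
Proof. by rewrite !sesqE adjmZ -scalemxAl -scalemxAl mxE. Qed.

Lemma sesq_conj n v (A : 'M[C]_n) w : conjc (sesq v A w) = sesq w (adjm A) v.
Proof.
by rewrite !sesqE -adjmE !adjmM adjmK mulmxA.
Qed.

Definition basis n (i : 'I_n) : 'cV[C]_n := delta_mx i 0.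

Lemma adjm_basis n (i : 'I_n) : adjm (basis i) = delta_mx 0 i.
Proof. by apply/matrixP => a b; rewrite adjmE !mxE rmorph_nat andbC. Qed.

Lemma sqn_basis n (i : 'I_n) : sqn (basis i) = 1.
Proof.
rewrite /sqn (bigD1 i) //= big1 => [|j /negPf nj].
  by rewrite mxE !eqxx normc1 expr1n addr0.
by rewrite mxE nj normc0 expr0n.
Qed.

Lemma basis_dot n (i : 'I_n) (w : 'cV[C]_n) : (adjm (basis i) *m w) 0 0 = w i 0.
Proof. by rewrite adjm_basis -rowE mxE. Qed.

Lemma sesq_basisl n i (A : 'M[C]_n) w : sesq (basis i) A w = (A *m w) i 0.
Proof. by rewrite !sesqE -mulmxA basis_dot. Qed.

Lemma sesq_basis n i j (A : 'M[C]_n) : sesq (basis i) A (basis j) = A i j.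
Proof. by rewrite sesq_basisl -colE mxE. Qed.

Lemma sesq_suml n (v : 'cV[C]_n) (A : 'M[C]_n) w :
  sesq v A w = \sum_i conjc (v i 0) * sesq (basis i) A w.
Proof.
rewrite {1}sesqE -mulmxA [LHS]mxE; apply: eq_bigr => i _.
by rewrite adjmE sesq_basisl.
Qed.

Lemma sesq_sumr n (v : 'cV[C]_n) (A : 'M[C]_n) w :
  sesq v A w = \sum_i sesq v A (basis i) * w i 0.
Proof.
rewrite {1}sesqE [LHS]mxE; apply: eq_bigr => i _; congr (_ * _).
by rewrite !sesqE /basis -colE [RHS]mxE.
Qed.

Lemma sesq_delta n (v w : 'cV[C]_n) (A B : 'M[C]_n) i j :
  sesq v (A *m delta_mx i j *m B) w = sesq v A (basis i) * sesq (basis j) B w.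
Proof.
have -> : delta_mx i j = basis i *m adjm (basis j) :> 'M[C]_n.
  by rewrite adjm_basis /basis mul_delta_mx.
rewrite !sesqE; have -> : adjm v *m (A *m (basis i *m adjm (basis j)) *m B) *m w =
          (adjm v *m A *m basis i) *m (adjm (basis j) *m B *m w).
  by rewrite !mulmxA.
by rewrite mxE big_ord1.
Qed.

End Adjoint.

(** * Resolvents: invertibility, Ward's identity, dependence on the spectral parameter *)

Section Resolvent.
Variable R : rcfType.
Local Notation C := R[i].
Variable n : nat.
Implicit Types (A B M : 'M[C]_n) (v w : 'cV[C]_n) (z : C).

(* The adjugate formula makes every entry a rational function of the entries of [M],
   so that measurability is immediate; it is the inverse of [M - z] whenever [M - z] is invertible. *)
Fact res_key : unit. Proof. by []. Qed.
Definition res : C -> 'M[C]_n -> 'M[C]_n :=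
  locked_with res_key (fun z M => (\det (M - z%:M))^-1 *: \adj (M - z%:M)).

Lemma res_def z M : res z M = (\det (M - z%:M))^-1 *: \adj (M - z%:M).
Proof. by rewrite /res unlock. Qed.

Lemma herm_quad M v : hermm M -> complex.Im (sesq v M v) = 0.
Proof.
move=> hM; have := sesq_conj v M v; rewrite hM => h.
have := congr1 (@complex.Im R) h; rewrite Im_conj; lra.
Qed.

(** A left null vector u of M - z satisfies u M = z u, so its quadratic form, which is real, equals
    z |u|^2; this forces u = 0. *)
Lemma herm_shift_unit M z : hermm M -> complex.Im z != 0 -> M - z%:M \in unitmx.
Proof.
move=> hM hz; rewrite unitmxE unitfE; apply/negP => /det0P [u u0 hu].
have e : u *m M = z *: u.
  by move/eqP: hu; rewrite mulmxBr subr_eq0 mul_mx_scalar => /eqP.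
have h := herm_quad (adjm u) hM.
move: h; rewrite !sesqE adjmK e -scalemxAl mxE -{1}[u]adjmK sqnE.
move/eqP; rewrite ImM /= mulr0 add0r mulf_eq0 (negPf hz) /= => /eqP /sqn_eq0 h.
by move: u0; rewrite -[u]adjmK h /adjm trmx0 map_mx0 eqxx.
Qed.

Section Herm.
Variables (M : 'M[C]_n) (z : C).
Hypothesis (hM : hermm M) (hz : 0 < complex.Im z).
Let G := res z M.

Lemma res_unit : M - z%:M \in unitmx.
Proof. by apply: herm_shift_unit => //; rewrite gt_eqF. Qed.

Lemma resE : G = invmx (M - z%:M).
Proof. by rewrite /G res_def /invmx res_unit. Qed.

Lemma mul_res : (M - z%:M) *m G = 1%:M.
Proof. by rewrite resE mulmxV // res_unit. Qed.

Lemma res_mul : G *m (M - z%:M) = 1%:M.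
Proof. by rewrite resE mulVmx // res_unit. Qed.

Lemma adjm_res_shift : (M - (conjc z)%:M) *m adjm G = 1%:M.
Proof.
have := congr1 (@adjm R n n) res_mul.
by rewrite adjm1 adjmM adjmD adjmN adjm_scalar hM.
Qed.

(** With y = G w one has w = (M - z) y, hence <w, y> = <y, M y> - conj z |y|^2, and the first term
    is real. *)
Lemma ward w : sqn (G *m w) * complex.Im z = complex.Im (sesq w G w).
Proof.
set y := G *m w.
have hy : w = (M - z%:M) *m y by rewrite /y mulmxA mul_res mul1mx.
have -> : sesq w G w = (adjm w *m y) 0 0 by rewrite !sesqE /y mulmxA.
rewrite {1}hy adjmM adjmD adjmN adjm_scalar hM mulmxBr mul_mx_scalar mulmxBl.
rewrite -scalemxAl !mxE ImD ImN -[X in complex.Im X + _]/(_ ) .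
have -> : complex.Im (\sum_j (adjm y *m M) 0 j * y j 0) = 0.
  by have := herm_quad y hM; rewrite !sesqE mxE.
have -> : \sum_j adjm y 0 j * y j 0 = (sqn y)%:C%C by rewrite -sqnE mxE.
by rewrite ImM /= mulr0 add0r Im_conj; ring.
Qed.

Lemma ward_adj v : sqn (adjm G *m v) * complex.Im z = complex.Im (sesq v G v).
Proof.
set y := adjm G *m v.
have hy : v = (M - (conjc z)%:M) *m y by rewrite /y mulmxA adjm_res_shift mul1mx.
have -> : sesq v G v = (adjm y *m v) 0 0.
  by rewrite !sesqE /y adjmM adjmK.
rewrite {1}hy mulmxBl mul_scalar_mx mulmxBr -scalemxAr mulmxA !mxE ImD ImN.
have -> : complex.Im (\sum_j (adjm y *m M) 0 j * y j 0) = 0.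
  by have := herm_quad y hM; rewrite !sesqE mxE.
have -> : \sum_j adjm y 0 j * y j 0 = (sqn y)%:C%C by rewrite -sqnE mxE.
by rewrite ImM /= Im_conj mulr0; ring.
Qed.

Lemma sqrt_div_ge (a b c : R) : 0 < c -> 0 <= a -> 0 <= b -> a ^+ 2 * c <= a * b -> a * c <= b.
Proof.
move=> c0 a0 b0; case: (eqVneq a 0) => [-> _|an]; first by rewrite mul0r.
by rewrite expr2 -mulrA ler_pM2l // lt_def an.
Qed.

(** Ward's identity gives |G w|^2 Im z <= |w| |G w|; one factor |G w| cancels, also when it is
    zero. *)
Lemma res_norm w : Num.sqrt (sqn (G *m w)) * complex.Im z <= Num.sqrt (sqn w).
Proof.
apply: sqrt_div_ge; rewrite ?sqrtr_ge0 // sqr_sqrtr ?sqn_ge0 // ward.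
apply: le_trans (ler_norm _) _; apply: le_trans (Im_le_normc _) _.
by rewrite mulrC !sesqE -mulmxA; exact: dot_le.
Qed.

Lemma res_adj_norm v : Num.sqrt (sqn (adjm G *m v)) * complex.Im z <= Num.sqrt (sqn v).
Proof.
apply: sqrt_div_ge; rewrite ?sqrtr_ge0 // sqr_sqrtr ?sqn_ge0 // ward_adj.
apply: le_trans (ler_norm _) _; apply: le_trans (Im_le_normc _) _.
rewrite !sesqE; have -> : adjm v *m G = adjm (adjm G *m v) by rewrite adjmM adjmK.
exact: dot_le.
Qed.

Lemma res_entry_bound v w :
  normc (sesq v G w) * complex.Im z <= Num.sqrt (sqn v) * Num.sqrt (sqn w).
Proof.
have h : normc (sesq v G w) <= Num.sqrt (sqn v) * Num.sqrt (sqn (G *m w)).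
  by rewrite !sesqE -mulmxA; exact: dot_le.
apply: le_trans (ler_wpM2r (ltW hz) h) _.
by rewrite -mulrA ler_wpM2l ?sqrtr_ge0 ?res_norm.
Qed.

End Herm.

(** Insert (M0 - z0) - (M1 - z1) between the two resolvents. Both uses are covered: a change of one
    matrix entry at fixed z, and a change of z at fixed matrix. *)
Lemma res_diff M0 M1 z0 z1 : hermm M0 -> hermm M1 ->
  0 < complex.Im z0 -> 0 < complex.Im z1 ->
  res z1 M1 - res z0 M0 = res z1 M1 *m ((M0 - M1) + (z1 - z0)%:M) *m res z0 M0.
Proof.
move=> h0 h1 i0 i1.
have -> : M0 - M1 + (z1 - z0)%:M = (M0 - z0%:M) - (M1 - z1%:M).
  by rewrite raddfB /= opprB addrACA [RHS]addrAC !addrA; congr (_ + _); rewrite addrAC.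
by rewrite mulmxBr mulmxBl -mulmxA mul_res // mulmx1 res_mul // mul1mx.
Qed.

Definition vnorm v : R := Num.sqrt (sqn v).

Lemma vnorm_ge0 v : 0 <= vnorm v. Proof. exact: sqrtr_ge0. Qed.

Lemma vnorm_sq v : vnorm v ^+ 2 = sqn v.
Proof. by rewrite sqr_sqrtr ?sqn_ge0. Qed.

Lemma dot_sum_le v w : \sum_i normc (v i 0) * normc (w i 0) <= vnorm v * vnorm w.
Proof. exact: CS_sqrt. Qed.

Lemma vnormD v w : vnorm (v + w) <= vnorm v + vnorm w.
Proof.
rewrite -(ler_pXn2r (n := 2)) ?nnegrE ?addr_ge0 ?vnorm_ge0 //.
rewrite vnorm_sq sqrrD !vnorm_sq.
apply: (@le_trans _ _ (\sum_i (normc (v i 0) ^+ 2 + normc (w i 0) ^+ 2 +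
   (normc (v i 0) * normc (w i 0)) *+ 2))).
  apply: ler_sum => i _; rewrite mxE.
  apply: (@le_trans _ _ ((normc (v i 0) + normc (w i 0)) ^+ 2)).
    by apply: lerXn2r; rewrite ?nnegrE ?addr_ge0 ?normc_ge0 ?normcD.
  by rewrite sqrrD addrAC.
rewrite !big_split /= -mulr2n.
have := dot_sum_le v w; rewrite /sqn; lra.
Qed.

Lemma sesq_mul_le v A B w :
  normc (sesq v (A *m B) w) <= vnorm (adjm A *m v) * vnorm (B *m w).
Proof.
have -> : sesq v (A *m B) w = (adjm (adjm A *m v) *m (B *m w)) 0 0.
  by rewrite !sesqE adjmM adjmK !mulmxA.
exact: dot_le.
Qed.

Lemma vnormZ a v : vnorm (a *: v) = normc a * vnorm v.
Proof.
by rewrite /vnorm sqnZ sqrtrM ?exprn_ge0 ?normc_ge0 // sqrtr_sqr ger0_norm ?normc_ge0.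
Qed.

Lemma vnorm_basis i : vnorm (basis R i) = 1.
Proof. by rewrite /vnorm sqn_basis sqrtr1. Qed.

Section Scale.
Variables (M : 'M[C]_n) (z z' : C).
Hypothesis (hM : hermm M) (hz' : 0 < complex.Im z') (hz : 0 < complex.Im z).

Lemma res_diff_same :
  res z' M - res z M = (z' - z) *: (res z' M *m res z M).
Proof. by rewrite res_diff // subrr add0r mul_mx_scalar -scalemxAl. Qed.

Lemma res_diff_same' :
  res z' M - res z M = (z' - z) *: (res z M *m res z' M).
Proof.
by rewrite -opprB res_diff // subrr add0r mul_mx_scalar -scalemxAl -scaleNr opprB.
Qed.

Lemma res_lipschitz v w : vnorm v <= 1 -> vnorm w <= 1 ->
  normc (sesq v (res z' M) w - sesq v (res z M) w) <=
  normc (z' - z) / (complex.Im z * complex.Im z').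
Proof.
move=> hv hw; rewrite -sesqBm res_diff_same sesqZm normcM.
apply: ler_wpM2l; first exact: normc_ge0.
apply: le_trans (sesq_mul_le _ _ _ _) _.
have h1 := res_adj_norm hM hz' v; have h2 := res_norm hM hz w.
rewrite invfM mulrC; apply: ler_pM; rewrite ?sqrtr_ge0 //.
  by rewrite -[_^-1]mul1r ler_pdivlMr //; exact: le_trans h2 hw.
by rewrite -[_^-1]mul1r ler_pdivlMr //; exact: le_trans h1 hv.
Qed.

Hypothesis (hre : complex.Re z = complex.Re z') (him : complex.Im z' <= complex.Im z).

Let hzz : normc (z' - z) = complex.Im z - complex.Im z'.
Proof.
have -> : z' - z = (complex.Im z' - complex.Im z)%:C%C * 'i%C.
  by move: hre; case: (z) => a b; case: (z') => c d /= <-; simpc; congr (_ +i* _)%C; ring.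
rewrite normcM normc_real /= expr0n expr1n /= add0r sqrtr1 mulr1.
by rewrite distrC ger0_norm // subr_ge0.
Qed.

(** With y = G(z)^* v, the vector G(z')^* v is y plus conj(z' - z) times G(z')^* y, whose norm is at
    most |y| / Im z'. As |z' - z| = Im z - Im z', the norm grows at most by the ratio of the
    imaginary parts. *)
Lemma res_scale_adj_norm v :
  vnorm (adjm (res z' M) *m v) * complex.Im z' <=
  vnorm (adjm (res z M) *m v) * complex.Im z.
Proof.
have -> : adjm (res z' M) *m v = adjm (res z M) *m v +
   conjc (z' - z) *: (adjm (res z' M) *m (adjm (res z M) *m v)).
  have e : res z' M = res z M + (z' - z) *: (res z M *m res z' M).
    by rewrite -res_diff_same' addrC subrK.
  by rewrite {1}e adjmD adjmZ adjmM mulmxDl -scalemxAl mulmxA.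
set y := adjm (res z M) *m v.
apply: le_trans (ler_wpM2r (ltW hz') (vnormD _ _)) _.
rewrite vnormZ normc_conj hzz mulrDl.
have h := res_adj_norm hM hz' y.
have h2 := ler_wpM2l (_ : 0 <= complex.Im z - complex.Im z') h.
rewrite subr_ge0 in h2; move: (h2 him); rewrite -/(vnorm _) -/(vnorm y); nra.
Qed.

(** The difference of the two entries is (z' - z) <G(z')^* v, G(z) w>. The first vector is at most t
    times as long as G(z)^* v, and Ward's identity at z bounds both lengths through the diagonal
    entries at v and w; this is why those two entries are hypotheses as well. *)
Lemma res_scale (t B : R) v w : complex.Im z <= t * complex.Im z' -> 0 <= B ->
  normc (sesq v (res z M) v) <= B -> normc (sesq w (res z M) w) <= B ->
  normc (sesq v (res z M) w) <= B ->
  normc (sesq v (res z' M) w) <= (1 + t) * B.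
Proof.
move=> ht B0 hv hw hvw.
have e : res z' M = res z M + (z' - z) *: (res z' M *m res z M).
  by rewrite -res_diff_same addrC subrK.
rewrite e sesqDm sesqZm; apply: le_trans (normcD _ _) _.
rewrite [X in _ <= X]mulrDl mul1r; apply: lerD => //.
rewrite normcM hzz.
set a := vnorm (adjm (res z' M) *m v); set b := vnorm (res z M *m w).
apply: (@le_trans _ _ ((complex.Im z - complex.Im z') * (a * b))).
  by apply: ler_wpM2l; [rewrite subr_ge0 | exact: sesq_mul_le].
set eta := complex.Im z; set eta' := complex.Im z'.
set a0 := vnorm (adjm (res z M) *m v).
have h1 : a * eta' <= a0 * eta by exact: res_scale_adj_norm.
have h2 : a0 ^+ 2 * eta <= B.
  rewrite vnorm_sq ward_adj //; apply: le_trans (ler_norm _) _.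
  exact: le_trans (Im_le_normc _) hv.
have h3 : b ^+ 2 * eta <= B.
  rewrite vnorm_sq ward //; apply: le_trans (ler_norm _) _.
  exact: le_trans (Im_le_normc _) hw.
have a0' : 0 <= a by exact: vnorm_ge0.
have b0' : 0 <= b by exact: vnorm_ge0.
have a00 : 0 <= a0 by exact: vnorm_ge0.
clearbody a b a0.
have h4 : a <= t * a0.
  rewrite -(ler_pM2r hz'); apply: le_trans h1 _.
  have -> : t * a0 * complex.Im z' = a0 * (t * complex.Im z') by ring.
  exact: ler_wpM2l.
have t0 : 0 <= t.
  by rewrite -(pmulr_lge0 _ hz'); apply: le_trans ht; exact: ltW.
have h5 : a0 * b * eta <= B.
  have : a0 * b *+ 2 <= a0 ^+ 2 + b ^+ 2.
    by rewrite -subr_ge0 addrAC -sqrrB sqr_ge0.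
  rewrite -(ler_pM2r hz) -/eta; lra.
have h6 : a * b <= t * a0 * b by apply: ler_wpM2r.
have h7 : (eta - eta') * (a * b) <= eta * (t * a0 * b).
  apply: ler_pM => //; [by rewrite subr_ge0 | exact: mulr_ge0 | by rewrite gerBl ltW].
apply: le_trans h7 _.
have -> : eta * (t * a0 * b) = t * (a0 * b * eta) by ring.
exact: ler_wpM2l.
Qed.

End Scale.

End Resolvent.

Ltac nneg := repeat match goal with
  | |- is_true (0 <= _ * _) => apply: mulr_ge0
  | |- is_true (0 <= _ ^+ _) => apply: exprn_ge0
  | |- is_true (0 <= _ + _) => apply: addr_ge0
  | |- is_true (0 <= _%:R) => exact: ler0n
  | |- is_true (0 <= _ ^-1) => rewrite invr_ge0
  | |- is_true (0 <= normc _) => exact: normc_ge0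
  | |- is_true (0 <= vnorm _) => exact: vnorm_ge0
  | |- is_true (0 <= `|_|) => exact: normr_ge0
  | |- is_true (0 <= Num.sqrt _) => exact: sqrtr_ge0
  end; try assumption; try (by apply: ltW); try by [].

(** * Perturbation of one matrix entry *)

Section PowerDiff.
Variable R : realDomainType.

Lemma pow_diff1 (a b Y : R) m : `|a| <= Y -> `|b| <= Y ->
  `|b ^+ m.+1 - a ^+ m.+1| <= m.+1%:R * `|b - a| * Y ^+ m.
Proof.
move=> ha hb; have Y0 : 0 <= Y by apply: le_trans ha.
elim: m => [|m IH]; first by rewrite !expr1 expr0 mul1r mulr1.
have -> : b ^+ m.+2 - a ^+ m.+2 = b * (b ^+ m.+1 - a ^+ m.+1) + (b - a) * a ^+ m.+1.
  by rewrite [b ^+ m.+2]exprS [a ^+ m.+2]exprS; ring.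
apply: le_trans (ler_normD _ _) _.
rewrite [X in _ <= X](_ : _ = m.+1%:R * `|b - a| * Y ^+ m.+1 + `|b - a| * Y ^+ m.+1).
apply: lerD; rewrite normrM.
  apply: (@le_trans _ _ (Y * (m.+1%:R * `|b - a| * Y ^+ m))).
    by apply: ler_pM.
  by rewrite exprS mulrCA.
- by apply: ler_wpM2l => //; rewrite normrX lerXn2r ?nnegrE.
by rewrite [m.+2%:R]mulrSr; ring.
Qed.

Lemma pow_diff2 (a b Y : R) m : `|a| <= Y -> `|b| <= Y ->
  `|b ^+ m.+2 - a ^+ m.+2 - m.+2%:R * a ^+ m.+1 * (b - a)| <=
  m.+2%:R ^+ 2 * `|b - a| ^+ 2 * Y ^+ m.
Proof.
move=> ha hb; have Y0 : 0 <= Y by apply: le_trans ha.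
elim: m => [|m IH].
  have -> : b ^+ 2 - a ^+ 2 - 2 * a ^+ 1 * (b - a) = (b - a) ^+ 2 by ring.
  by rewrite normrX expr0 mulr1 ler_peMl ?exprn_ge0 //; lra.
have -> : b ^+ m.+3 - a ^+ m.+3 - m.+3%:R * a ^+ m.+2 * (b - a) =
   b * (b ^+ m.+2 - a ^+ m.+2 - m.+2%:R * a ^+ m.+1 * (b - a)) +
   m.+2%:R * a ^+ m.+1 * (b - a) ^+ 2.
  by rewrite [m.+3%:R]mulrSr (exprS _ m.+2) (exprS a m.+2) (exprS a m.+1); ring.
apply: le_trans (ler_normD _ _) _.
apply: (@le_trans _ _ (Y * (m.+2%:R ^+ 2 * `|b - a| ^+ 2 * Y ^+ m) +
        m.+2%:R * Y ^+ m.+1 * `|b - a| ^+ 2)).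
  apply: lerD; rewrite !normrM; first exact: ler_pM.
  rewrite !normrX normr_nat; apply: ler_wpM2r; first by rewrite mulr_ge0.
  by apply: ler_wpM2l => //; rewrite lerXn2r ?nnegrE.
rewrite [X in X + _](_ : _ = m.+2%:R ^+ 2 * (`|b - a| ^+ 2 * Y ^+ m.+1)); last first.
  by rewrite (exprS Y m); ring.
rewrite [X in _ + X](_ : _ = m.+2%:R * (`|b - a| ^+ 2 * Y ^+ m.+1)); last by ring.
rewrite -mulrDl -[X in _ <= X]mulrA; apply: ler_wpM2r.
  by rewrite mulr_ge0 ?exprn_ge0.
rewrite [m.+3%:R]mulrSr; set k := m.+2%:R : R.
have : 0 <= k by [].
nra.
Qed.

End PowerDiff.

(** * Test vectors and rank-two perturbations *)

Section Vectors.
Variable R : rcfType.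
Local Notation C := R[i].
Variable n : nat.
Implicit Types (A B : 'M[C]_n) (v w u y : 'cV[C]_n) (c : 'I_n -> 'I_n -> C).

(* Test vectors encoding sums weighted by conj(v_i) c_ij as sesquilinear forms, see [sesq_lvec]. *)
Definition lvec v c j : 'cV[C]_n := \col_k (v k 0 * conjc (c k j)).
Definition rvec v c j : 'cV[C]_n := \col_k (conjc (v k 0) * c k j).

Lemma sesq_lvec v c j A w :
  sesq (lvec v c j) A w = \sum_i conjc (v i 0) * c i j * sesq (basis R i) A w.
Proof.
rewrite sesq_suml; apply: eq_bigr => i _.
by rewrite mxE rmorphM /= conjcK.
Qed.

Lemma sesq_rvec v c j A w :
  sesq w A (rvec v c j) = \sum_i conjc (v i 0) * c i j * sesq w A (basis R i).
Proof. by rewrite sesq_sumr; apply: eq_bigr => i _; rewrite mxE mulrC. Qed.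

Lemma sesq_lvec_conj v c j A w :
  \sum_i conjc (v i 0) * c i j * conjc (sesq w A (basis R i)) =
  conjc (sesq w A (lvec v c j)).
Proof.
rewrite sesq_sumr rmorph_sum; apply: eq_bigr => i _.
by rewrite mxE !rmorphM /= conjcK mulrC.
Qed.

Lemma sesq_rvec_conj v c j A w :
  \sum_i conjc (v i 0) * c i j * conjc (sesq (basis R i) A w) =
  conjc (sesq (rvec v c j) A w).
Proof.
rewrite sesq_suml rmorph_sum; apply: eq_bigr => i _.
by rewrite mxE !rmorphM /= !conjcK.
Qed.

Lemma nM_le (a b : C) (p q : R) : normc a <= p -> normc b <= q ->
  normc (a * b) <= p * q.
Proof. by move=> h1 h2; rewrite normcM ler_pM ?normc_ge0. Qed.

Lemma nD_le (a b : C) (p q : R) : normc a <= p -> normc b <= q ->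
  normc (a + b) <= p + q.
Proof. by move=> h1 h2; apply: le_trans (normcD _ _) _; apply: lerD. Qed.

Lemma normc_nat k : normc (k%:R : C) = k%:R.
Proof. by rewrite -[k%:R](rmorph_nat (real_complex R)) normc_real ger0_norm. Qed.

Lemma avg_le (F : 'I_n -> C) (B : R) : (0 < n)%N ->
  (forall l, normc (F l) <= B) -> normc (n%:R^-1 * \sum_l F l) <= B.
Proof.
move=> n0 h; rewrite normcM normcV normc_nat ler_pdivrMl ?ltr0n //.
apply: le_trans (normc_sum _ _ _) _.
apply: le_trans (ler_sum _ (fun l _ => h l)) _.
by rewrite sumr_const card_ord mulr_natl.
Qed.

(** The form of A D B for the change D of one matrix entry and its mirror image, already split into
    rank-one parts ([ptE]). The switch b will be 1 off the diagonal and 0 on it, so that a diagonal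
    entry is not counted twice. *)
Definition pt (b x : C) i j A B (u y : 'cV[C]_n) : C :=
  b * x * (sesq u A (basis R i) * sesq (basis R j) B y) +
  conjc x * (sesq u A (basis R j) * sesq (basis R i) B y).

Definition Dmx (b x : C) (i j : 'I_n) : 'M[C]_n :=
  (b * x) *: delta_mx i j + conjc x *: delta_mx j i.

Lemma ptE b x i j A B u y : sesq u (A *m Dmx b x i j *m B) y = pt b x i j A B u y.
Proof.
rewrite /Dmx mulmxDr mulmxDl sesqDm -!scalemxAr -!scalemxAl !sesqZm.
by rewrite !sesq_delta.
Qed.

(** The free factor q is taken to be 1 or |z|: in the second case the left entry absorbs it, by the
    weight in [good]. *)
Lemma pt_le (q a c : R) b x i j A B u y : 0 <= q -> normc b <= 1 ->
  q * normc (sesq u A (basis R i)) <= a -> q * normc (sesq u A (basis R j)) <= a ->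
  normc (sesq (basis R j) B y) <= c -> normc (sesq (basis R i) B y) <= c ->
  q * normc (pt b x i j A B u y) <= 2 * normc x * a * c.
Proof.
move=> q0 hb h1 h2 h3 h4.
have a0 : 0 <= a by apply: le_trans h1; rewrite mulr_ge0 ?normc_ge0.
apply: le_trans (ler_wpM2l q0 (normcD _ _)) _.
rewrite !normcM normc_conj.
have x0 := normc_ge0 x.
have e1 : q * normc (sesq u A (basis R i)) * normc (sesq (basis R j) B y) <= a * c.
  by apply: ler_pM; rewrite ?mulr_ge0 ?normc_ge0.
have e2 : q * normc (sesq u A (basis R j)) * normc (sesq (basis R i) B y) <= a * c.
  by apply: ler_pM; rewrite ?mulr_ge0 ?normc_ge0.
have e3 := ler_wpM2l x0 e1; have e4 := ler_wpM2l x0 e2.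
have e5 : normc b * (normc x * (q * normc (sesq u A (basis R i)) * normc (sesq (basis R j) B y)))
   <= 1 * (normc x * (a * c)).
  by apply: ler_pM; rewrite ?normc_ge0 ?mulr_ge0 ?normc_ge0.
move: e4 e5; lra.
Qed.

(** Unlike in [pt_le], the entries on the right are kept: their sum over the index pairs is what
    Ward's identity controls later. *)
Lemma pt_le_struct (a : R) b x i j A B u y : normc b <= 1 ->
  normc (sesq u A (basis R i)) <= a -> normc (sesq u A (basis R j)) <= a ->
  normc (pt b x i j A B u y) <=
  normc x * a * (normc (sesq (basis R i) B y) + normc (sesq (basis R j) B y)).
Proof.
move=> hb h1 h2.
apply: le_trans (normcD _ _) _; rewrite !normcM normc_conj.
have x0 := normc_ge0 x.
have e1 := ler_wpM2r (normc_ge0 (sesq (basis R j) B y)) h1.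
have e2 := ler_wpM2r (normc_ge0 (sesq (basis R i) B y)) h2.
have e3 := ler_wpM2l x0 e1; have e4 := ler_wpM2l x0 e2.
have e5 : normc b * (normc x * (normc (sesq u A (basis R i)) * normc (sesq (basis R j) B y)))
   <= 1 * (normc x * (a * normc (sesq (basis R j) B y))).
  by apply: ler_pM; rewrite ?normc_ge0 ?mulr_ge0 ?normc_ge0.
move: e4 e5; lra.
Qed.

(** The weight 1 + |z| makes K a bound for the entries of both G and z G. *)
Definition good (K : R) (z : C) (F : seq 'cV[C]_n) A :=
  all (fun x => all (fun y => normc (sesq x A y) * (1 + normc z) <= K) F) F.

Lemma goodP K z F A x y : good K z F A -> x \in F -> y \in F ->
  normc (sesq x A y) * (1 + normc z) <= K.
Proof. by move=> /allP h hx hy; have /allP := h x hx; apply. Qed.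

Lemma good1 K z F A x y : good K z F A -> x \in F -> y \in F ->
  normc (sesq x A y) <= K.
Proof.
move=> h hx hy; apply: le_trans (goodP h hx hy).
by rewrite ler_peMr ?normc_ge0 // lerDl normc_ge0.
Qed.

Lemma goodz K z F A x y : good K z F A -> x \in F -> y \in F ->
  normc z * normc (sesq x A y) <= K.
Proof.
move=> h hx hy; apply: le_trans (goodP h hx hy).
by rewrite mulrC ler_wpM2l ?normc_ge0 // lerDr.
Qed.

End Vectors.

(** * Variation of the error [fD] and of its powers when one entry changes *)

Section Perturbation.
Variable R : rcfType.
Local Notation C := R[i].
Variable n : nat.
Variables (z : C) (s : 'I_n -> 'I_n -> R) (v w : 'cV[C]_n).
Implicit Types (G : 'M[C]_n) (i j l : 'I_n) (x b : C).

Local Notation e := (basis R).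
Definition cof k l : C := (s k l)%:C%C.
Definition lv l := lvec v cof l.

(* [fD G] is <v, (1 + z G + S[G] G) w>, the error in the self-consistent equation; [s] is n times the variance profile. *)
Definition fD G : C :=
  (adjm v *m w) 0 0 + z * sesq v G w + n%:R^-1 * \sum_l G l l * sesq (lv l) G w.

Definition Wc G u : C := z * sesq v G u + n%:R^-1 * \sum_l G l l * sesq (lv l) G u.

(** The derivative of [fD] at G in the direction of the rank-one product of the column G p and the
    row q^* G. *)
Definition cD (p q : 'cV[C]_n) G : C :=
  Wc G p * sesq q G w + n%:R^-1 * \sum_l sesq (e l) G p * sesq q G (e l) * sesq (lv l) G w.

(* coefficients of x and of conj x in the first-order variation of [fD] *)
Definition aD b G i j : C := - (b * cD (e i) (e j) G).
Definition bD G i j : C := - cD (e j) (e i) G.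

(** [fD] is quadratic in G. What is left beyond the linear terms is the product of two first-order
    differences, and terms linear in the second-order remainder r of the resolvent. *)
Lemma fD_lin b x G0 G1 i j :
  let G := G1 - G0 in
  (forall p q, sesq p G q = - pt b x i j G0 G0 p q + pt b x i j (G0 *m Dmx b x i j *m G0) G1 p q) ->
  let r p q := pt b x i j (G0 *m Dmx b x i j *m G0) G1 p q in
  fD G1 - fD G0 - (aD b G0 i j * x + bD G0 i j * conjc x) =
  z * r v w + n%:R^-1 * \sum_l (sesq (e l) G (e l) * sesq (lv l) G w +
     r (e l) (e l) * sesq (lv l) G0 w + G0 l l * r (lv l) w).
Proof.
move=> G hG r.
have hr p q : r p q = sesq p G q + pt b x i j G0 G0 p q by rewrite hG addrAC addNr add0r.
under eq_bigr => l _ do rewrite !hr.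
rewrite hr.
have -> : aD b G0 i j * x + bD G0 i j * conjc x =
  - (z * pt b x i j G0 G0 v w) - n%:R^-1 * \sum_l
    (G0 l l * pt b x i j G0 G0 (lv l) w + pt b x i j G0 G0 (e l) (e l) * sesq (lv l) G0 w).
  rewrite /aD /bD /cD /Wc /pt big_split /=.
  have E1 : \sum_l G0 l l *
     (b * x * (sesq (lv l) G0 (e i) * sesq (e j) G0 w) +
      conjc x * (sesq (lv l) G0 (e j) * sesq (e i) G0 w)) =
     b * x * ((\sum_l G0 l l * sesq (lv l) G0 (e i)) * sesq (e j) G0 w) +
     conjc x * ((\sum_l G0 l l * sesq (lv l) G0 (e j)) * sesq (e i) G0 w).
    rewrite !mulr_suml !mulr_sumr -big_split /=; apply: eq_bigr => l _; ring.
  have E2 : \sum_l (b * x * (sesq (e l) G0 (e i) * sesq (e j) G0 (e l)) +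
      conjc x * (sesq (e l) G0 (e j) * sesq (e i) G0 (e l))) * sesq (lv l) G0 w =
    b * x * (\sum_l sesq (e l) G0 (e i) * sesq (e j) G0 (e l) * sesq (lv l) G0 w) +
    conjc x * (\sum_l sesq (e l) G0 (e j) * sesq (e i) G0 (e l) * sesq (lv l) G0 w).
    rewrite !mulr_sumr -big_split /=; apply: eq_bigr => l _; ring.
  rewrite E1 E2; ring.
rewrite /fD.
have -> : \sum_l (sesq (e l) G (e l) * sesq (lv l) G w +
     (sesq (e l) G (e l) + pt b x i j G0 G0 (e l) (e l)) * sesq (lv l) G0 w +
     G0 l l * (sesq (lv l) G w + pt b x i j G0 G0 (lv l) w)) =
  \sum_l G1 l l * sesq (lv l) G1 w - \sum_l G0 l l * sesq (lv l) G0 w +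
  \sum_l (G0 l l * pt b x i j G0 G0 (lv l) w + pt b x i j G0 G0 (e l) (e l) * sesq (lv l) G0 w).
  rewrite -sumrB -big_split /=; apply: eq_bigr => l _.
  by rewrite !sesqBm !sesq_basis; ring.
rewrite sesqBm; ring.
Qed.

Variable F : seq 'cV[C]_n.
Hypothesis n0 : (0 < n)%N.
Hypothesis Fe : forall i, e i \in F.
Hypothesis Fv : v \in F.
Hypothesis Fw : w \in F.
Hypothesis Fl : forall l, lv l \in F.
Variable K : R.
Hypothesis K1 : 1 <= K.

Let K0 : 0 <= K. Proof. by apply: le_trans K1. Qed.
Let KK : K <= K ^+ 2. Proof. by rewrite expr2 ler_peMl. Qed.

Lemma Wc_le G u : good K z F G -> u \in F -> normc (Wc G u) <= 2 * K ^+ 2.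
Proof.
move=> gG hx.
have h1 := goodz gG Fv hx; rewrite -normcM in h1.
have h2 : normc (n%:R^-1 * \sum_l G l l * sesq (lv l) G u) <= K ^+ 2.
  apply: avg_le => // l; rewrite expr2; apply: nM_le; last exact: (good1 gG).
  by rewrite -sesq_basis; exact: (good1 gG).
apply: le_trans (nD_le h1 h2) _; move: KK; lra.
Qed.

Lemma cD_le G p q : good K z F G -> p \in F -> q \in F ->
  normc (cD p q G) <= 3 * K ^+ 3.
Proof.
move=> gG hp hq.
have h1 : normc (Wc G p * sesq q G w) <= 2 * K ^+ 2 * K.
  by apply: nM_le; [exact: Wc_le | exact: (good1 gG)].
have h2 : normc (n%:R^-1 * \sum_l sesq (e l) G p * sesq q G (e l) * sesq (lv l) G w) <= K * K * K.
  by apply: avg_le => // l; do 2 (apply: nM_le; last exact: (good1 gG)); exact: (good1 gG).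
apply: le_trans (nD_le h1 h2) _; move: KK; lra.
Qed.

Lemma fD_le G : good K z F G -> normc ((adjm v *m w) 0 0) <= 1 ->
  normc (fD G) <= 3 * K ^+ 2.
Proof.
move=> gG h; rewrite /fD -addrA; apply: le_trans (nD_le h (Wc_le gG Fw)) _.
move: KK K1; lra.
Qed.

Section Two.
Variables (b x : C) (i j : 'I_n) (G0 G1 : 'M[C]_n).
Hypothesis (hb : normc b <= 1).
Hypothesis (g0 : good K z F G0) (g1 : good K z F G1).
Hypothesis hd1 : G1 - G0 = - (G1 *m Dmx b x i j *m G0).
Hypothesis hd0 : G1 - G0 = - (G0 *m Dmx b x i j *m G1).
Let a := normc x.
Let a0 : 0 <= a. Proof. exact: normc_ge0. Qed.
Let r p q := pt b x i j (G0 *m Dmx b x i j *m G0) G1 p q.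

(** The resolvent identity, applied once more to the factor G1 on its own right-hand side. *)
Lemma second_order p q : sesq p (G1 - G0) q = - pt b x i j G0 G0 p q + r p q.
Proof.
rewrite hd0 sesqNm /r -!ptE -sesqNm -sesqNm -sesqDm; congr sesq.
have e1 : G1 = G0 - G0 *m Dmx b x i j *m G1 by rewrite -hd0 addrC subrK.
by rewrite {1}e1 mulmxBr opprB addrC !mulmxA.
Qed.

Let pt00_le (q : R) u y : 0 <= q -> (forall u', u' \in F -> q * normc (sesq u G0 u') <= K) ->
  y \in F -> q * normc (pt b x i j G0 G0 u y) <= 2 * a * K * K.
Proof. by move=> q0 h hy; apply: pt_le => //; try exact: h; exact: (good1 g0). Qed.

Let r_le (q : R) u y : 0 <= q -> (forall u', u' \in F -> q * normc (sesq u G0 u') <= K) ->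
  y \in F -> q * normc (r u y) <= 4 * a ^+ 2 * K ^+ 3.
Proof.
move=> q0 h hy.
have -> : 4 * a ^+ 2 * K ^+ 3 = 2 * a * (2 * a * K * K) * K by ring.
by apply: pt_le => //; rewrite ?ptE; try exact: pt00_le; exact: (good1 g1).
Qed.

Let G_le (q : R) u y : 0 <= q -> (forall u', u' \in F -> q * normc (sesq u G0 u') <= K) ->
  y \in F -> q * normc (sesq u (G1 - G0) y) <= 2 * a * K ^+ 2.
Proof.
move=> q0 h hy; rewrite hd0 sesqNm normcNE ptE expr2 mulrA.
by apply: pt_le => //; try exact: h; exact: (good1 g1).
Qed.

Let q1 u : u \in F -> forall u', u' \in F -> 1 * normc (sesq u G0 u') <= K.
Proof. by move=> hu u' hu'; rewrite mul1r; exact: (good1 g0). Qed.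

Let qz u : u \in F -> forall u', u' \in F -> normc z * normc (sesq u G0 u') <= K.
Proof. by move=> hu u' hu'; exact: (goodz g0). Qed.

Let G_le1 u y : u \in F -> y \in F -> normc (sesq u (G1 - G0) y) <= 2 * a * K ^+ 2.
Proof. by move=> hu hy; rewrite -[normc _]mul1r; apply: G_le (q1 hu) hy. Qed.

Let r_le1 u y : u \in F -> y \in F -> normc (r u y) <= 4 * a ^+ 2 * K ^+ 3.
Proof. by move=> hu hy; rewrite -[normc _]mul1r; apply: r_le (q1 hu) hy. Qed.

Lemma fD_diff_le : normc (fD G1 - fD G0) <= 6 * a * K ^+ 3.
Proof.
have -> : fD G1 - fD G0 = z * sesq v (G1 - G0) w + n%:R^-1 * \sum_l
    (sesq (e l) (G1 - G0) (e l) * sesq (lv l) G1 w + sesq (e l) G0 (e l) * sesq (lv l) (G1 - G0) w).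
  have -> : \sum_l (sesq (e l) (G1 - G0) (e l) * sesq (lv l) G1 w +
      sesq (e l) G0 (e l) * sesq (lv l) (G1 - G0) w) =
     \sum_l G1 l l * sesq (lv l) G1 w - \sum_l G0 l l * sesq (lv l) G0 w.
    by rewrite -sumrB; apply: eq_bigr => l _; rewrite !sesqBm !sesq_basis; ring.
  by rewrite /fD sesqBm; ring.
have h1 : normc (z * sesq v (G1 - G0) w) <= 2 * a * K ^+ 2.
  by rewrite normcM; apply: G_le (qz Fv) Fw; exact: normc_ge0.
have h2 : normc (n%:R^-1 * \sum_l
    (sesq (e l) (G1 - G0) (e l) * sesq (lv l) G1 w + sesq (e l) G0 (e l) * sesq (lv l) (G1 - G0) w))
    <= 2 * a * K ^+ 2 * K + K * (2 * a * K ^+ 2).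
  apply: avg_le => // l; apply: nD_le; apply: nM_le; try exact: G_le1.
    exact: (good1 g1).
  exact: (good1 g0).
apply: le_trans (nD_le h1 h2) _.
have : 0 <= a * K ^+ 2 * (K - 1) by rewrite !mulr_ge0 ?exprn_ge0 ?subr_ge0.
rewrite (exprS K 2); lra.
Qed.

Lemma fD_second_le : normc (fD G1 - fD G0 - (aD b G0 i j * x + bD G0 i j * conjc x)) <=
  16 * a ^+ 2 * K ^+ 4.
Proof.
rewrite (fD_lin second_order).
have h1 : normc (z * r v w) <= 4 * a ^+ 2 * K ^+ 3.
  by rewrite normcM; apply: r_le (qz Fv) Fw; exact: normc_ge0.
have h2 : normc (n%:R^-1 * \sum_l (sesq (e l) (G1 - G0) (e l) * sesq (lv l) (G1 - G0) w +
     r (e l) (e l) * sesq (lv l) G0 w + G0 l l * r (lv l) w)) <=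
   (2 * a * K ^+ 2) * (2 * a * K ^+ 2) + (4 * a ^+ 2 * K ^+ 3) * K + K * (4 * a ^+ 2 * K ^+ 3).
  apply: avg_le => // l; apply: nD_le; first apply: nD_le; apply: nM_le;
    try exact: G_le1; try exact: r_le1; first exact: (good1 g0).
  by rewrite -sesq_basis; exact: (good1 g0).
apply: le_trans (nD_le h1 h2) _.
have : 0 <= a ^+ 2 * K ^+ 3 * (K - 1) by rewrite !mulr_ge0 ?exprn_ge0 ?subr_ge0.
rewrite (exprS K 3); lra.
Qed.

Let A1 := normc (sesq (e i) G1 w) + normc (sesq (e j) G1 w).
Let A0 := normc (sesq (e i) G0 w) + normc (sesq (e j) G0 w).

Let A1_ge0 : 0 <= A1. Proof. by rewrite addr_ge0 ?normc_ge0. Qed.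

Hypothesis haK : 2 * a * K <= 1.

(** The expansion is made around G0, while Ward's identity will be summed for G1, so the entries at
    G0 have to be traded for those at G1. The resolvent identity does it with an error 2 a K A1 <=
    A1. *)
Lemma A0_le : A0 <= 2 * A1.
Proof.
have h u : u \in F -> normc (sesq u G0 w) <= normc (sesq u G1 w) + a * K * A1.
  move=> hu; have -> : G0 = G1 + G0 *m Dmx b x i j *m G1.
    by rewrite -[X in _ + X]opprK -hd0 opprB addrC subrK.
  rewrite sesqDm ptE; apply: le_trans (normcD _ _) _; rewrite lerD2l.
  by apply: pt_le_struct => //; exact: (good1 g0).
have := h _ (Fe i); have := h _ (Fe j).
have : 2 * a * K * A1 <= 1 * A1 by apply: ler_wpM2r.
have eA : A1 = normc (sesq (e i) G1 w) + normc (sesq (e j) G1 w) by [].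
move: eA; rewrite /A0; generalize A1 => A eA; lra.
Qed.

Variable m : nat.
Let X G := complex.Re (fD G).
Definition lin_term G : C :=
  - pt b x i j G G (e j) w * (X G ^+ m.+2)%:C%C +
  sesq (e j) G w * (m.+2%:R * X G ^+ m.+1 *
      complex.Re (aD b G i j * x + bD G i j * conjc x))%:C%C.
(** The factor that multiplies the entry H_ij when one factor of X^(m+3) is expanded. *)
Definition phi G : C := sesq (e j) G w * (X G ^+ m.+2)%:C%C.

Hypothesis hvw : normc ((adjm v *m w) 0 0) <= 1.
Hypothesis hxi : 6 * a * K ^+ 3 <= 1.

(** Three things survive in the bound: a second power of the change a, one factor A1 for Ward's
    identity, and m powers of X for the moment recursion. The other two powers of X are spent on the
    bound 4 K^2. The shift 6 a K^3 lets the same base dominate X at both matrices. *)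
Lemma remainder_le :
  normc (phi G1 - phi G0 - lin_term G0) <=
  200 * m.+2%:R ^+ 2 * K ^+ 6 * a ^+ 2 * A1 * (`|X G1| + 6 * a * K ^+ 3) ^+ m.
Proof.
set xi := 6 * a * K ^+ 3; set Y := `|X G1| + xi; set k : R := m.+2%:R.
have K2 : 1 <= K ^+ 2 by rewrite exprn_ege1.
have K3 : 0 <= K ^+ 3 by rewrite exprn_ge0.
have k2 : 2 <= k by rewrite ler_nat.
have xi0 : 0 <= xi by rewrite mulr_ge0 // mulr_ge0.
have Xd : `|X G1 - X G0| <= xi.
  have -> : X G1 - X G0 = complex.Re (fD G1 - fD G0) by rewrite /X ReD ReN.
  exact: le_trans (Re_le_normc _) fD_diff_le.
have X1 : `|X G1| <= Y by rewrite lerDl.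
have X0 : `|X G0| <= Y.
  rewrite -[X G0](subKr (X G1)); apply: le_trans (ler_normB _ _) _.
  by rewrite lerD2l.
have Y0 : 0 <= Y by apply: le_trans X1.
have YK : Y <= 4 * K ^+ 2.
  have : `|X G1| <= 3 * K ^+ 2.
    by apply: le_trans (Re_le_normc _) _; exact: fD_le.
  rewrite /Y; move: hxi; rewrite -/xi; lra.
have Ym : 0 <= Y ^+ m by rewrite exprn_ge0.
set L := pt b x i j G0 G0 (e j) w.
(* Three sources of second order: the remainder of the resolvent entry, the product of two
   first-order variations, and the remainder of the power of X. *)
have e1 : phi G1 - phi G0 - lin_term G0 =
   r (e j) w * (X G1 ^+ m.+2)%:C%C - L * (X G1 ^+ m.+2 - X G0 ^+ m.+2)%:C%C +
   sesq (e j) G0 w * (X G1 ^+ m.+2 - X G0 ^+ m.+2 - k * X G0 ^+ m.+1 *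
      complex.Re (aD b G0 i j * x + bD G0 i j * conjc x))%:C%C.
  rewrite /phi /lin_term -/L -/k.
  have -> : sesq (e j) G1 w = sesq (e j) G0 w + (- L + r (e j) w).
    by rewrite -second_order sesqBm addrC subrK.
  rewrite !rmorphB /=; ring.
have hr : normc (r (e j) w) <= 2 * a ^+ 2 * K ^+ 2 * A1.
  have -> : 2 * a ^+ 2 * K ^+ 2 * A1 = a * (2 * a * K * K) * A1 by ring.
  by apply: pt_le_struct => //; rewrite ptE -[normc _]mul1r; apply: pt00_le (q1 (Fe j)) (Fe _).
have hL : normc L <= a * K * (2 * A1).
  apply: le_trans (_ : a * K * A0 <= _); last by rewrite ler_wpM2l ?A0_le ?mulr_ge0.
  by apply: pt_le_struct => //; exact: (good1 g0).
have hg : normc (sesq (e j) G0 w) <= 2 * A1.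
  by apply: le_trans A0_le; rewrite lerDr normc_ge0.
have Q1 : `|X G1 ^+ m.+2| <= 16 * K ^+ 4 * Y ^+ m.
  rewrite normrX; apply: le_trans (_ : Y ^+ m.+2 <= _); first by rewrite lerXn2r ?nnegrE.
  rewrite !exprS mulrA; apply: ler_wpM2r => //.
  have := ler_pM Y0 Y0 YK YK; lra.
have YmK : Y ^+ m.+1 <= 4 * K ^+ 2 * Y ^+ m by rewrite exprS ler_wpM2r.
have Q2 : `|X G1 ^+ m.+2 - X G0 ^+ m.+2| <= k * xi * (4 * K ^+ 2 * Y ^+ m).
  apply: le_trans (pow_diff1 _ X0 X1) _.
  by apply: ler_pM; rewrite ?mulr_ge0 ?exprn_ge0 // ler_wpM2l.
have Q3 : `|X G1 ^+ m.+2 - X G0 ^+ m.+2 - k * X G0 ^+ m.+1 *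
      complex.Re (aD b G0 i j * x + bD G0 i j * conjc x)| <=
   k ^+ 2 * xi ^+ 2 * Y ^+ m + k * (4 * K ^+ 2 * Y ^+ m) * (16 * a ^+ 2 * K ^+ 4).
  set l := complex.Re _.
  have -> : X G1 ^+ m.+2 - X G0 ^+ m.+2 - k * X G0 ^+ m.+1 * l =
     (X G1 ^+ m.+2 - X G0 ^+ m.+2 - k * X G0 ^+ m.+1 * (X G1 - X G0)) +
     k * X G0 ^+ m.+1 * (X G1 - X G0 - l) by ring.
  apply: le_trans (ler_normD _ _) _; apply: lerD.
    apply: le_trans (pow_diff2 _ X0 X1) _; apply: ler_wpM2r => //.
    by apply: ler_wpM2l; rewrite ?exprn_ge0 // lerXn2r ?nnegrE.
  rewrite !normrM normrX; apply: ler_pM; rewrite ?mulr_ge0 ?exprn_ge0 //.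
    rewrite ger0_norm ?ler0n //; apply: ler_wpM2l => //; apply: le_trans YmK.
    by rewrite lerXn2r ?nnegrE.
  have -> : X G1 - X G0 - l = complex.Re (fD G1 - fD G0 - (aD b G0 i j * x + bD G0 i j * conjc x)).
    by rewrite /l /X -!ReN -!ReD.
  exact: le_trans (Re_le_normc _) fD_second_le.
rewrite e1.
apply: le_trans (nD_le (nD_le (nM_le hr (lexx _)) _) (nM_le hg (lexx _))) _.
  by rewrite normcNE; exact: nM_le hL (lexx _).
rewrite !normc_real.
have c1 : 0 <= 2 * a ^+ 2 * K ^+ 2 * A1 by rewrite !mulr_ge0 ?exprn_ge0.
have c2 : 0 <= a * K * (2 * A1) by rewrite !mulr_ge0.
have c3 : 0 <= 2 * A1 by rewrite mulr_ge0.
have := ler_wpM2l c1 Q1; have := ler_wpM2l c2 Q2; have := ler_wpM2l c3 Q3.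
set T := a ^+ 2 * K ^+ 6 * A1 * Y ^+ m.
have T0 : 0 <= T by rewrite !mulr_ge0 ?exprn_ge0.
have -> : 2 * a ^+ 2 * K ^+ 2 * A1 * (16 * K ^+ 4 * Y ^+ m) = 32 * T by rewrite /T; ring.
have -> : a * K * (2 * A1) * (k * xi * (4 * K ^+ 2 * Y ^+ m)) = 48 * k * T by rewrite /T /xi; ring.
have -> : 2 * A1 * (k ^+ 2 * xi ^+ 2 * Y ^+ m + k * (4 * K ^+ 2 * Y ^+ m) * (16 * a ^+ 2 * K ^+ 4))
   = (72 * k ^+ 2 + 128 * k) * T by rewrite /T /xi; ring.
have -> : 200 * k ^+ 2 * K ^+ 6 * a ^+ 2 * A1 * Y ^+ m = 200 * k ^+ 2 * T by rewrite /T; ring.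
(* The contributions add up to 32 + 48 k + 72 k^2 + 128 k, which is at most 200 k^2 since k >= 2. *)
have : 0 <= (128 * k ^+ 2 - 32 - 176 * k) * T.
  by apply: mulr_ge0 => //; nra.
lra.
Qed.

End Two.

End Perturbation.

(** * The linear terms after averaging over one entry, and their cancellation *)

Section Bulk.
Variable R : rcfType.
Local Notation C := R[i].
Variable n : nat.
Variables (z : C) (s : 'I_n -> 'I_n -> R) (tau : 'I_n -> 'I_n -> C) (v w : 'cV[C]_n).
Implicit Types (G : 'M[C]_n) (i j l : 'I_n) (c : 'I_n -> 'I_n -> C).
Local Notation e := (basis R).
Local Notation lv := (lv s v).
Local Notation fD := (fD z s v w).
Local Notation cD := (cD z s v w).
Local Notation aD := (aD z s v w).
Local Notation bD := (bD z s v w).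
Local Notation X G := (complex.Re (fD G)).
Variable m : nat.

(* Off the diagonal the variation of an entry moves two matrix entries, on it only one. *)
Definition offd i j : C := (i != j)%:R.

Lemma conj_half : conjc (2^-1 : C) = 2^-1.
Proof. by rewrite conjc_inv conjc_nat. Qed.

(** Chosen so that the real part of a x + b conj x equals gam x + conj gam conj x. Then the first
    variation of [phi] is a combination of x and conj x, with coefficients [aF] and [bF], although X
    is only a real part. *)
Definition gam G i j : C := 2^-1 * (aD (offd i j) G i j + conjc (bD G i j)).
Definition aF G i j : C :=
  - (offd i j * (sesq (e j) G (e i) * sesq (e j) G w)) * (X G ^+ m.+2)%:C%C +
  sesq (e j) G w * (m.+2%:R * X G ^+ m.+1)%:C%C * gam G i j.
Definition bF G i j : C :=
  - (G j j * sesq (e i) G w) * (X G ^+ m.+2)%:C%C +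
  sesq (e j) G w * (m.+2%:R * X G ^+ m.+1)%:C%C * conjc (gam G i j).

Lemma lin_termE G i j x :
  lin_term z s v w (offd i j) x i j m G = aF G i j * x + bF G i j * conjc x.
Proof.
rewrite /lin_term /pt /aF /bF !sesq_basis.
set a := aD (offd i j) G i j; set b := bD G i j.
have -> : (m.+2%:R * X G ^+ m.+1 * complex.Re (a * x + b * conjc x))%:C%C =
  (m.+2%:R * X G ^+ m.+1)%:C%C * (gam G i j * x + conjc (gam G i j) * conjc x).
  rewrite rmorphM /=; congr (_ * _).
  rewrite ReJ_add /gam -/a -/b !(conjcD, conjcM) conj_half !conjcK; ring.
ring.
Qed.

Variable F : seq 'cV[C]_n.
Hypothesis n0 : (0 < n)%N.
Hypothesis Fe : forall i, e i \in F.
Hypothesis Fv : v \in F.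
Hypothesis Fw : w \in F.
Hypothesis Fl : forall l, lv l \in F.
Variable K : R.
Hypothesis K1 : 1 <= K.

Let K0 : 0 <= K. Proof. by apply: le_trans K1. Qed.

Lemma sum_lin (k : 'I_n -> C) (T : 'I_n -> C) (B : 'I_n -> 'I_n -> C) :
  (forall l, T l = \sum_i k i * B i l) -> \sum_l T l = \sum_i k i * \sum_l B i l.
Proof.
move=> h; under eq_bigr do rewrite h.
by rewrite exchange_big; apply: eq_bigr => i _; rewrite mulr_sumr.
Qed.

Lemma Wc_rvec G c j : Wc z s v G (rvec v c j) = \sum_i conjc (v i 0) * c i j * Wc z s v G (e i).
Proof.
rewrite /Wc (sum_lin (k := fun i => conjc (v i 0) * c i j)
  (B := fun i l => G l l * sesq (lv l) G (e i))); last first.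
  by move=> l; rewrite sesq_rvec mulr_sumr; apply: eq_bigr => i _; rewrite mulrCA.
rewrite sesq_rvec !mulr_sumr -big_split /=; apply: eq_bigr => i _; ring.
Qed.

Lemma Wc_lvec G c j : conjc (Wc z s v G (lvec v c j)) =
  \sum_i conjc (v i 0) * c i j * conjc (Wc z s v G (e i)).
Proof.
rewrite /Wc conjcD !conjcM rmorph_sum (sum_lin (k := fun i => conjc (v i 0) * c i j)
  (B := fun i l => conjc (G l l * sesq (lv l) G (e i)))); last first.
  move=> l; rewrite [LHS]conjcM -sesq_lvec_conj mulr_sumr; apply: eq_bigr => i _.
  by rewrite conjcM mulrCA.
rewrite -sesq_lvec_conj !mulr_sumr -big_split /=; apply: eq_bigr => i _.
rewrite conjcD !conjcM rmorph_sum; ring.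
Qed.

Section Arr.
Variables (c : 'I_n -> 'I_n -> C) (G : 'M[C]_n) (j : 'I_n).
Hypothesis (Fc : lvec v c j \in F) (Fc' : rvec v c j \in F) (gG : good K z F G).
Let k i := conjc (v i 0) * c i j.

(** [cD] depends linearly on its first vector, so the sum over i collapses to one [cD] at the test
    vector [rvec v c j]: N terms cost no more than one. The next three lemmas do the same for the
    conjugate and for the other slot; the conjugation decides between [lvec] and [rvec]. *)
Lemma arr_le1 : normc (\sum_i conjc (v i 0) * c i j * cD (e i) (e j) G) <= 3 * K ^+ 3.
Proof.
have -> : \sum_i conjc (v i 0) * c i j * cD (e i) (e j) G = cD (rvec v c j) (e j) G.
  rewrite /cD (sum_lin (T := fun l => sesq (e l) G (rvec v c j) * _ * _) (k := k)
    (B := fun i l => sesq (e l) G (e i) * sesq (e j) G (e l) * sesq (lv l) G w)); last first.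
    move=> l; rewrite sesq_rvec !mulr_suml; apply: eq_bigr => i _; by rewrite !mulrA.
  rewrite Wc_rvec mulr_suml !mulr_sumr -big_split /=; apply: eq_bigr => i _.
  rewrite /k; ring.
exact: cD_le.
Qed.

Lemma arr_le2 : normc (\sum_i conjc (v i 0) * c i j * conjc (cD (e i) (e j) G)) <= 3 * K ^+ 3.
Proof.
have -> : \sum_i conjc (v i 0) * c i j * conjc (cD (e i) (e j) G) = conjc (cD (lvec v c j) (e j) G).
  rewrite /cD conjcD !conjcM rmorph_sum Wc_lvec.
  rewrite (sum_lin (T := fun l => conjc (sesq (e l) G (lvec v c j) * _ * _)) (k := k)
    (B := fun i l => conjc (sesq (e l) G (e i) * sesq (e j) G (e l) * sesq (lv l) G w))); last first.
    move=> l; rewrite !conjcM -sesq_lvec_conj !mulr_suml; apply: eq_bigr => i _.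
    by rewrite !conjcM /k; ring.
  rewrite mulr_suml !mulr_sumr -big_split /=; apply: eq_bigr => i _.
  rewrite conjcD !conjcM rmorph_sum /k; ring.
by rewrite normc_conj; exact: cD_le.
Qed.

Lemma arr_le3 : normc (\sum_i conjc (v i 0) * c i j * cD (e j) (e i) G) <= 3 * K ^+ 3.
Proof.
have -> : \sum_i conjc (v i 0) * c i j * cD (e j) (e i) G = cD (e j) (lvec v c j) G.
  rewrite /cD (sum_lin (T := fun l => _ * sesq (lvec v c j) G (e l) * _) (k := k)
    (B := fun i l => sesq (e l) G (e j) * sesq (e i) G (e l) * sesq (lv l) G w)); last first.
    move=> l; rewrite sesq_lvec !mulr_sumr !mulr_suml; apply: eq_bigr => i _; rewrite /k; ring.
  rewrite sesq_lvec !mulr_sumr -big_split /=; apply: eq_bigr => i _.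
  rewrite /k; ring.
exact: cD_le.
Qed.

Lemma arr_le4 : normc (\sum_i conjc (v i 0) * c i j * conjc (cD (e j) (e i) G)) <= 3 * K ^+ 3.
Proof.
have -> : \sum_i conjc (v i 0) * c i j * conjc (cD (e j) (e i) G) = conjc (cD (e j) (rvec v c j) G).
  rewrite /cD conjcD !conjcM rmorph_sum.
  rewrite (sum_lin (T := fun l => conjc (_ * sesq (rvec v c j) G (e l) * _)) (k := k)
    (B := fun i l => conjc (sesq (e l) G (e j) * sesq (e i) G (e l) * sesq (lv l) G w))); last first.
    move=> l; rewrite !conjcM -sesq_rvec_conj !mulr_sumr !mulr_suml; apply: eq_bigr => i _.
    by rewrite !conjcM /k; ring.
  rewrite -sesq_rvec_conj !mulr_sumr -big_split /=; apply: eq_bigr => i _.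
  rewrite conjcD !conjcM rmorph_sum /k; ring.
by rewrite normc_conj; exact: cD_le.
Qed.

End Arr.

Local Notation cs := (cof s).
Definition off_arr c i j : C := offd i j * c i j.

Hypothesis FcS : forall j, lvec v cs j \in F /\ rvec v cs j \in F.
Hypothesis FcSo : forall j, lvec v (off_arr cs) j \in F /\ rvec v (off_arr cs) j \in F.
Hypothesis FcT : forall j, lvec v tau j \in F /\ rvec v tau j \in F.
Hypothesis FcTo : forall j, lvec v (off_arr tau) j \in F /\ rvec v (off_arr tau) j \in F.
Hypothesis hvw : normc ((adjm v *m w) 0 0) <= 1.

(** The double sum is what E[H_ij times the linear term] yields, with variances s_ij / n and
    pseudo-variances tau_ij / n. The last term is the S[G] G part of the error, times X^(m+2). *)
Definition bulk G : C :=
  \sum_i \sum_j conjc (v i 0) * (n%:R^-1 * (cs i j * bF G i j + tau i j * aF G i j)) +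
  n%:R^-1 * (\sum_l G l l * sesq (lv l) G w) * (X G ^+ m.+2)%:C%C.

Lemma conj_offd i j : conjc (offd i j) = offd i j.
Proof. exact: conjc_nat. Qed.

(** The part - G_jj <e_i, G w> of [bF], summed against conj(v_i) s_ij, is exactly minus the S[G] G
    term. Every term left has a factor <e_j, G w>, which is averaged over j. *)
Lemma bulkE G : bulk G = n%:R^-1 * \sum_j sesq (e j) G w *
  (- sesq (e j) G (rvec v (off_arr tau) j) * (X G ^+ m.+2)%:C%C +
   (m.+2%:R * X G ^+ m.+1)%:C%C * (2^-1 *
    (- (\sum_i conjc (v i 0) * off_arr cs i j * conjc (cD (e i) (e j) G))
     - (\sum_i conjc (v i 0) * cs i j * cD (e j) (e i) G)
     - (\sum_i conjc (v i 0) * off_arr tau i j * cD (e i) (e j) G)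
     - (\sum_i conjc (v i 0) * tau i j * conjc (cD (e j) (e i) G))))).
Proof.
rewrite /bulk exchange_big /= -mulrA mulr_suml mulr_sumr -big_split /= mulr_sumr.
apply: eq_bigr => j _.
set Q := (X G ^+ m.+2)%:C%C; set Q' := (m.+2%:R * X G ^+ m.+1)%:C%C.
set y := sesq (e j) G w; set nn : C := n%:R^-1; set hf : C := 2^-1.
(* The identity is checked for each i, in the form that all terms sum to zero, and is only then
   split into separate sums. *)
have h : \sum_i (conjc (v i 0) * (nn * (cs i j * bF G i j + tau i j * aF G i j))
  + nn * G j j * Q * (conjc (v i 0) * cs i j * sesq (e i) G w)
  + nn * y * Q * (conjc (v i 0) * off_arr tau i j * sesq (e j) G (e i))
  + nn * y * Q' * hf * (conjc (v i 0) * off_arr cs i j * conjc (cD (e i) (e j) G)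
    + conjc (v i 0) * cs i j * cD (e j) (e i) G
    + conjc (v i 0) * off_arr tau i j * cD (e i) (e j) G
    + conjc (v i 0) * tau i j * conjc (cD (e j) (e i) G))) = 0.
  apply: big1 => i _.
  rewrite /bF /aF /gam /aD /bD /off_arr -/Q -/Q' -/y.
  set c1 := cD (e i) (e j) G; set c2 := cD (e j) (e i) G.
  clearbody c1 c2 Q Q' y.
  rewrite !(conjcM, conjcD, conjcN) conj_half conj_offd !conjcK -/hf.
  ring.
move: h; rewrite !big_split /= -!mulr_sumr !big_split /= => h.
rewrite sesq_rvec /lv sesq_lvec; apply/eqP; rewrite -subr_eq0; apply/eqP; rewrite -[RHS]h.
ring.
Qed.

(** The average of |<e_j, G w>| is deliberately not replaced by K: Cauchy-Schwarz and Ward's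
    identity will show that it is small. *)
Lemma bulk_le G : good K z F G ->
  normc (bulk G) <= 27 * m.+2%:R * K ^+ 5 * `|X G| ^+ m *
     (n%:R^-1 * \sum_j normc (sesq (e j) G w)).
Proof.
move=> gG; rewrite bulkE normcM normcV normc_nat mulrCA.
apply: ler_wpM2l; first by rewrite invr_ge0.
apply: le_trans (normc_sum _ _ _) _; rewrite mulr_sumr; apply: ler_sum => j _.
rewrite normcM mulrC; apply: ler_wpM2r; first exact: normc_ge0.
have XK : `|X G| <= 3 * K ^+ 2.
  by apply: le_trans (Re_le_normc _) _; apply: fD_le gG hvw.
have Xm : 0 <= `|X G| ^+ m by rewrite exprn_ge0.
have [_ r1] := FcTo j.
have h1 : normc (- sesq (e j) G (rvec v (off_arr tau) j) * (X G ^+ m.+2)%:C%C) <=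
   K * (9 * K ^+ 4 * `|X G| ^+ m).
  apply: nM_le; first by rewrite normcNE; exact: (good1 gG).
  rewrite normc_real normrX !exprS mulrA; apply: ler_wpM2r => //.
  have := ler_pM (normr_ge0 _) (normr_ge0 _) XK XK; lra.
have h2 : normc (2^-1 *
    (- (\sum_i conjc (v i 0) * off_arr cs i j * conjc (cD (e i) (e j) G))
     - (\sum_i conjc (v i 0) * cs i j * cD (e j) (e i) G)
     - (\sum_i conjc (v i 0) * off_arr tau i j * cD (e i) (e j) G)
     - (\sum_i conjc (v i 0) * tau i j * conjc (cD (e j) (e i) G)))) <=
   2^-1 * (3 * K ^+ 3 + 3 * K ^+ 3 + 3 * K ^+ 3 + 3 * K ^+ 3).
  rewrite normcM normcV normc_nat; apply: ler_wpM2l; first by rewrite invr_ge0.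
  have [a1 a2] := FcS j; have [a3 a4] := FcSo j; have [a5 a6] := FcT j; have [a7 a8] := FcTo j.
  apply: nD_le; [apply: nD_le; [apply: nD_le|]|]; rewrite normcNE.
  - by apply: arr_le2.
  - by apply: arr_le3.
  - by apply: arr_le1.
  by apply: arr_le4.
have h3 : normc ((m.+2%:R * X G ^+ m.+1)%:C%C) <= m.+2%:R * (3 * K ^+ 2 * `|X G| ^+ m).
  rewrite normc_real normrM ger0_norm ?ler0n // ler_wpM2l // normrX exprS.
  exact: ler_wpM2r.
apply: le_trans (nD_le h1 (nM_le h3 h2)) _.
have c : 0 <= K ^+ 5 * `|X G| ^+ m by rewrite mulr_ge0 // exprn_ge0.
have k1 : 1 <= m.+2%:R :> R by rewrite ler1n.
have := ler_wpM2r c k1.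
lra.
Qed.

End Bulk.

(** * Measurability and resampling of one entry *)

Section ComplexMeasurable.
Context (R : realType) d (T : measurableType d).
Local Notation C := R[i].
Implicit Types f g : T -> C.

Definition cmeas f :=
  measurable_fun setT (fun t => complex.Re (f t)) /\
  measurable_fun setT (fun t => complex.Im (f t)).

Lemma cmeas_cst c : cmeas (fun=> c).
Proof. by split; exact: measurable_cst. Qed.

Lemma cmeas_ext f g : (forall t, f t = g t) -> cmeas f -> cmeas g.
Proof. by move=> h; rewrite (_ : f = g) //; apply: funext. Qed.

Lemma cmeasD f g : cmeas f -> cmeas g -> cmeas (fun t => f t + g t).
Proof.
move=> [f1 f2] [g1 g2]; split.
  by under eq_fun do rewrite ReD; exact: measurable_funD.
by under eq_fun do rewrite ImD; exact: measurable_funD.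
Qed.

Lemma cmeasN f : cmeas f -> cmeas (fun t => - f t).
Proof.
move=> [f1 f2]; split.
  by under eq_fun do rewrite ReN; exact: measurable_funN.
by under eq_fun do rewrite ImN; exact: measurable_funN.
Qed.

Lemma cmeasB f g : cmeas f -> cmeas g -> cmeas (fun t => f t - g t).
Proof. by move=> hf hg; apply: cmeasD => //; exact: cmeasN. Qed.

Lemma cmeasM f g : cmeas f -> cmeas g -> cmeas (fun t => f t * g t).
Proof.
move=> [f1 f2] [g1 g2]; split.
  under eq_fun do rewrite ReM.
  by apply: measurable_funB; exact: measurable_funM.
under eq_fun do rewrite ImM.
by apply: measurable_funD; exact: measurable_funM.
Qed.

Lemma cmeas_conj f : cmeas f -> cmeas (fun t => conjc (f t)).
Proof.
move=> [f1 f2]; split.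
  by under eq_fun do rewrite Re_conj.
by under eq_fun do rewrite Im_conj; exact: measurable_funN.
Qed.

Lemma cmeas_sum (I : Type) (r : seq I) (Q : pred I) (F : I -> T -> C) :
  (forall i, cmeas (F i)) -> cmeas (fun t => \sum_(i <- r | Q i) F i t).
Proof.
move=> h; elim: r => [|i r IH].
  by apply: cmeas_ext (cmeas_cst 0) => t; rewrite big_nil.
apply: (@cmeas_ext (fun t => (if Q i then F i t else 0) + \sum_(j <- r | Q j) F j t)).
  by move=> t; rewrite big_cons; case: (Q i); rewrite ?add0r.
by apply: cmeasD => //; case: (Q i) => //; exact: cmeas_cst.
Qed.

Lemma cmeas_prod (I : Type) (r : seq I) (F : I -> T -> C) :
  (forall i, cmeas (F i)) -> cmeas (fun t => \prod_(i <- r) F i t).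
Proof.
move=> h; elim: r => [|i r IH].
  by apply: cmeas_ext (cmeas_cst 1) => t; rewrite big_nil.
apply: (@cmeas_ext (fun t => F i t * \prod_(j <- r) F j t)).
  by move=> t; rewrite big_cons.
exact: cmeasM.
Qed.

Lemma cmeas_real (f : T -> R) : measurable_fun setT f -> cmeas (fun t => (f t)%:C%C).
Proof. by move=> h; split => //=; exact: measurable_cst. Qed.

Lemma measurable_inv_nneg (f : T -> R) : (forall t, 0 <= f t) ->
  measurable_fun setT f -> measurable_fun setT (fun t => (f t)^-1).
Proof.
move=> f0 mf; under eq_fun do rewrite -powR_inv1 //.
exact: measurableT_comp (measurable_powR _) mf.
Qed.

Lemma measurable_sqrt_nneg (f : T -> R) : (forall t, 0 <= f t) ->
  measurable_fun setT f -> measurable_fun setT (fun t => Num.sqrt (f t)).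
Proof.
move=> f0 mf; under eq_fun do rewrite -powR12_sqrt //.
exact: measurableT_comp (measurable_powR _) mf.
Qed.

Lemma cmeas_normc f : cmeas f -> measurable_fun setT (fun t => normc (f t)).
Proof.
move=> [f1 f2].
rewrite (_ : (fun t => normc (f t)) =
  (fun t => Num.sqrt (complex.Re (f t) ^+ 2 + complex.Im (f t) ^+ 2))); last first.
  by apply: funext => t; case: (f t).
apply: measurable_sqrt_nneg => [t|]; first by rewrite addr_ge0 ?sqr_ge0.
by apply: measurable_funD; exact: measurable_funX.
Qed.

Lemma cmeasV f : cmeas f -> cmeas (fun t => (f t)^-1).
Proof.
move=> hf; apply: (@cmeas_ext (fun t => conjc (f t) * ((normc (f t) ^+ 2)^-1)%:C%C)).
  move=> t; have [->|fn] := eqVneq (f t) 0; first by rewrite invr0 conjc0 mul0r.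
  apply: (mulfI fn); rewrite mulrA mul_conjc -rmorphM /= divff // ?divff //.
  by rewrite expf_neq0 //; apply: contra fn => /eqP /eq0_normc ->.
apply: cmeasM; first exact: cmeas_conj.
apply: cmeas_real; apply: measurable_inv_nneg => [t|]; first by rewrite exprn_ge0 ?normc_ge0.
by apply: measurable_funX; exact: cmeas_normc.
Qed.

Definition mmeas n (M : T -> 'M[C]_n) := forall a b, cmeas (fun t => M t a b).

Lemma cmeas_det n (M : T -> 'M[C]_n) : mmeas M -> cmeas (fun t => \det (M t)).
Proof.
move=> h; apply: cmeas_sum => s; apply: cmeasM; first exact: cmeas_cst.
by apply: cmeas_prod => i; exact: h.
Qed.

Lemma mmeas_adj n (M : T -> 'M[C]_n) : mmeas M -> mmeas (fun t => \adj (M t)).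
Proof.
move=> h a b; apply: (@cmeas_ext (fun t => cofactor (M t) b a)).
  by move=> t; rewrite mxE.
apply: cmeasM; first exact: cmeas_cst.
apply: cmeas_det => c e; apply: cmeas_ext (h (lift b c) (lift a e)) => t.
by rewrite !mxE.
Qed.

Lemma mmeas_res n z (M : T -> 'M[C]_n) : mmeas M -> mmeas (fun t => res z (M t)).
Proof.
move=> h.
have hz : mmeas (fun t => M t - z%:M).
  move=> a b; apply: (@cmeas_ext (fun t => M t a b - (z%:M : 'M[C]_n) a b)).
    by move=> t; rewrite !mxE.
  by apply: cmeasB => //; exact: cmeas_cst.
move=> a b; apply: (@cmeas_ext (fun t => (\det (M t - z%:M))^-1 * (\adj (M t - z%:M)) a b)).
  by move=> t; rewrite res_def [RHS]mxE.
by apply: cmeasM; [exact: cmeasV (cmeas_det hz) | exact: (mmeas_adj hz)].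
Qed.

Lemma cmeas_sesq n v w (M : T -> 'M[C]_n) : mmeas M -> cmeas (fun t => sesq v (M t) w).
Proof.
move=> h; apply: (@cmeas_ext (fun t => \sum_i conjc (v i 0) * \sum_j M t i j * w j 0)).
  move=> t; rewrite sesq_suml; apply: eq_bigr => i _; congr (_ * _).
  by rewrite sesq_basisl mxE.
apply: cmeas_sum => i; apply: cmeasM; first exact: cmeas_cst.
by apply: cmeas_sum => j; apply: cmeasM => //; exact: cmeas_cst.
Qed.

End ComplexMeasurable.

(* The value space of (H_ij, upper triangle of H), to be given the sigma-algebra generated by rectangles. *)
Definition entry_space (R : realType) (N : nat) : Type :=
  ((R * R) * ('I_N -> 'I_N -> R * R))%type.
HB.instance Definition _ R N := gen_eqMixin (entry_space R N).
HB.instance Definition _ R N := gen_choiceMixin (entry_space R N).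
HB.instance Definition _ R N :=
  isPointed.Build (entry_space R N) ((0, 0), fun _ _ => (0, 0)).

(** * Equality of laws under resampling of one entry *)

Section Resample.
Context (R : realType) d (T : measurableType d) (P : probability T R) (N : nat).
Local Notation C := R[i].
Variable H : 'I_N -> 'I_N -> T -> C.
Hypothesis mH : forall i j, measurable_fun setT (fun w => reim (H i j w)).
Hypothesis hH : forall i j w, H j i w = conjc (H i j w).
Hypothesis indep : entries_independent P H.

(* Resampling: the (i, j) and (j, i) entries come from an independent copy of H. *)
Definition rmat2 (i j : 'I_N) (x : T * T) : 'M[C]_N :=
  \matrix_(a, b) (if ((a == i) && (b == j)) || ((a == j) && (b == i))
                  then H a b x.2 else H a b x.1).

Local Notation X := (entry_space R N).
(** Only entries on or above the diagonal are constrained: independence is assumed for them, and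
    they determine the Hermitian matrix. *)
Let rects : set (set X) := [set A | exists (B0 : set (R * R)) (B : 'I_N -> 'I_N -> set (R * R)),
   [/\ measurable B0, (forall a b, measurable (B a b)) &
     A = [set x | B0 x.1 /\ forall a b : 'I_N, (a <= b)%N -> B a b (x.2 a b)]]].
Local Notation XX := (g_sigma_algebraType rects).

Let toC (p : R * R) : C := (p.1 +i* p.2)%C.
Let toM (m : 'I_N -> 'I_N -> R * R) : 'M[C]_N :=
  \matrix_(a, b) (if (a <= b)%N then toC (m a b) else conjc (toC (m b a))).

Let rects_setI : setI_closed rects.
Proof.
move=> A A' [B0 [B [m0 mB ->]]] [B0' [B' [m0' mB' ->]]].
exists (B0 `&` B0'), (fun a b => B a b `&` B' a b); split.
- exact: measurableI.
- by move=> a b; exact: measurableI.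
apply/seteqP; split => x /=.
  by move=> [[h1 h2] [h3 h4]]; split => // a b ab; split; [exact: h2|exact: h4].
by move=> [[h1 h2] h3]; do !split => //; move=> a b ab; have [] := h3 _ _ ab.
Qed.

Let coord0 : measurable_fun setT (fun x : XX => x.1 : R * R).
Proof.
move=> _ B mB; rewrite setTI; apply: sub_sigma_algebra.
exists B, (fun _ _ => setT); split => //.
by apply/seteqP; split => x //= -[].
Qed.

Let coord (a b : 'I_N) : (a <= b)%N -> measurable_fun setT (fun x : XX => x.2 a b : R * R).
Proof.
move=> ab _ B mB; rewrite setTI; apply: sub_sigma_algebra.
exists setT, (fun a' b' => if (a' == a) && (b' == b) then B else setT); split => //.
  by move=> a' b'; case: ifP.
apply/seteqP; split => x /=.
  by move=> h; split => // a' b' _; case: ifP => // /andP [/eqP -> /eqP ->].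
by move=> [_ /(_ _ _ ab)]; rewrite !eqxx.
Qed.

Let cmeas_toC d' (T' : measurableType d') (f : T' -> R * R) :
  measurable_fun setT f -> cmeas (fun t => toC (f t)).
Proof.
by move=> hf; split => /=; [exact: measurableT_comp measurable_fst hf
  | exact: measurableT_comp measurable_snd hf].
Qed.

Let mmeas_toM : mmeas (fun x : XX => toM x.2).
Proof.
move=> a b; have [ab|ba] := leqP a b.
  apply: cmeas_ext (cmeas_toC (coord ab)) => t; by rewrite mxE ab.
apply: cmeas_ext (cmeas_conj (cmeas_toC (coord (ltnW ba)))) => t.
by rewrite mxE leqNgt ba.
Qed.

(** Joint measurability, phrased as stability under composition with measurable maps, so that
    matrices need no sigma-algebra of their own. *)
Definition meas2 (phi : C -> 'M[C]_N -> R) := forall d' (T' : measurableType d')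
  (h : T' -> C) (M : T' -> 'M[C]_N), cmeas h -> mmeas M ->
  measurable_fun setT (fun t => phi (h t) (M t)).

Section Upper.
Variables (i j : 'I_N).
Hypothesis ij : (i <= j)%N.

(** Both maps pair H_ij(x.1) with a matrix that has the law of H and is independent of it: in [Psi1]
    the entry (i, j) alone is taken from x.2, in [Psi2] the whole matrix is. *)
Let Psi1 (x : T * T) : XX := (reim (H i j x.1), fun a b => reim (rmat2 i j x a b)).
Let Psi2 (x : T * T) : XX := (reim (H i j x.1), fun a b => reim (H a b x.2)).

Let rr B0 B : X -> Prop := fun x => B0 x.1 /\ forall a b : 'I_N, (a <= b)%N -> B a b (x.2 a b).

Let Bx (B0 : set (R * R)) (B : 'I_N -> 'I_N -> set (R * R)) (a b : 'I_N) :=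
  if (a == i) && (b == j) then B0 else B a b.

(** The preimage of a rectangle is again a product set: x.1 has to satisfy the constraints with B0
    in the place of B i j, and x.2 only the constraint B i j. *)
Let pre1 B0 B : Psi1 @^-1` [set x | rr B0 B x] =
  [set w | forall a b : 'I_N, (a <= b)%N -> Bx B0 B a b (reim (H a b w))] `*`
  [set w | B i j (reim (H i j w))].
Proof.
apply/seteqP; split => -[w w'] /=.
  move=> [h0 hB]; split; last by have := hB i j ij; rewrite /= mxE !eqxx.
  move=> a b ab; rewrite /Bx; case: ifP => [/andP [/eqP -> /eqP ->] //|n1].
  have := hB a b ab; rewrite /= mxE n1 /=.
  case: ifP => // /andP [/eqP ea /eqP eb].
  have : i = j by apply/eqP; rewrite -val_eqE eqn_leq ij -ea -eb ab.
  by move=> eij; move: n1; rewrite ea eb eij !eqxx.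
move=> [h1 h2]; split; first by have := h1 i j ij; rewrite /Bx !eqxx.
move=> a b ab; rewrite /= mxE; case: ifP => [/orP [/andP [/eqP -> /eqP ->] //|]|].
  move=> /andP [/eqP ea /eqP eb].
  have eij : i = j by apply/eqP; rewrite -val_eqE eqn_leq ij -ea -eb ab.
  by rewrite ea eb /= eij; rewrite eij in h2.
move=> /negbT; rewrite negb_or => /andP [n1 _].
by have := h1 a b ab; rewrite /Bx (negPf n1).
Qed.

Let pre2 B0 B : Psi2 @^-1` [set x | rr B0 B x] =
  [set w | B0 (reim (H i j w))] `*`
  [set w | forall a b : 'I_N, (a <= b)%N -> B a b (reim (H a b w))].
Proof. by []. Qed.

Let msingle a b (B : set (R * R)) : measurable B -> measurable [set w | B (reim (H a b w))].
Proof. by move=> mB; rewrite -[X in measurable X]setTI; exact: mH. Qed.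

Let mmulti (B : 'I_N -> 'I_N -> set (R * R)) : (forall a b, measurable (B a b)) ->
  measurable [set w | forall a b : 'I_N, (a <= b)%N -> B a b (reim (H a b w))].
Proof.
move=> mB.
have -> : [set w | forall a b : 'I_N, (a <= b)%N -> B a b (reim (H a b w))] =
   \bigcap_(k in [set k : 'I_N * 'I_N | (k.1 <= k.2)%N]) [set w | B k.1 k.2 (reim (H k.1 k.2 w))].
  apply/seteqP; split => w /=; first by move=> h [a b] /= ab; exact: h.
  by move=> h a b ab; exact: (h (a, b)).
by apply: fin_bigcap_measurable => [|k _]; [exact: finite_finset | exact: msingle].
Qed.

Let mPsi1 : measurable_fun setT Psi1.
Proof.
apply: (@measurability _ _ _ [the measurableType _ of XX] setT _ rects erefl) => _ [_ [B0 [B [m0 mB ->]]] <-].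
rewrite setTI -[[set x | _]]/[set x | rr B0 B x] pre1; apply: measurableX.
  by apply: mmulti => a b; rewrite /Bx; case: ifP.
exact: msingle.
Qed.

Let mPsi2 : measurable_fun setT Psi2.
Proof.
apply: (@measurability _ _ _ [the measurableType _ of XX] setT _ rects erefl) => _ [_ [B0 [B [m0 mB ->]]] <-].
rewrite setTI -[[set x | _]]/[set x | rr B0 B x] pre2; apply: measurableX.
  exact: msingle.
exact: mmulti.
Qed.

Let PP := (P \x P)%E.

Let pfm1 : {measure set XX -> \bar R} :=
  measure_function_pushforward__canonical__measure_function_Measure PP mPsi1.
Let pfm2 : {measure set XX -> \bar R} :=
  measure_function_pushforward__canonical__measure_function_Measure PP mPsi2.

(** Rectangles are stable under intersection and generate the sigma-algebra, so it is enough to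
    compare on them. By independence both measures equal P(H_ij in B0) times the product over all
    entries of P(H_ab in B a b). *)
Let law_eq (A : set XX) : measurable A -> pfm1 A = pfm2 A.
Proof.
move=> mA; apply: (@measure_unique _ R [the measurableType _ of XX] rects (fun=> setT) erefl rects_setI _ _ pfm1 pfm2 _ _ A mA).
- move=> _; exists setT, (fun _ _ => setT); split => //.
  by apply/seteqP; split.
- by apply/seteqP; split => // x _; exists 0%N.
- move=> _ [B0 [B [m0 mB ->]]].
  rewrite /pfm1 /pfm2 /= /pushforward -[[set x | _]]/[set x | rr B0 B x] pre1 pre2.
  have mBx a b : measurable (Bx B0 B a b) by rewrite /Bx; case: ifP.
  rewrite !product_measure1E; [|exact: msingle|exact: mmulti|exact: mmulti|exact: msingle].
  have e1 := indep mBx; have e2 := indep mB.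
  rewrite [X in (X * _ = _)%E](_ : _ = \prod_(k : 'I_N * 'I_N | (k.1 <= k.2)%N)
         P [set w | Bx B0 B k.1 k.2 (reim (H k.1 k.2 w))])%E; last exact: e1.
  rewrite [X in (_ = _ * X)%E](_ : _ = \prod_(k : 'I_N * 'I_N | (k.1 <= k.2)%N)
         P [set w | B k.1 k.2 (reim (H k.1 k.2 w))])%E; last exact: e2.
  rewrite (bigD1 (i, j)) //= [in RHS](bigD1 (i, j)) //=.
  rewrite {1}/Bx !eqxx /= -!muleA; congr (_ * _)%E.
  rewrite muleC; congr (_ * _)%E; apply: eq_bigr => -[a b] /= /andP [ab n1].
  by rewrite /Bx; move: n1; rewrite xpair_eqE => /negPf ->.
- by move=> _; rewrite /pfm1 /= /pushforward preimage_setT probability_setT ltry.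
Qed.

Let complex_eta (z : C) : (complex.Re z +i* complex.Im z)%C = z. Proof. by case: z. Qed.
Let conj_eta (z : C) : (complex.Re z -i* complex.Im z)%C = conjc z. Proof. by case: z. Qed.

Let toC_reim z : toC (reim z) = z. Proof. by case: z. Qed.

Let toM1 x : toM (Psi1 x).2 = rmat2 i j x.
Proof.
apply/matrixP => a b; rewrite !mxE /=.
case: (a <= b)%N; first by rewrite toC_reim mxE.
rewrite conj_eta mxE orbC [(b == j) && _]andbC [(b == i) && _]andbC.
by rewrite (fun_if (@conjc R)) -!hH.
Qed.

Let toM2 x : toM (Psi2 x).2 = rmat H x.2.
Proof.
apply/matrixP => a b; rewrite !mxE /=; case: (a <= b)%N; first by rewrite ?toC_reim ?complex_eta.
by rewrite [RHS]hH conj_eta.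
Qed.

Variable phi : C -> 'M[C]_N -> R.
Hypothesis mphi : meas2 phi.

Let f (y : XX) := (phi (toC y.1) (toM y.2))%:E.

Let mf : measurable_fun setT f.
Proof.
by apply/measurable_EFinP; apply: mphi; [exact: cmeas_toC|exact: mmeas_toM].
Qed.

Let f1 x : f (Psi1 x) = (phi (H i j x.1) (rmat2 i j x))%:E.
Proof. by rewrite /f toM1 /= toC_reim. Qed.

Let f2 x : f (Psi2 x) = (phi (H i j x.1) (rmat H x.2))%:E.
Proof. by rewrite /f toM2 /= toC_reim. Qed.

Lemma resample_up : PP.-integrable setT (fun x => (phi (H i j x.1) (rmat2 i j x))%:E) ->
  PP.-integrable setT (fun x => (phi (H i j x.1) (rmat H x.2))%:E) ->
  (\int[PP]_x (phi (H i j x.1) (rmat2 i j x))%:E =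
   \int[PP]_x (phi (H i j x.1) (rmat H x.2))%:E)%E.
Proof.
rewrite (_ : (fun x => _ ) = f \o Psi1) => [i1|]; last by apply: funext => x /=; rewrite f1.
rewrite (_ : (fun x => (phi (H i j x.1) (rmat H x.2))%:E) = f \o Psi2) => [i2|]; last first.
  by apply: funext => x /=; rewrite f2.
transitivity (\int[pfm1]_y f y)%E.
  by rewrite integral_pushforward.
rewrite (eq_measure_integral pfm2); last by move=> A mA _; exact: law_eq.
by rewrite integral_pushforward.
Qed.

End Upper.

Lemma rmat2C i j x : rmat2 i j x = rmat2 j i x.
Proof. by apply/matrixP => a b; rewrite !mxE orbC. Qed.

Lemma meas2_conj (phi : C -> 'M[C]_N -> R) : meas2 phi -> meas2 (fun h M => phi (conjc h) M).
Proof. by move=> h d' T' f M mf mM; apply: h => //; exact: cmeas_conj. Qed.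

(** Below the diagonal the statement for (j, i) is applied to the functional with its first argument
    conjugated. *)
Lemma resample i j (phi : C -> 'M[C]_N -> R) : meas2 phi ->
  (P \x P)%E.-integrable setT (fun x => (phi (H i j x.1) (rmat2 i j x))%:E) ->
  (P \x P)%E.-integrable setT (fun x => (phi (H i j x.1) (rmat H x.2))%:E) ->
  (\int[P \x P]_x (phi (H i j x.1) (rmat2 i j x))%:E =
   \int[P \x P]_x (phi (H i j x.1) (rmat H x.2))%:E)%E.
Proof.
move=> mphi; have [ij|ji] := leqP i j; first exact: resample_up.
have := resample_up (ltnW ji) (meas2_conj mphi).
have -> : (fun x => (phi (conjc (H j i x.1)) (rmat2 j i x))%:E) =
          (fun x => (phi (H i j x.1) (rmat2 i j x))%:E).
  by apply: funext => x; rewrite -hH rmat2C.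
have -> : (fun x : T * T => (phi (conjc (H j i x.1)) (rmat H x.2))%:E) =
          (fun x => (phi (H i j x.1) (rmat H x.2))%:E).
  by apply: funext => x; rewrite -hH.
by [].
Qed.

End Resample.

(** * Real-valued expectations and Markov's inequality *)

Section Expectation.
Context (R : realType) d (T : measurableType d) (Q : probability T R).
Implicit Types f g : T -> R.

Definition intg f := Q.-integrable setT (EFin \o f).
Definition Ex f : R := fine (\int[Q]_x (f x)%:E)%E.

Lemma Ex_fin f : intg f -> (\int[Q]_x (f x)%:E = (Ex f)%:E)%E.
Proof. by move=> h; rewrite fineK //; exact: integrable_fin_num. Qed.

Lemma intg_meas f : intg f -> measurable_fun setT f.
Proof. by move=> /measurable_int /measurable_EFinP. Qed.

Lemma intgD f g : intg f -> intg g -> intg (fun t => f t + g t).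
Proof. exact: (integrableD measurableT). Qed.

Lemma intgZ k f : intg f -> intg (fun t => k * f t).
Proof. by move=> h; apply: (integrableZl measurableT k h). Qed.

Lemma intgN f : intg f -> intg (fun t => - f t).
Proof. by move=> /(intgZ (-1)); rewrite /intg; under eq_fun do rewrite /= mulN1r. Qed.

Lemma intgB f g : intg f -> intg g -> intg (fun t => f t - g t).
Proof. by move=> hf hg; apply: intgD => //; exact: intgN. Qed.

Lemma intg_cst k : intg (fun=> k).
Proof. exact: finite_measure_integrable_cst. Qed.

Lemma intg_dom f g : measurable_fun setT f -> (forall t, `|f t| <= g t) ->
  intg g -> intg f.
Proof.
move=> mf fg ig; apply: (le_integrable measurableT _ _ ig).
  exact/measurable_EFinP.
by move=> t _ /=; rewrite lee_fin (le_trans (fg t)) // ler_norm.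
Qed.

Lemma intg_bdd f k : measurable_fun setT f -> (forall t, `|f t| <= k) -> intg f.
Proof. by move=> mf h; apply: (intg_dom mf h); exact: intg_cst. Qed.

Lemma intg_norm f : intg f -> intg (fun t => `|f t|).
Proof. by move=> h; apply: (integrable_norm h). Qed.

Lemma intg_sum (I : Type) (r : seq I) (F : I -> T -> R) :
  (forall i, intg (F i)) -> intg (fun t => \sum_(i <- r) F i t).
Proof.
move=> h; elim: r => [|i r IH].
  by rewrite /intg; under eq_fun do rewrite /= big_nil; exact: intg_cst.
by rewrite /intg; under eq_fun do rewrite /= big_cons; exact: intgD.
Qed.

Lemma ExD f g : intg f -> intg g -> Ex (fun t => f t + g t) = Ex f + Ex g.
Proof. by move=> hf hg; exact: (RintegralD measurableT hf hg). Qed.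

Lemma ExB f g : intg f -> intg g -> Ex (fun t => f t - g t) = Ex f - Ex g.
Proof. by move=> hf hg; exact: (RintegralB measurableT hf hg). Qed.

Lemma ExZ k f : intg f -> Ex (fun t => k * f t) = k * Ex f.
Proof. by move=> hf; exact: (RintegralZl k measurableT hf). Qed.

Lemma Ex_cst k : Ex (fun=> k) = k.
Proof.
rewrite /Ex; have := Rintegral_cst Q measurableT k; rewrite /Rintegral => ->.
rewrite [X in fine X](_ : _ = 1%E) ?mulr1 //; exact: probability_setT.
Qed.

Lemma Ex_le f g : intg f -> intg g -> (forall t, f t <= g t) -> Ex f <= Ex g.
Proof. by move=> hf hg h; apply: (le_Rintegral measurableT hf hg) => t _. Qed.

Lemma Ex_ge0 f : (forall t, 0 <= f t) -> 0 <= Ex f.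
Proof. by move=> h; apply: Rintegral_ge0 => t _. Qed.

Lemma Ex_abs f : intg f -> `|Ex f| <= Ex (fun t => `|f t|).
Proof. by move=> h; apply: (le_normr_Rintegral measurableT h). Qed.

Lemma Ex_ext f g : (forall t, f t = g t) -> Ex f = Ex g.
Proof. by move=> h; rewrite (_ : f = g) //; apply: funext. Qed.

Lemma intg_ext f g : (forall t, f t = g t) -> intg f -> intg g.
Proof. by move=> h; rewrite (_ : f = g) //; apply: funext. Qed.

Lemma Ex_sum (I : Type) (r : seq I) (F : I -> T -> R) :
  (forall i, intg (F i)) -> Ex (fun t => \sum_(i <- r) F i t) = \sum_(i <- r) Ex (F i).
Proof.
move=> h; elim: r => [|i r IH].
  by rewrite big_nil -[RHS](Ex_cst 0); apply: Ex_ext => t; rewrite big_nil.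
rewrite big_cons -IH -ExD //; last exact: intg_sum.
by apply: Ex_ext => t; rewrite big_cons.
Qed.

Lemma intg_indic A : measurable A -> intg (fun t => (\1_A t : R)).
Proof.
move=> mA; apply: (@intg_bdd _ 1); first exact: measurable_indic.
by move=> t; rewrite indicE; case: (_ \in _); rewrite ?normr1 ?normr0.
Qed.

Lemma Ex_indic A : measurable A -> Ex (fun t => (\1_A t : R)) = fine (Q A).
Proof. by move=> mA; rewrite /Ex integral_indic // setIT. Qed.

Lemma markov_Ex f c k : 0 < c -> intg f -> (forall t, 0 <= f t) -> Ex f <= k * c ->
  (Q [set t | (c <= f t)%R] <= k%:E)%E.
Proof.
move=> c0 hf f0 h.
have mA : measurable [set t | c <= f t].
  rewrite (_ : [set t | _] = setT `&` f @^-1` [set` `[c, +oo[%R]); last first.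
    by rewrite setTI; apply/seteqP; split => t /=; rewrite in_itv /= andbT.
  by apply: (intg_meas hf) => //; exact: measurable_itv.
rewrite -(fineK (fin_num_measure Q _ mA)) lee_fin -Ex_indic //.
rewrite -(ler_pM2r c0); apply: le_trans h; rewrite mulrC -ExZ; last exact: intg_indic.
apply: Ex_le => //; first by apply: intgZ; exact: intg_indic.
move=> t; rewrite indicE; case: (boolP (t \in _)) => [|_]; last by rewrite mulr0.
by rewrite inE /= mulr1.
Qed.

End Expectation.

(** * Expectations over two independent copies *)

Section ProductExpectation.
Context (R : realType) d (T : measurableType d) (P : probability T R).
Local Notation PP := (P \x P)%E.
Implicit Types a f : T -> R.

Lemma integral_fst (a : T -> \bar R) : measurable_fun setT a -> (forall t, 0 <= a t)%E ->
  (\int[PP]_x a x.1 = \int[P]_t a t)%E.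
Proof.
move=> ma a0; rewrite (@fubini_tonelli1 _ _ _ _ _ P P (fun x => a x.1)) //.
  apply: eq_integral => t _; rewrite /fubini_F /= integral_cst //.
  by rewrite [X in (_ * X)%E](_ : _ = 1%E) ?mule1 //; exact: probability_setT.
exact: measurableT_comp ma measurable_fst.
Qed.

Lemma integral_snd (a : T -> \bar R) : measurable_fun setT a -> (forall t, 0 <= a t)%E ->
  (\int[PP]_x a x.2 = \int[P]_t a t)%E.
Proof.
move=> ma a0; rewrite (@fubini_tonelli2 _ _ _ _ _ P P (fun x => a x.2)) //.
  apply: eq_integral => t _; rewrite /fubini_G /= integral_cst //.
  by rewrite [X in (_ * X)%E](_ : _ = 1%E) ?mule1 //; exact: probability_setT.
exact: measurableT_comp ma measurable_snd.
Qed.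

Lemma intg_fst a : intg P a -> intg PP (fun x => a x.1).
Proof.
move=> ia; have ma := intg_meas ia; apply/integrableP; split.
  by apply/measurable_EFinP; exact: measurableT_comp ma measurable_fst.
rewrite (integral_fst (a := fun t => `|(a t)%:E|%E)) //; first by case/integrableP: ia.
by apply/measurableT_comp => //; exact/measurable_EFinP.
Qed.

Lemma intg_snd a : intg P a -> intg PP (fun x => a x.2).
Proof.
move=> ia; have ma := intg_meas ia; apply/integrableP; split.
  by apply/measurable_EFinP; exact: measurableT_comp ma measurable_snd.
rewrite (integral_snd (a := fun t => `|(a t)%:E|%E)) //; first by case/integrableP: ia.
by apply/measurableT_comp => //; exact/measurable_EFinP.
Qed.

Lemma intg_prod a f : intg P a -> intg P f -> intg PP (fun x => a x.1 * f x.2).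
Proof.
move=> ia jf; have ma := intg_meas ia; have mf := intg_meas jf.
apply/integrableP; split.
  apply/measurable_EFinP; apply: measurable_funM.
    exact: measurableT_comp ma measurable_fst.
  exact: measurableT_comp mf measurable_snd.
rewrite (@fubini_tonelli1 _ _ _ _ _ P P (fun x => `|(a x.1 * f x.2)%:E|%E)) //; last first.
  apply: measurableT_comp => //; apply/measurable_EFinP; apply: measurable_funM.
    exact: measurableT_comp ma measurable_fst.
  exact: measurableT_comp mf measurable_snd.
rewrite (eq_integral (fun t => `|(a t)%:E| * (\int[P]_s `|(f s)%:E|))%E); last first.
  move=> t _; rewrite /fubini_F /= -ge0_integralZl //; last first.
    by apply/measurable_EFinP; exact: measurableT_comp.
  by apply: eq_integral => s _; rewrite normrM.
have [_ fa] := integrableP _ _ _ ia; have [_ ff] := integrableP _ _ _ jf.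
rewrite ge0_integralZr //; last 2 first.
- by apply: measurableT_comp => //; exact/measurable_EFinP.
- by apply: integral_ge0 => s _.
apply: lte_mul_pinfty => //; first exact: integral_ge0.
by rewrite ge0_fin_numE //; exact: integral_ge0.
Qed.

Lemma Ex_prod a f : intg P a -> intg P f ->
  Ex PP (fun x => a x.1 * f x.2) = Ex P a * Ex P f.
Proof.
move=> ia jf; rewrite {1}/Ex -integral12_prod_meas1; last exact: intg_prod.
rewrite (eq_integral (fun t => (a t * Ex P f)%:E)); last first.
  move=> t _; rewrite /fubini_F /= -ExZ // -Ex_fin //; exact: intgZ.
rewrite -/(Ex P (fun t => a t * Ex P f)).
by rewrite (@Ex_ext _ _ _ _ _ (fun t => Ex P f * a t)) ?ExZ // => [|t]; rewrite mulrC.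
Qed.

Lemma Ex_fst a : intg P a -> Ex PP (fun x => a x.1) = Ex P a.
Proof.
move=> ia; have := Ex_prod ia (intg_cst P 1); rewrite Ex_cst mulr1 => <-.
by apply: Ex_ext => x; rewrite mulr1.
Qed.

Lemma Ex_snd a : intg P a -> Ex PP (fun x => a x.2) = Ex P a.
Proof.
move=> ia; have := Ex_prod (intg_cst P 1) ia; rewrite Ex_cst mul1r => <-.
by apply: Ex_ext => x; rewrite mul1r.
Qed.

End ProductExpectation.

(** * High moments of the error in the self-consistent equation *)

Section MeasurableFunctionals.
Context (R : realType) (N : nat).
Local Notation C := R[i].
Variables (z : C) (s : 'I_N -> 'I_N -> R) (v w : 'cV[C]_N) (m : nat).
Context d (T : measurableType d) (G : T -> 'M[C]_N).
Hypothesis mG : mmeas G.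

Lemma cmeas_fD : cmeas (fun t => fD z s v w (G t)).
Proof.
apply: cmeasD; first apply: cmeasD; first exact: cmeas_cst.
  by apply: cmeasM; [exact: cmeas_cst | exact: cmeas_sesq].
apply: cmeasM; first exact: cmeas_cst.
by apply: cmeas_sum => l; apply: cmeasM; [exact: mG | exact: cmeas_sesq].
Qed.

Lemma cmeas_cD p q : cmeas (fun t => cD z s v w p q (G t)).
Proof.
apply: cmeasD.
  apply: cmeasM; last exact: cmeas_sesq.
  apply: cmeasD; first by apply: cmeasM; [exact: cmeas_cst | exact: cmeas_sesq].
  apply: cmeasM; first exact: cmeas_cst.
  by apply: cmeas_sum => l; apply: cmeasM; [exact: mG | exact: cmeas_sesq].
apply: cmeasM; first exact: cmeas_cst.
by apply: cmeas_sum => l; apply: cmeasM; [apply: cmeasM |]; exact: cmeas_sesq.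
Qed.

Lemma measurable_X : measurable_fun setT (fun t => complex.Re (fD z s v w (G t))).
Proof. exact: cmeas_fD.1. Qed.

Lemma cmeas_aD b i j : cmeas (fun t => aD z s v w b (G t) i j).
Proof. by apply: cmeasN; apply: cmeasM; [exact: cmeas_cst | exact: cmeas_cD]. Qed.

Lemma cmeas_bD i j : cmeas (fun t => bD z s v w (G t) i j).
Proof. by apply: cmeasN; exact: cmeas_cD. Qed.

Lemma cmeas_gam i j : cmeas (fun t => gam z s v w (G t) i j).
Proof.
apply: cmeasM; first exact: cmeas_cst.
by apply: cmeasD; [exact: cmeas_aD | apply: cmeas_conj; exact: cmeas_bD].
Qed.

Lemma cmeas_Xpow k : cmeas (fun t => (complex.Re (fD z s v w (G t)) ^+ k)%:C%C).
Proof. by apply: cmeas_real; apply: measurable_funX; exact: measurable_X. Qed.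

Lemma cmeas_Xpow' k c : cmeas (fun t => (c * complex.Re (fD z s v w (G t)) ^+ k)%:C%C).
Proof.
apply: cmeas_real; apply: measurable_funM; first exact: measurable_cst.
by apply: measurable_funX; exact: measurable_X.
Qed.

Lemma cmeas_aF i j : cmeas (fun t => aF z s v w m (G t) i j).
Proof.
apply: cmeasD.
  apply: cmeasM; last exact: cmeas_Xpow.
  apply: cmeasN; apply: cmeasM; first exact: cmeas_cst.
  by apply: cmeasM; exact: cmeas_sesq.
apply: cmeasM; last exact: cmeas_gam.
by apply: cmeasM; [exact: cmeas_sesq | exact: cmeas_Xpow'].
Qed.

Lemma cmeas_bF i j : cmeas (fun t => bF z s v w m (G t) i j).
Proof.
apply: cmeasD.
  apply: cmeasM; last exact: cmeas_Xpow.
  by apply: cmeasN; apply: cmeasM; [exact: mG | exact: cmeas_sesq].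
apply: cmeasM; last by apply: cmeas_conj; exact: cmeas_gam.
by apply: cmeasM; [exact: cmeas_sesq | exact: cmeas_Xpow'].
Qed.

Lemma cmeas_phi j : cmeas (fun t => phi z s v w j m (G t)).
Proof. by apply: cmeasM; [exact: cmeas_sesq | exact: cmeas_Xpow]. Qed.

Lemma measurable_good K (F : seq 'cV[C]_N) : measurable [set t | good K z F (G t)].
Proof.
have -> : [set t | good K z F (G t)] =
  \bigcap_(k in [set` [seq (x, y) | x <- F, y <- F]])
     [set t | normc (sesq k.1 (G t) k.2) * (1 + normc z) <= K].
  apply/seteqP; split => t /=.
    move=> h [x y] /= /allpairsP [[x' y'] /= [hx hy [-> ->]]]; exact: goodP h hx hy.
  move=> h; apply/allP => x hx; apply/allP => y hy; apply: (h (x, y)) => /=.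
  by apply/allpairsP; exists (x, y).
apply: fin_bigcap_measurable => [|[x y] _ /=]; first exact: finite_seq.
rewrite (_ : [set t | _] = setT `&` (fun t => normc (sesq x (G t) y) * (1 + normc z)) @^-1`
   [set` `]-oo, K]%R]); last first.
  by rewrite setTI; apply/seteqP; split => t /=; rewrite in_itv.
have : measurable_fun setT (fun t => normc (sesq x (G t) y) * (1 + normc z)).
  by apply: measurable_funM; [apply: cmeas_normc; exact: cmeas_sesq | exact: measurable_cst].
by apply => //; exact: measurable_itv.
Qed.

End MeasurableFunctionals.

(** * Deterministic bounds, for integrability and for the exceptional events *)

Section CrudeBounds.
Context (R : realType) (N : nat).
Local Notation C := R[i].
Variables (z : C) (s : 'I_N -> 'I_N -> R) (tau : 'I_N -> 'I_N -> C) (v w : 'cV[C]_N) (m : nat).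
Local Notation e := (basis R).
Local Notation lv := (lv s v).
Variable F : seq 'cV[C]_N.
Hypothesis n0 : (0 < N)%N.
Hypothesis Fe : forall i, e i \in F.
Hypothesis Fv : v \in F.
Hypothesis Fw : w \in F.
Hypothesis Fl : forall l, lv l \in F.
Hypothesis hvw : normc ((adjm v *m w) 0 0) <= 1.
Variable K : R.
Hypothesis K1 : 1 <= K.
Variable G : 'M[C]_N.
Hypothesis gG : good K z F G.
Local Notation X := (complex.Re (fD z s v w G)).

Let K0 : 0 <= K. Proof. by apply: le_trans K1. Qed.
Let L := 3 * K ^+ 2.
Let L0 : 0 <= L. Proof. by rewrite mulr_ge0 // exprn_ge0. Qed.

Lemma X_crude : `|X| <= L.
Proof. by apply: le_trans (Re_le_normc _) _; apply: fD_le gG hvw. Qed.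

Lemma Xpow_crude k : normc ((X ^+ k)%:C%C) <= L ^+ k.
Proof. by rewrite normc_real normrX lerXn2r ?nnegrE //; exact: X_crude. Qed.

Lemma Xpow_crude' k (c : R) : 0 <= c -> normc ((c * X ^+ k)%:C%C) <= c * L ^+ k.
Proof.
move=> c0; rewrite normc_real normrM ger0_norm // ler_wpM2l //.
by have := Xpow_crude k; rewrite normc_real.
Qed.

Lemma phi_crude j : normc (phi z s v w j m G) <= K * L ^+ m.+2.
Proof. by apply: nM_le; [exact: (good1 gG) | exact: Xpow_crude]. Qed.

Lemma offd_le (i j : 'I_N) : normc (offd R i j) <= 1.
Proof. by rewrite /offd normc_nat; case: (i == j). Qed.

Lemma gam_crude i j : normc (gam z s v w G i j) <= 3 * K ^+ 3.
Proof.
have h1 : normc (aD z s v w (offd R i j) G i j) <= 1 * (3 * K ^+ 3).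
  rewrite normcNE; apply: nM_le; first exact: offd_le.
  exact: cD_le.
have h2 : normc (conjc (bD z s v w G i j)) <= 3 * K ^+ 3.
  by rewrite normc_conj normcNE; exact: cD_le.
rewrite /gam; apply: le_trans (nM_le (lexx _) (nD_le h1 h2)) _.
rewrite normcV normc_nat; lra.
Qed.

Let P1 := K ^+ 2 * L ^+ m.+2 + K * (m.+2%:R * L ^+ m.+1) * (3 * K ^+ 3).

Lemma aF_crude i j : normc (aF z s v w m G i j) <= P1.
Proof.
apply: nD_le; last first.
  apply: nM_le; last exact: gam_crude.
  by apply: nM_le; [exact: (good1 gG) | exact: Xpow_crude'].
apply: nM_le; last exact: Xpow_crude.
rewrite normcNE -[K ^+ 2]mul1r; apply: nM_le; first exact: offd_le.
by rewrite expr2; apply: nM_le; exact: (good1 gG).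
Qed.

Lemma bF_crude i j : normc (bF z s v w m G i j) <= P1.
Proof.
apply: nD_le; last first.
  apply: nM_le; last by rewrite normc_conj; exact: gam_crude.
  by apply: nM_le; [exact: (good1 gG) | exact: Xpow_crude'].
apply: nM_le; last exact: Xpow_crude.
by rewrite normcNE expr2; apply: nM_le; rewrite -?sesq_basis; exact: (good1 gG).
Qed.

Definition crude_cst := K ^+ 2 * L ^+ m.+2 + K * (m.+2%:R * L ^+ m.+1) * (3 * K ^+ 3).

End CrudeBounds.

(** * The matrix H, its resampled version, and complex expectations *)

Section MomentIdentity.
Context (R : realType) d (T : measurableType d) (P : probability T R) (N : nat).
Local Notation C := R[i].
Variable H : 'I_N -> 'I_N -> T -> C.
Hypothesis mH : forall i j, measurable_fun setT (fun w => reim (H i j w)).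
Hypothesis hH : forall i j w, H j i w = conjc (H i j w).
Hypothesis indep : entries_independent P H.
Local Notation PP := (P \x P)%E.
Local Notation e := (basis R).

Lemma cmeas_H i j : cmeas (H i j).
Proof.
split; [exact: measurableT_comp measurable_fst (mH i j) |
        exact: measurableT_comp measurable_snd (mH i j)].
Qed.

Lemma mmeas_H : mmeas (rmat H).
Proof. by move=> a b; apply: cmeas_ext (cmeas_H a b) => t; rewrite mxE. Qed.

Lemma herm_H w : hermm (rmat H w).
Proof. by apply/matrixP => a b; rewrite adjmE !mxE -hH. Qed.

Lemma herm_H2 i j x : hermm (rmat2 H i j x).
Proof.
apply/matrixP => a b; rewrite adjmE !mxE orbC [(b == j) && _]andbC [(b == i) && _]andbC.
by case: ifP => _; rewrite -hH.
Qed.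

Lemma cmeas_comp d1 d2 (T1 : measurableType d1) (T2 : measurableType d2)
  (f : T2 -> C) (g : T1 -> T2) : cmeas f -> measurable_fun setT g -> cmeas (fun t => f (g t)).
Proof. by move=> [h1 h2] hg; split; [exact: measurableT_comp h1 hg|exact: measurableT_comp h2 hg]. Qed.

Lemma mmeas_H2 : mmeas (fun x : T * T => rmat H x.2).
Proof. by move=> a b; exact: cmeas_comp (mmeas_H a b) measurable_snd. Qed.

Lemma mmeas_rmat2 i j : mmeas (fun x : T * T => rmat2 H i j x).
Proof.
move=> a b; case e1 : (((a == i) && (b == j)) || ((a == j) && (b == i))).
  by apply: cmeas_ext (cmeas_comp (cmeas_H a b) measurable_snd) => t; rewrite mxE e1.
by apply: cmeas_ext (cmeas_comp (cmeas_H a b) measurable_fst) => t; rewrite mxE e1.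
Qed.

Lemma rmat2_ij i j x : rmat2 H i j x i j = H i j x.2.
Proof. by rewrite mxE !eqxx. Qed.

(** On the diagonal [offd] removes the first of the two terms, and the second is the right change
    because diagonal entries are real. *)
Lemma rmat_sub i j x :
  rmat H x.1 - rmat2 H i j x = Dmx (offd R i j) (H i j x.1 - H i j x.2) i j.
Proof.
apply/matrixP => a b; rewrite !mxE /offd.
have hd k y : conjc (H k k y) = H k k y by rewrite -hH.
have [->|na] := eqVneq a i; have [->|nb] := eqVneq b j => /=; rewrite ?eqxx /=.
- have [eij|nij] := eqVneq i j => /=; last by rewrite !mulr1 mulr0 addr0 mul1r.
  by rewrite -eij conjcD conjcN !hd !mul0r add0r mulr1.
- have [eij|nij] := eqVneq i j; last by rewrite /= mulr0 mulr0 addr0 subrr.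
  by move: nb; rewrite -eij => /negPf ->; rewrite /= !mulr0 addr0 subrr.
- have [eij|nij] := eqVneq a j; last by rewrite /= !mulr0 addr0 subrr.
  have [eji|nji] := eqVneq j i; first by move: na; rewrite eij eji eqxx.
  by rewrite /= !mulr0 addr0 subrr.
have [ea|nej] := eqVneq a j; have [eb|nei] := eqVneq b i; rewrite /= ?mulr0 ?addr0 ?subrr //.
by rewrite add0r mulr1 ea eb conjcD conjcN -!hH.
Qed.

Definition cintg d' (T' : measurableType d') (Q : probability T' R) (f : T' -> C) :=
  intg Q (fun t => complex.Re (f t)) /\ intg Q (fun t => complex.Im (f t)).

Definition Ec d' (T' : measurableType d') (Q : probability T' R) (f : T' -> C) : C :=
  ((Ex Q (fun t => complex.Re (f t))) +i* (Ex Q (fun t => complex.Im (f t))))%C.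

Lemma cintg_dom d' (T' : measurableType d') (Q : probability T' R) (f : T' -> C) g :
  cmeas f -> (forall t, normc (f t) <= g t) -> intg Q g -> cintg Q f.
Proof.
move=> [m1 m2] h ig; split; apply: (intg_dom _ _ ig) => // t; apply: le_trans (h t).
  exact: Re_le_normc.
exact: Im_le_normc.
Qed.

Lemma Ec_prod (a f : T -> C) : cintg P a -> cintg P f ->
  intg PP (fun x => complex.Re (a x.1 * f x.2)) /\
  Ex PP (fun x => complex.Re (a x.1 * f x.2)) = complex.Re (Ec P a * Ec P f).
Proof.
move=> [a1 a2] [f1 f2].
have e1 x : complex.Re (a x.1 * f x.2) =
  complex.Re (a x.1) * complex.Re (f x.2) - complex.Im (a x.1) * complex.Im (f x.2) by rewrite ReM.
have i1 := intg_prod a1 f1; have i2 := intg_prod a2 f2.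
split; first by apply: (intg_ext (fun x => esym (e1 x))); exact: intgB.
rewrite (Ex_ext _ e1) (ExB i1 i2).
by have -> := Ex_prod a1 f1; have -> := Ex_prod a2 f2; rewrite ReM.
Qed.

End MomentIdentity.

(** * The moment identity obtained by resampling *)

Section Identity.
Context (R : realType) d (T : measurableType d) (P : probability T R) (N : nat).
Local Notation C := R[i].
Variable H : 'I_N -> 'I_N -> T -> C.
Hypothesis mH : forall i j, measurable_fun setT (fun w => reim (H i j w)).
Hypothesis hH : forall i j w, H j i w = conjc (H i j w).
Hypothesis indep : entries_independent P H.
Local Notation PP := (P \x P)%E.
Local Notation e := (basis R).
Variables (z : C) (s : 'I_N -> 'I_N -> R) (tau : 'I_N -> 'I_N -> C) (v w : 'cV[C]_N) (m : nat).
Hypothesis n0 : (0 < N)%N.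
Hypothesis hz : 0 < complex.Im z.
Hypothesis hmean : forall i j, Ec P (H i j) = 0.
Hypothesis hint : forall i j k, intg P (fun t => normc (H i j t) ^+ k).
Hypothesis hs : forall i j, Ec P (fun t => H i j t * conjc (H i j t)) = N%:R^-1 * (s i j)%:C%C.
Hypothesis htau : forall i j, Ec P (fun t => H i j t * H i j t) = N%:R^-1 * tau i j.
Local Notation lv := (lv s v).
Variable F : seq 'cV[C]_N.
Hypothesis Fe : forall i, e i \in F.
Hypothesis Fv : v \in F.
Hypothesis Fw : w \in F.
Hypothesis Fl : forall l, lv l \in F.
Hypothesis hvw : normc ((adjm v *m w) 0 0) <= 1.
Variable Kc : R.
Hypothesis Kc1 : 1 <= Kc.
Hypothesis good_c : forall M, hermm M -> good Kc z F (res z M).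

Local Notation g := (res z).
Local Notation XM M := (complex.Re (fD z s v w (g M))).
Local Notation phiM j M := (phi z s v w j m (g M)).
Local Notation aFM M := (aF z s v w m (g M)).
Local Notation bFM M := (bF z s v w m (g M)).
Local Notation bulkM M := (bulk z s tau v w m (g M)).

Definition remd i j (x : T * T) : C :=
  phiM j (rmat H x.1) - phiM j (rmat2 H i j x)
  - lin_term z s v w (offd R i j) (H i j x.1 - H i j x.2) i j m (g (rmat2 H i j x)).

(** As (M - z) G = 1, the part <v, (1 + z G) w> of the error is <v, M G w>. One factor of X^(m+3) is
    expanded in this way, which makes the entries of M appear explicitly. *)
Lemma X_expand M : hermm M -> XM M ^+ m.+3 =
  \sum_i \sum_j complex.Re (conjc (v i 0) * (M i j * phiM j M)) +
  complex.Re (N%:R^-1 * (\sum_l (g M) l l * sesq (lv l) (g M) w) * (XM M ^+ m.+2)%:C%C).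
Proof.
move=> hM; have reZ (a : C) (c : R) : complex.Re (a * c%:C%C) = complex.Re a * c.
  by rewrite ReM /= mulr0 subr0.
have e1 : fD z s v w (g M) = \sum_i \sum_j conjc (v i 0) * (M i j * sesq (e j) (g M) w) +
   N%:R^-1 * \sum_l (g M) l l * sesq (lv l) (g M) w.
  rewrite /fD; congr (_ + _).
  have -> : (adjm v *m w) 0 0 + z * sesq v (g M) w = sesq v (M *m g M) w.
    have := mul_res hM hz; rewrite mulmxBl mul_scalar_mx => /eqP; rewrite subr_eq => /eqP ->.
    by rewrite sesqDm sesqZm [sesq v 1%:M w]sesqE mulmx1.
  rewrite sesq_suml; apply: eq_bigr => i _.
  rewrite -mulr_sumr; congr (_ * _).
  rewrite sesq_basisl -mulmxA mxE; apply: eq_bigr => j _.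
  by rewrite sesq_basisl.
rewrite exprSr /phi; set c := XM M ^+ m.+2.
rewrite mulrC -reZ e1 mulrDl ReD; congr (_ + _).
rewrite mulr_suml Re_sum; apply: eq_bigr => i _.
by rewrite mulr_suml Re_sum; apply: eq_bigr => j _; rewrite !mulrA.
Qed.

Lemma Re_Ec (c : C) (f : T -> C) : cintg P f ->
  Ex P (fun t => complex.Re (c * f t)) = complex.Re (c * Ec P f).
Proof.
move=> [f1 f2]; rewrite (@Ex_ext _ _ _ _ _ (fun t => complex.Re c * complex.Re (f t) - complex.Im c * complex.Im (f t))); last first.
  by move=> t; rewrite ReM.
by rewrite ExB ?ExZ ?ReM //; exact: intgZ.
Qed.

Let B := crude_cst m Kc.

Let K0 : 0 <= Kc. Proof. by apply: le_trans Kc1. Qed.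

Let X_le M : hermm M -> `|XM M| <= 3 * Kc ^+ 2.
Proof. by move=> hM; apply: (@X_crude _ _ z s v w F) => //; exact: good_c. Qed.

Let phi_le M j : hermm M -> normc (phiM j M) <= Kc * (3 * Kc ^+ 2) ^+ m.+2.
Proof. by move=> hM; apply: (@phi_crude _ _ z s v w m F) => //; exact: good_c. Qed.

Let aF_le M i j : hermm M -> normc (aFM M i j) <= B.
Proof. by move=> hM; apply: (@aF_crude _ _ z s v w m F) => //; exact: good_c. Qed.

Let bF_le M i j : hermm M -> normc (bFM M i j) <= B.
Proof. by move=> hM; apply: (@bF_crude _ _ z s v w m F) => //; exact: good_c. Qed.

Let B0 : 0 <= B.
Proof.
have l0 k : 0 <= (3 * Kc ^+ 2) ^+ k by rewrite exprn_ge0 // mulr_ge0 // exprn_ge0.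
rewrite /B /crude_cst; apply: addr_ge0; first by apply: mulr_ge0 => //; exact: exprn_ge0.
apply: mulr_ge0; first by apply: mulr_ge0 => //; exact: mulr_ge0.
by apply: mulr_ge0 => //; exact: exprn_ge0.
Qed.

Let i1 i j : intg P (fun t => normc (H i j t)).
Proof. by have := hint i j 1; under eq_fun do rewrite expr1. Qed.

Let mG : mmeas (fun t => g (rmat H t)).
Proof. exact: mmeas_res (mmeas_H mH). Qed.

Let mv k := conjc (v k 0).

Lemma resampleE i j (phi : C -> 'M[C]_N -> R) (dom : T * T -> R) : meas2 phi ->
  intg PP dom -> (forall x, `|phi (H i j x.1) (rmat2 H i j x)| <= dom x) ->
  (forall x, `|phi (H i j x.1) (rmat H x.2)| <= dom x) ->
  [/\ intg PP (fun x => phi (H i j x.1) (rmat2 H i j x)),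
      intg PP (fun x => phi (H i j x.1) (rmat H x.2)) &
   Ex PP (fun x => phi (H i j x.1) (rmat2 H i j x)) =
   Ex PP (fun x => phi (H i j x.1) (rmat H x.2))].
Proof.
move=> mphi idom d1 d2.
have c1 : cmeas (fun x : T * T => H i j x.1) by exact: cmeas_comp (cmeas_H mH i j) measurable_fst.
have j1 := intg_dom (mphi _ _ _ _ c1 (mmeas_rmat2 mH i j)) d1 idom.
have j2 := intg_dom (mphi _ _ _ _ c1 (mmeas_H2 mH)) d2 idom.
by split=> //; rewrite /Ex (resample mH hH indep).
Qed.

(** After resampling, H_ij(x.1) is independent of the matrix inside [phi], and it has mean zero. *)
Lemma zero_term i j : [/\
  intg PP (fun x => complex.Re (mv i * (H i j x.1 * phiM j (rmat2 H i j x)))) &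
  Ex PP (fun x => complex.Re (mv i * (H i j x.1 * phiM j (rmat2 H i j x)))) = 0].
Proof.
set D := normc (mv i) * (Kc * (3 * Kc ^+ 2) ^+ m.+2).
have hD (h : C) M : hermm M -> `|complex.Re (mv i * (h * phiM j M))| <= D * normc h.
  move=> hM; apply: le_trans (Re_le_normc _) _.
  have -> : D * normc h = normc (mv i) * (normc h * (Kc * (3 * Kc ^+ 2) ^+ m.+2)) by rewrite /D; ring.
  apply: nM_le (lexx _) _; apply: nM_le (lexx _) _; exact: phi_le.
have m2 : meas2 (fun h M => complex.Re (mv i * (h * phiM j M))).
  move=> d' T' h M mh mM.
  have hc : cmeas (fun t => mv i * (h t * phiM j (M t))).
    by apply: cmeasM (cmeas_cst _ _) _; apply: cmeasM mh _; exact: (cmeas_phi _ _ _ _ _ (mmeas_res z mM)).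
  exact: hc.1.
have id : intg PP (fun x => D * normc (H i j x.1)) by apply: intgZ; exact: intg_fst (i1 i j).
have [] := resampleE m2 id (fun x => hD _ _ (herm_H2 hH i j x)) (fun x => hD _ _ (herm_H hH x.2)).
move=> j1 j2 ->; split => //.
have ia : cintg P (fun t => mv i * H i j t).
  apply: (@cintg_dom _ _ _ _ _ (fun t => normc (mv i) * normc (H i j t))).
  - exact: cmeasM (cmeas_cst _ _) (cmeas_H mH i j).
  - by move=> t; rewrite normcM.
  - exact: intgZ.
have jf : cintg P (fun t => phiM j (rmat H t)).
  apply: (cintg_dom (cmeas_phi _ _ _ _ _ mG _) _ (intg_cst P _)) => t.
  exact: phi_le (herm_H hH t).
have [_ e1] := Ec_prod ia jf.
rewrite (@Ex_ext _ _ _ _ _ (fun x => complex.Re (mv i * H i j x.1 * phiM j (rmat H x.2)))); last first.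
  by move=> x; rewrite mulrA.
rewrite e1.
have -> : Ec P (fun t => mv i * H i j t) = 0.
  have hc : cintg P (H i j).
    apply: (@cintg_dom _ _ _ _ _ (fun t => normc (H i j t))) => //; exact: cmeas_H.
  (* The imaginary part is reached as the real part after multiplication by -i. *)
  have r1 := Re_Ec (mv i) hc; have r2 := Re_Ec (- 'i%C * mv i) hc.
  move: r1 r2; rewrite hmean !mulr0 /= => r1 r2.
  rewrite /Ec r1; congr (_ +i* _)%C; rewrite -[RHS]r2; apply: Ex_ext => t.
  by rewrite -mulrA ReM /=; ring.
by rewrite mul0r.
Qed.

(** By equality of laws the resampled matrix becomes an independent copy of H. Of h (aF (h - h') +
    bF conj(h - h')) with h' in the copy, only h^2 aF and |h|^2 bF survive, as the cross terms carry
    the mean of h. *)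
Lemma lin_term_E i j : [/\
  intg PP (fun x => complex.Re (mv i * (H i j x.1 *
    lin_term z s v w (offd R i j) (H i j x.1 - H i j x.2) i j m (g (rmat2 H i j x))))),
  intg P (fun t => complex.Re (mv i * (N%:R^-1 *
    ((s i j)%:C%C * bFM (rmat H t) i j + tau i j * aFM (rmat H t) i j)))) &
  Ex PP (fun x => complex.Re (mv i * (H i j x.1 *
    lin_term z s v w (offd R i j) (H i j x.1 - H i j x.2) i j m (g (rmat2 H i j x))))) =
  Ex P (fun t => complex.Re (mv i * (N%:R^-1 *
    ((s i j)%:C%C * bFM (rmat H t) i j + tau i j * aFM (rmat H t) i j))))].
Proof.
pose L (h : C) (M : 'M[C]_N) := complex.Re (mv i * (h * (aFM M i j * (h - M i j) + bFM M i j * conjc (h - M i j)))).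
set D := normc (mv i) * (2 * B).
have hL (h : C) M : hermm M -> `|L h M| <= D * (normc h ^+ 2 + normc h * normc (M i j)).
  move=> hM; apply: le_trans (Re_le_normc _) _.
  have -> : D * (normc h ^+ 2 + normc h * normc (M i j)) = normc (mv i) * (normc h * (B * (normc h + normc (M i j)) + B * (normc h + normc (M i j)))) by rewrite /D; ring.
  apply: nM_le (lexx _) _; apply: nM_le (lexx _) _; apply: nD_le; apply: nM_le.
  - exact: aF_le.
  - exact: normcB.
  - exact: bF_le.
  - by rewrite normc_conj; exact: normcB.
have mL : meas2 L.
  move=> d' T' h M mh mM.
  have mr := mmeas_res z mM; have mh' := cmeasB mh (mM i j).
  have hc : cmeas (fun t => mv i * (h t * (aFM (M t) i j * (h t - M t i j)
     + bFM (M t) i j * conjc (h t - M t i j)))).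
    apply: cmeasM (cmeas_cst _ _) _; apply: cmeasM mh _.
    apply: cmeasD; apply: cmeasM => //; first exact: cmeas_aF.
      exact: cmeas_bF.
    exact: cmeas_conj.
  exact: hc.1.
have id : intg PP (fun x => D * (normc (H i j x.1) ^+ 2 + normc (H i j x.1) * normc (H i j x.2))).
  apply: intgZ; apply: intgD; last exact: (intg_prod (i1 i j) (i1 i j)).
  exact: (intg_fst (a := fun t => normc (H i j t) ^+ 2)).
have hd1 x : `|L (H i j x.1) (rmat2 H i j x)| <=
   D * (normc (H i j x.1) ^+ 2 + normc (H i j x.1) * normc (H i j x.2)).
  by rewrite -(rmat2_ij H i j x); exact: hL (herm_H2 hH i j x).
have hd2 x : `|L (H i j x.1) (rmat H x.2)| <=
   D * (normc (H i j x.1) ^+ 2 + normc (H i j x.1) * normc (H i j x.2)).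
  by have := hL (H i j x.1) _ (herm_H hH x.2); rewrite mxE.
have [j1 j2 j3] := resampleE mL id hd1 hd2.
have eL x : complex.Re (mv i * (H i j x.1 *
    lin_term z s v w (offd R i j) (H i j x.1 - H i j x.2) i j m (g (rmat2 H i j x)))) =
  L (H i j x.1) (rmat2 H i j x) by rewrite lin_termE -{1 2}(rmat2_ij H i j x).
pose a t := mv i * aFM (rmat H t) i j; pose b t := mv i * bFM (rmat H t) i j.
pose h := H i j.
have mh : cmeas h by exact: cmeas_H.
have ma : cmeas a by apply: cmeasM (cmeas_cst _ _) _; exact: cmeas_aF.
have mb : cmeas b by apply: cmeasM (cmeas_cst _ _) _; exact: cmeas_bF.
have na t : normc (a t) <= normc (mv i) * B by apply: nM_le (lexx _) _; exact: aF_le (herm_H hH t).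
have nb t : normc (b t) <= normc (mv i) * B by apply: nM_le (lexx _) _; exact: bF_le (herm_H hH t).
have ia : cintg P a by exact: (cintg_dom ma na (intg_cst P _)).
have ib : cintg P b by exact: (cintg_dom mb nb (intg_cst P _)).
have iah : cintg P (fun t => a t * h t).
  apply: (@cintg_dom _ _ _ _ _ (fun t => normc (mv i) * B * normc (h t))); first exact: cmeasM.
    by move=> t; apply: nM_le.
  exact: (intgZ _ (i1 i j)).
have ibh : cintg P (fun t => b t * conjc (h t)).
  apply: (@cintg_dom _ _ _ _ _ (fun t => normc (mv i) * B * normc (h t))).
  - by apply: cmeasM => //; exact: cmeas_conj.
  - by move=> t; apply: nM_le => //; rewrite normc_conj.
  exact: (intgZ _ (i1 i j)).
have ih : cintg P h by exact: (cintg_dom mh (fun t => lexx _) (i1 i j)).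
have i2 : cintg P (fun t => h t * h t).
  apply: (cintg_dom (g := fun t => normc (h t) ^+ 2) (cmeasM mh mh) _ (hint i j 2)).
  by move=> t; rewrite normcM expr2.
have i2' : cintg P (fun t => h t * conjc (h t)).
  apply: (cintg_dom (g := fun t => normc (h t) ^+ 2) (cmeasM mh (cmeas_conj mh)) _ (hint i j 2)).
  by move=> t; rewrite normcM normc_conj expr2.
have [p1 q1] := Ec_prod i2 ia; have [p2 q2] := Ec_prod i2' ib.
have [p3 q3] := Ec_prod ih iah; have [p4 q4] := Ec_prod ih ibh.
have eL2 x : L (H i j x.1) (rmat H x.2) =
  (complex.Re (h x.1 * h x.1 * a x.2) + complex.Re (h x.1 * conjc (h x.1) * b x.2)) -
  (complex.Re (h x.1 * (a x.2 * h x.2)) + complex.Re (h x.1 * (b x.2 * conjc (h x.2)))).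
  rewrite -!ReD -ReN -ReD /L !mxE; congr complex.Re; rewrite /a /b /h conjcD conjcN.
  ring.
have kk : intg P (fun t => complex.Re (N%:R^-1 * (s i j)%:C%C * b t)) /\
          intg P (fun t => complex.Re (N%:R^-1 * tau i j * a t)).
  split; apply: (intg_dom (g := fun=> _) _ _ (intg_cst P _)).
  - exact: (cmeasM (cmeas_cst _ _) mb).1.
  - by move=> t; apply: le_trans (Re_le_normc _) _; exact: nM_le (lexx _) (nb t).
  - exact: (cmeasM (cmeas_cst _ _) ma).1.
  - by move=> t; apply: le_trans (Re_le_normc _) _; exact: nM_le (lexx _) (na t).
have eB t : complex.Re (mv i * (N%:R^-1 *
    ((s i j)%:C%C * bFM (rmat H t) i j + tau i j * aFM (rmat H t) i j))) =
  complex.Re (N%:R^-1 * (s i j)%:C%C * b t) + complex.Re (N%:R^-1 * tau i j * a t).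
  by rewrite -ReD; congr complex.Re; rewrite /a /b; ring.
split.
- exact: (intg_ext (fun x => esym (eL x)) j1).
- by apply: (intg_ext (fun x => esym (eB x))); case: kk => k1 k2; exact: intgD.
rewrite (Ex_ext _ eL) j3 (Ex_ext _ eL2) (Ex_ext _ eB).
rewrite (ExB (intgD p1 p2) (intgD p3 p4)) (ExD p1 p2) (ExD p3 p4).
rewrite q1 q2 q3 q4 hmean !mul0r addr0 subr0 hs htau.
by case: kk => k1 k2; rewrite (ExD k1 k2) !Re_Ec // addrC.
Qed.

(** Subtracting the vanishing term of [zero_term] turns E[H_ij phi(H)] into the expectation of H_ij
    times a difference of [phi], which is split into its linear part and [remd]. *)
Lemma main_term i j : [/\
  intg P (fun t => complex.Re (mv i * (rmat H t i j * phiM j (rmat H t)))),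
  intg PP (fun x => complex.Re (mv i * (H i j x.1 * remd i j x))) &
  Ex P (fun t => complex.Re (mv i * (rmat H t i j * phiM j (rmat H t)))) =
  Ex P (fun t => complex.Re (mv i * (N%:R^-1 *
    ((s i j)%:C%C * bFM (rmat H t) i j + tau i j * aFM (rmat H t) i j)))) +
  Ex PP (fun x => complex.Re (mv i * (H i j x.1 * remd i j x)))].
Proof.
have [z1 z2] := zero_term i j; have [l1 l2 l3] := lin_term_E i j.
have im : intg P (fun t => complex.Re (mv i * (rmat H t i j * phiM j (rmat H t)))).
  apply: (@intg_dom _ _ _ _ _ (fun t => normc (mv i) * ((Kc * (3 * Kc ^+ 2) ^+ m.+2) * normc (H i j t)))).
  - have hc : cmeas (fun t => mv i * (rmat H t i j * phiM j (rmat H t))).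
      by apply: cmeasM (cmeas_cst _ _) _; apply: cmeasM (mmeas_H mH i j) _; exact: cmeas_phi.
    exact: hc.1.
  - move=> t; apply: le_trans (Re_le_normc _) _; apply: nM_le (lexx _) _.
    by rewrite mulrC mxE; apply: nM_le (lexx _); exact: phi_le (herm_H hH t).
  - by apply: intgZ; exact: intgZ.
have im1 := intg_fst im.
have er x : complex.Re (mv i * (H i j x.1 * remd i j x)) =
  complex.Re (mv i * (rmat H x.1 i j * phiM j (rmat H x.1))) -
  complex.Re (mv i * (H i j x.1 * phiM j (rmat2 H i j x))) -
  complex.Re (mv i * (H i j x.1 *
    lin_term z s v w (offd R i j) (H i j x.1 - H i j x.2) i j m (g (rmat2 H i j x)))).
  by rewrite -!ReN -!ReD mxE /remd; congr complex.Re; ring.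
split => //.
  by apply: (intg_ext (fun x => esym (er x))); apply: intgB => //; exact: intgB.
rewrite (Ex_ext _ er) (ExB (intgB im1 z1) l1) (ExB im1 z1) z2 l3 (Ex_fst im).
ring.
Qed.

Lemma Re_sum2 (f : 'I_N -> 'I_N -> C) :
  complex.Re (\sum_i \sum_j f i j) = \sum_i \sum_j complex.Re (f i j).
Proof. by rewrite Re_sum; apply: eq_bigr => i _; rewrite Re_sum. Qed.

Lemma Xpow_intg k : intg P (fun t => XM (rmat H t) ^+ k).
Proof.
apply: (@intg_bdd _ _ _ _ _ ((3 * Kc ^+ 2) ^+ k)).
  by apply: measurable_funX; exact: measurable_X.
move=> t; rewrite normrX lerXn2r ?nnegrE ?mulr_ge0 ?exprn_ge0 //.
exact: X_le (herm_H hH t).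
Qed.

Lemma moment_identity :
  intg P (fun t => complex.Re (bulkM (rmat H t))) /\
  Ex P (fun t => XM (rmat H t) ^+ m.+3) = Ex P (fun t => complex.Re (bulkM (rmat H t))) +
  \sum_i \sum_j Ex PP (fun x => complex.Re (mv i * (H i j x.1 * remd i j x))).
Proof.
pose f1 t := \sum_i \sum_j complex.Re (mv i * (rmat H t i j * phiM j (rmat H t))).
pose f2 t := complex.Re (N%:R^-1 * (\sum_l (g (rmat H t)) l l * sesq (lv l) (g (rmat H t)) w) *
   (XM (rmat H t) ^+ m.+2)%:C%C).
pose f3 t := \sum_i \sum_j complex.Re (mv i * (N%:R^-1 *
    ((s i j)%:C%C * bFM (rmat H t) i j + tau i j * aFM (rmat H t) i j))).
have i1' : intg P f1.
  by apply: intg_sum => i; apply: intg_sum => j; have [] := main_term i j.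
have i3 : intg P f3.
  by apply: intg_sum => i; apply: intg_sum => j; have [] := lin_term_E i j.
have ex t : XM (rmat H t) ^+ m.+3 = f1 t + f2 t by rewrite X_expand //; exact: herm_H.
have i2 : intg P f2.
  apply: (@intg_ext _ _ _ _ (fun t => XM (rmat H t) ^+ m.+3 - f1 t)).
    by move=> t; rewrite ex addrC addKr.
  by apply: intgB => //; exact: Xpow_intg.
have eb t : complex.Re (bulkM (rmat H t)) = f3 t + f2 t.
  by rewrite /bulk ReD Re_sum2.
split; first by apply: (intg_ext (fun t => esym (eb t))); exact: intgD.
rewrite (Ex_ext _ ex) (Ex_ext _ eb) !ExD // addrAC; congr (_ + _).
rewrite /f1 /f3 !Ex_sum => [|i|i]; last 2 first.
- by apply: intg_sum => j; have [] := lin_term_E i j.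
- by apply: intg_sum => j; have [] := main_term i j.
rewrite -big_split /=; apply: eq_bigr => i _.
rewrite !Ex_sum => [|j|j]; last 2 first.
- by have [] := lin_term_E i j.
- by have [] := main_term i j.
by rewrite -big_split /=; apply: eq_bigr => j _; have [_ _ ->] := main_term i j.
Qed.

End Identity.

(** * Recursive inequality between moments of the error *)

Section MomentInequality.
Context (R : realType) d (T : measurableType d) (P : probability T R) (N : nat).
Local Notation C := R[i].
Variable H : 'I_N -> 'I_N -> T -> C.
Hypothesis mH : forall i j, measurable_fun setT (fun w => reim (H i j w)).
Hypothesis hH : forall i j w, H j i w = conjc (H i j w).
Hypothesis indep : entries_independent P H.
Local Notation PP := (P \x P)%E.
Local Notation e := (basis R).
Variables (z : C) (s : 'I_N -> 'I_N -> R) (tau : 'I_N -> 'I_N -> C) (v w : 'cV[C]_N) (m : nat).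
Hypothesis n0 : (0 < N)%N.
Hypothesis hz : 0 < complex.Im z.
Hypothesis hmean : forall i j, Ec P (H i j) = 0.
Hypothesis hint : forall i j k, intg P (fun t => normc (H i j t) ^+ k).
Hypothesis hs : forall i j, Ec P (fun t => H i j t * conjc (H i j t)) = N%:R^-1 * (s i j)%:C%C.
Hypothesis htau : forall i j, Ec P (fun t => H i j t * H i j t) = N%:R^-1 * tau i j.
Local Notation lv := (lv s v).
Variable F : seq 'cV[C]_N.
Hypothesis Fe : forall i, e i \in F.
Hypothesis Fv : v \in F.
Hypothesis Fw : w \in F.
Hypothesis Fl : forall l, lv l \in F.
Local Notation cs := (cof s).
Hypothesis FcS : forall j, lvec v cs j \in F /\ rvec v cs j \in F.
Hypothesis FcSo : forall j, lvec v (off_arr cs) j \in F /\ rvec v (off_arr cs) j \in F.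
Hypothesis FcT : forall j, lvec v tau j \in F /\ rvec v tau j \in F.
Hypothesis FcTo : forall j, lvec v (off_arr tau) j \in F /\ rvec v (off_arr tau) j \in F.
Hypothesis hv : vnorm v <= 1.
Hypothesis hvw : normc ((adjm v *m w) 0 0) <= 1.
Variable Kc : R.
Hypothesis Kc1 : 1 <= Kc.
Hypothesis good_c : forall M, hermm M -> good Kc z F (res z M).

Local Notation g := (res z).
Local Notation XM M := (complex.Re (fD z s v w (g M))).
Local Notation bulkM M := (bulk z s tau v w m (g M)).
Local Notation gH t := (g (rmat H t)).
Local Notation remd := (remd H z s v w m).

Variables (K rho theta delta sq : R).
Hypothesis K1 : 1 <= K.
Hypothesis rho0 : 0 <= rho.
Hypothesis theta0 : 0 < theta.
Hypothesis hrK : 12 * rho * K ^+ 3 <= 1.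
Hypothesis sq0 : 0 <= sq.
Hypothesis hsq : K <= sq ^+ 2 * complex.Im z.
Hypothesis c4 : forall i j, Ex P (fun t => normc (H i j t) ^+ 4) <= 1.

Definition goodset := [set t | good K z F (gH t)].
Definition big_entry i j := [set t | rho < normc (H i j t)].

Hypothesis hgood : fine (P (~` goodset)) <= delta.
Hypothesis hbig : forall i j, fine (P (big_entry i j)) <= delta.

Let B := crude_cst m Kc.
Let xi := 12 * rho * K ^+ 3.
Let Y t := (`|XM (rmat H t)| + xi) ^+ m.

Let Kc0 : 0 <= Kc. Proof. by apply: le_trans Kc1. Qed.
Let K0 : 0 <= K. Proof. by apply: le_trans K1. Qed.
Let xi0 : 0 <= xi. Proof. rewrite /xi; nneg. Qed.
Let Y0 t : 0 <= Y t. Proof. by rewrite exprn_ge0 // addr_ge0. Qed.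

Let mG : mmeas (fun t => gH t).
Proof. exact: mmeas_res (mmeas_H mH). Qed.

Lemma mgoodset : measurable goodset.
Proof. exact: measurable_good. Qed.

Lemma mbig i j : measurable (big_entry i j).
Proof.
rewrite (_ : big_entry i j = setT `&` (fun t => normc (H i j t)) @^-1` [set` `]rho, +oo[%R]); last first.
  by rewrite setTI; apply/seteqP; split => t /=; rewrite in_itv /= andbT.
by apply: (cmeas_normc (cmeas_H mH i j)) => //; exact: measurable_itv.
Qed.

Let X_le M : hermm M -> `|XM M| <= 3 * Kc ^+ 2.
Proof. by move=> hM; apply: (@X_crude _ _ z s v w F) => //; exact: good_c. Qed.

Lemma norm_w t : goodset t -> vnorm (gH t *m w) <= sq.
Proof.
move=> gt.
rewrite -(ler_pXn2r (n := 2)) ?nnegrE ?vnorm_ge0 // -(ler_pM2r hz).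
apply: le_trans hsq; rewrite vnorm_sq ward //; last exact: herm_H.
apply: le_trans (ler_norm _) _; apply: le_trans (Im_le_normc _) _.
exact: (good1 gt).
Qed.

Lemma entry_sesq i t : normc (sesq (e i) (gH t) w) = normc ((gH t *m w) i 0).
Proof. by rewrite sesq_basisl. Qed.

Let one : 'cV[C]_N := \col_i 1.

Let one_norm : vnorm one = Num.sqrt N%:R.
Proof.
rewrite /vnorm /sqn; congr Num.sqrt.
under eq_bigr do rewrite mxE normc1 expr1n.
by rewrite sumr_const card_ord.
Qed.

Let sumG t : \sum_j normc (sesq (e j) (gH t) w) <= Num.sqrt N%:R * vnorm (gH t *m w).
Proof.
rewrite -one_norm; apply: le_trans (dot_sum_le one _).
by apply: ler_sum => j _; rewrite mxE normc1 mul1r entry_sesq.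
Qed.

(** Cauchy-Schwarz twice. The first half is N times <|v|, |G w|>; in the second half both sums cost
    a factor N^(1/2). A termwise bound would lose the smallness of |G w|. *)
Lemma sum_vA t : goodset t ->
  \sum_i \sum_j normc (v i 0) * (normc (sesq (e i) (gH t) w) + normc (sesq (e j) (gH t) w)) <=
  2 * N%:R * sq.
Proof.
move=> gt; have hw := norm_w gt.
have -> : \sum_i \sum_j normc (v i 0) * (normc (sesq (e i) (gH t) w) + normc (sesq (e j) (gH t) w)) =
  N%:R * (\sum_i normc (v i 0) * normc ((gH t *m w) i 0)) +
  (\sum_i normc (v i 0)) * (\sum_j normc (sesq (e j) (gH t) w)).
  rewrite mulr_sumr mulr_suml -big_split /=; apply: eq_bigr => i _.
  by rewrite -mulr_sumr big_split /= sumr_const card_ord -mulr_natl entry_sesq; ring.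
rewrite -mulrA mulrDl mul1r; apply: lerD.
  apply: ler_wpM2l => //; apply: le_trans (dot_sum_le _ _) _.
  by apply: le_trans (ler_pM _ _ hv hw) _; rewrite ?vnorm_ge0 ?mul1r.
have h1 : \sum_i normc (v i 0) <= Num.sqrt N%:R.
  rewrite -one_norm -[X in _ <= X]mul1r; apply: le_trans (_ : vnorm v * vnorm one <= _).
    apply: le_trans (dot_sum_le _ _); apply: ler_sum => i _.
    by rewrite mxE normc1 mulr1.
  by apply: ler_wpM2r; rewrite ?vnorm_ge0.
apply: le_trans (ler_pM _ _ h1 (sumG t)) _.
- by apply: sumr_ge0 => i _; exact: normc_ge0.
- by apply: sumr_ge0 => i _; exact: normc_ge0.
by rewrite mulrA -expr2 sqr_sqrtr // ler_wpM2l.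
Qed.

Let Z i j (x : T * T) := 1 + normc (H i j x.1) ^+ 2 + normc (H i j x.2) ^+ 2.
Let goodset2 i j := [set x : T * T | good K z F (g (rmat2 H i j x))].
Let Bd i j (x : T * T) : R := \1_(~` goodset) x.1 + \1_(~` goodset2 i j) x +
  \1_(big_entry i j) x.1 + \1_(big_entry i j) x.2.

Let c1 := 800 * m.+2%:R ^+ 2 * K ^+ 6 * rho ^+ 3.

Let res_pair i j x (xx := H i j x.1 - H i j x.2) :
  gH x.1 - g (rmat2 H i j x) = - (g (rmat2 H i j x) *m Dmx (offd R i j) xx i j *m gH x.1).
Proof.
have := res_diff (herm_H hH x.1) (herm_H2 hH i j x) hz hz.
by rewrite subrr raddf0 addr0 rmat_sub // => <-; rewrite opprB.
Qed.

(** The third power of rho in [c1] arises from |H_ij| <= rho and from the square of |H_ij - H'_ij|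
    <= 2 rho in [remainder_le]. *)
Let rem_good i j x : goodset x.1 -> goodset2 i j x ->
  normc (H i j x.1) <= rho -> normc (H i j x.2) <= rho ->
  normc (conjc (v i 0) * (H i j x.1 * remd i j x)) <=
  c1 * (normc (v i 0) * (normc (sesq (e i) (gH x.1) w) + normc (sesq (e j) (gH x.1) w))) * Y x.1.
Proof.
move=> g1 g2 h1 h2.
have ha : normc (H i j x.1 - H i j x.2) <= 2 * rho.
  by apply: le_trans (normcB _ _) _; lra.
have d0 := res_pair i j x.
set a := normc (H i j x.1 - H i j x.2) in ha *.
have a0 : 0 <= a by exact: normc_ge0.
have K3 : K <= K ^+ 3 by rewrite exprS ler_peMr // exprn_ege1.
have haK3 : 6 * a * K ^+ 3 <= xi.
  by rewrite /xi; apply: ler_wpM2r; [rewrite exprn_ge0 | lra].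
have haK3' : 6 * a * K ^+ 3 <= 1 by apply: le_trans haK3 _.
have haK : 2 * a * K <= 1.
  have : a * K <= a * K ^+ 3 by apply: ler_wpM2l.
  have : 0 <= a * K ^+ 3 by rewrite mulr_ge0 // exprn_ge0.
  lra.
have := @remainder_le R N z s v w F n0 Fe Fv Fw Fl K K1 (offd R i j) (H i j x.1 - H i j x.2) i j
  (g (rmat2 H i j x)) (gH x.1) (offd_le _ _ _) g2 g1 d0 haK m hvw haK3'.
rewrite -/a; set A := normc _ + normc _; move=> hr.
have A0 : 0 <= A by rewrite addr_ge0 ?normc_ge0.
rewrite !normcM normc_conj.
have hYY : (`|XM (rmat H x.1)| + 6 * a * K ^+ 3) ^+ m <= Y x.1.
  by apply: lerXn2r; rewrite ?nnegrE ?lerD2l //; nneg.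
have ha2 : a ^+ 2 <= 4 * rho ^+ 2.
  have -> : 4 * rho ^+ 2 = (2 * rho) ^+ 2 by ring.
  by rewrite lerXn2r ?nnegrE // mulr_ge0.
have hr2 : normc (remd i j x) <= 200 * m.+2%:R ^+ 2 * K ^+ 6 * (4 * rho ^+ 2) * A * Y x.1.
  apply: le_trans hr _; apply: ler_pM; [by nneg|by nneg| |exact: hYY].
  by apply: ler_wpM2r; [|apply: ler_wpM2l]; nneg.
have := ler_pM (normc_ge0 _) (normc_ge0 _) h1 hr2.
move=> /(ler_wpM2l (normc_ge0 (v i 0))) /le_trans; apply.
rewrite le_eqVlt; apply/orP; left; apply/eqP; rewrite /c1; ring.
Qed.

Let v1 i : normc (v i 0) <= 1.
Proof.
apply: le_trans hv; rewrite -(ler_pXn2r (n := 2)) ?nnegrE ?normc_ge0 ?vnorm_ge0 // vnorm_sq.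
rewrite /sqn (bigD1 i) //= lerDl; apply: sumr_ge0 => j _; exact: exprn_ge0 (normc_ge0 _).
Qed.

Let B_ge : Kc * (3 * Kc ^+ 2) ^+ m.+2 <= B /\ 0 <= B.
Proof.
have l0 k : 0 <= (3 * Kc ^+ 2) ^+ k by rewrite exprn_ge0 // mulr_ge0 // exprn_ge0.
have q0 : 0 <= Kc * (m.+2%:R * (3 * Kc ^+ 2) ^+ m.+1) * (3 * Kc ^+ 3).
  apply: mulr_ge0; first by apply: mulr_ge0 => //; exact: mulr_ge0.
  by apply: mulr_ge0 => //; exact: exprn_ge0.
have q1 : Kc * (3 * Kc ^+ 2) ^+ m.+2 <= Kc ^+ 2 * (3 * Kc ^+ 2) ^+ m.+2.
  by apply: ler_wpM2r => //; rewrite expr2 ler_peMl.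
have q2 : 0 <= Kc * (3 * Kc ^+ 2) ^+ m.+2 by exact: mulr_ge0.
rewrite /B /crude_cst; split; lra.
Qed.

Let rem_crude i j x :
  normc (conjc (v i 0) * (H i j x.1 * remd i j x)) <= 4 * B * Z i j x.
Proof.
have [hB B0] := B_ge.
have hM1 := herm_H hH x.1; have hM2 := herm_H2 hH i j x.
have p1 : normc (phi z s v w j m (gH x.1)) <= B.
  by apply: le_trans hB; apply: (@phi_crude _ _ z s v w m F) => //; exact: good_c.
have p2 : normc (phi z s v w j m (g (rmat2 H i j x))) <= B.
  by apply: le_trans hB; apply: (@phi_crude _ _ z s v w m F) => //; exact: good_c.
have a1 : normc (aF z s v w m (g (rmat2 H i j x)) i j) <= B.
  by apply: (@aF_crude _ _ z s v w m F) => //; exact: good_c.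
have b1 : normc (bF z s v w m (g (rmat2 H i j x)) i j) <= B.
  by apply: (@bF_crude _ _ z s v w m F) => //; exact: good_c.
set h := normc (H i j x.1); set h' := normc (H i j x.2).
have hx : normc (H i j x.1 - H i j x.2) <= h + h' by exact: normcB.
have hr : normc (remd i j x) <= (B + B) + (B * (h + h') + B * (h + h')).
  rewrite /remd lin_termE; apply: le_trans (normcB _ _) _; apply: lerD.
    by apply: le_trans (normcB _ _) _; apply: lerD.
  by apply: nD_le; apply: nM_le => //; rewrite normc_conj.
rewrite normcM normc_conj.
apply: le_trans (ler_pM (normc_ge0 _) (normc_ge0 _) (v1 i) (nM_le (lexx _) hr)) _.
rewrite mul1r -/h /Z -/h -/h'.
have -> : h * (B + B + (B * (h + h') + B * (h + h'))) = B * (2 * h * (1 + h + h')) by ring.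
rewrite [X in _ <= X](_ : _ = B * (4 * (1 + h ^+ 2 + h' ^+ 2))); last by ring.
apply: ler_wpM2l => //.
have := sqr_ge0 (h - 1); have := sqr_ge0 (h - h'); have := sqr_ge0 h'; rewrite !sqrrB; nra.
Qed.

(** Young's inequality. It takes the role of Cauchy-Schwarz for the expectation of Z on a rare
    event: [theta] is small, and the probability of the event is far smaller than [theta]. *)
Let Z_theta i j x : Z i j x <= theta * Z i j x ^+ 2 + theta^-1.
Proof.
have z0 : 0 <= Z i j x by rewrite /Z; nneg.
move: (Z i j x) z0 => q q0.
rewrite -(ler_pM2l theta0) mulrDr divff ?gt_eqF // mulrA -expr2 -exprMn.
have := sqr_ge0 (theta * q - 1); have : 0 <= theta * q by rewrite mulr_ge0 // ltW.
move: (theta * q) => y; rewrite sqrrB mulr1 expr1n; lra.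
Qed.

(** Either both matrices are good and both copies of the entry are at most rho, or [Bd] is at least
    1 and the crude bound 4 B Z is hidden in the second term by [Z_theta]. *)
Lemma rem_bound i j x :
  complex.Re (conjc (v i 0) * (H i j x.1 * remd i j x)) <=
  c1 * (normc (v i 0) * (normc (sesq (e i) (gH x.1) w) + normc (sesq (e j) (gH x.1) w)))
    * Y x.1 * \1_goodset x.1 + 4 * B * (theta * Z i j x ^+ 2 + theta^-1 * Bd i j x).
Proof.
apply: le_trans (ler_norm _) _; apply: le_trans (Re_le_normc _) _.
have [hB B0] := B_ge.
have i0 (U : Type) (A : set U) y : 0 <= (\1_A y : R) by rewrite indicE ler0n.
have c10 : 0 <= c1 by rewrite /c1; nneg.
have b0 : 0 <= Bd i j x by rewrite /Bd; do 3 (apply: addr_ge0 => //).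
have t0 : 0 <= theta * Z i j x ^+ 2.
  by rewrite mulr_ge0 ?(ltW theta0) // sqr_ge0.
have nn : 0 <= 4 * B * (theta * Z i j x ^+ 2 + theta^-1 * Bd i j x).
  by apply: mulr_ge0; [exact: mulr_ge0 | apply: addr_ge0 => //; rewrite mulr_ge0 // invr_ge0 ltW].
have crude : 1 <= Bd i j x -> normc (conjc (v i 0) * (H i j x.1 * remd i j x)) <=
  c1 * (normc (v i 0) * (normc (sesq (e i) (gH x.1) w) + normc (sesq (e j) (gH x.1) w)))
    * Y x.1 * \1_goodset x.1 + 4 * B * (theta * Z i j x ^+ 2 + theta^-1 * Bd i j x).
  move=> h1; apply: le_trans (rem_crude i j x) _.
  rewrite -[X in X <= _]add0r; apply: lerD.
    by apply: mulr_ge0 => //; apply: mulr_ge0 => //; nneg.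
  apply: ler_wpM2l; first exact: mulr_ge0.
  apply: le_trans (Z_theta i j x) _; rewrite lerD2l ler_peMr // invr_ge0 ltW //.
have [g1|g1] := boolP (good K z F (gH x.1)); last first.
  apply: crude; rewrite /Bd {1}indicE mem_set /=; last exact/negP.
  by rewrite -!addrA lerDl !addr_ge0.
have [g2|g2] := boolP (good K z F (g (rmat2 H i j x))); last first.
  apply: crude; rewrite /Bd [X in _ + X + _ + _]indicE mem_set /=; last exact/negP.
  by rewrite [X in X + _ + _]addrC -!addrA lerDl !addr_ge0.
have [h1|h1] := leP (normc (H i j x.1)) rho; last first.
  apply: crude; rewrite /Bd [X in _ + X + _]indicE mem_set //=.
  by rewrite [X in X + _]addrC -!addrA lerDl !addr_ge0.
have [h2|h2] := leP (normc (H i j x.2)) rho; last first.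
  apply: crude; rewrite /Bd [X in _ + X]indicE mem_set //=.
  by rewrite lerDr !addr_ge0.
apply: le_trans (rem_good g1 g2 h1 h2) _.
by rewrite [\1_goodset _]indicE mem_set //= mulr1 lerDl.
Qed.

Let i0 (U : Type) (A : set U) y : 0 <= (\1_A y : R).
Proof. by rewrite indicE ler0n. Qed.

Let i01 (U : Type) (A : set U) y : `|\1_A y : R| <= 1.
Proof. by rewrite indicE; case: (_ \in _); rewrite ?normr1 ?normr0. Qed.

Let A_ i j t := normc (v i 0) * (normc (sesq (e i) (gH t) w) + normc (sesq (e j) (gH t) w)).

Let mA i j : measurable_fun setT (A_ i j).
Proof.
apply: measurable_funM; first exact: measurable_cst.
by apply: measurable_funD; apply: cmeas_normc; exact: cmeas_sesq.
Qed.

Let mY : measurable_fun setT Y.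
Proof.
apply: measurable_funX; apply: measurable_funD; last exact: measurable_cst.
by apply: measurableT_comp => //; exact: measurable_X.
Qed.

Let Y_bd t : `|Y t| <= (3 * Kc ^+ 2 + xi) ^+ m.
Proof.
rewrite ger0_norm //; apply: lerXn2r; rewrite ?nnegrE; try by nneg.
by rewrite lerD2r; exact: X_le (herm_H hH t).
Qed.

Lemma Y_intg : intg P Y.
Proof. exact: intg_bdd mY Y_bd. Qed.

Let A_bd i j t : `|A_ i j t| <= 2 * Kc.
Proof.
rewrite ger0_norm; last by rewrite /A_; nneg.
have g1 := good_c (herm_H hH t).
have h1 : normc (sesq (e i) (gH t) w) <= Kc by exact: (good1 g1).
have h2 : normc (sesq (e j) (gH t) w) <= Kc by exact: (good1 g1).
apply: le_trans (ler_pM (normc_ge0 _) (addr_ge0 (normc_ge0 _) (normc_ge0 _)) (v1 i) (lerD h1 h2)) _.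
lra.
Qed.

Let t1 i j t : R := c1 * A_ i j t * Y t * \1_goodset t.

Let c10 : 0 <= c1. Proof. by rewrite /c1; nneg. Qed.

Let t1_intg i j : intg P (t1 i j).
Proof.
apply: (@intg_bdd _ _ _ _ _ (c1 * (2 * Kc) * (3 * Kc ^+ 2 + xi) ^+ m * 1)).
  apply: measurable_funM; last exact: measurable_indic mgoodset.
  apply: measurable_funM => //; apply: measurable_funM => //; exact: measurable_cst.
move=> t; rewrite /t1 normrM [`|c1 * _ * _|]normrM [`|c1 * _|]normrM (ger0_norm c10).
apply: ler_pM (i01 _ _) => //; first by nneg.
by apply: ler_pM (Y_bd _) => //; [nneg | apply: ler_wpM2l].
Qed.

Let Zsq_bd i j x : Z i j x ^+ 2 <= 3 * (1 + normc (H i j x.1) ^+ 4 + normc (H i j x.2) ^+ 4).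
Proof.
rewrite /Z; set a := normc _ ^+ 2; set b := normc _ ^+ 2.
have -> : normc (H i j x.1) ^+ 4 = a ^+ 2 by rewrite /a -exprM.
have -> : normc (H i j x.2) ^+ 4 = b ^+ 2 by rewrite /b -exprM.
have := sqr_ge0 (a - 1); have := sqr_ge0 (b - 1); have := sqr_ge0 (a - b).
rewrite !sqrrB !sqrrD; lra.
Qed.

Let ch i j k : cmeas (fun x : T * T => H i j x.1) /\ cmeas (fun x : T * T => H k j x.2).
Proof. by split; [exact: cmeas_comp (cmeas_H mH _ _) measurable_fst | exact: cmeas_comp (cmeas_H mH _ _) measurable_snd]. Qed.

Let mZ i j : measurable_fun setT (Z i j).
Proof.
have [m1 m2] := ch i j i.
apply: measurable_funD; last by apply: measurable_funX; exact: cmeas_normc.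
by apply: measurable_funD; [exact: measurable_cst | apply: measurable_funX; exact: cmeas_normc].
Qed.

Let Zdom i j := fun x : T * T => 3 * (1 + normc (H i j x.1) ^+ 4 + normc (H i j x.2) ^+ 4).

Let Zdom_intg i j : intg PP (Zdom i j) /\ Ex PP (Zdom i j) <= 9.
Proof.
have a1 := intg_fst (hint i j 4); have a2 := intg_snd (hint i j 4).
have a3 := intgD (intgD (intg_cst PP 1) a1) a2.
split; first exact: intgZ.
rewrite /Zdom (ExZ _ a3) (ExD (intgD (intg_cst PP 1) a1) a2) (ExD (intg_cst PP 1) a1) Ex_cst.
rewrite (Ex_fst (hint i j 4)) (Ex_snd (hint i j 4)).
have := c4 i j; lra.
Qed.

Let Zsq_intg i j : intg PP (fun x => Z i j x ^+ 2).
Proof.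
have [a1 _] := Zdom_intg i j.
apply: (intg_dom (g := Zdom i j)) => //; first exact: measurable_funX.
by move=> x; rewrite ger0_norm ?sqr_ge0 //; exact: Zsq_bd.
Qed.

Let Zsq_le i j : Ex PP (fun x => Z i j x ^+ 2) <= 9.
Proof.
have [a1 a2] := Zdom_intg i j; apply: le_trans a2.
by apply: Ex_le => //; exact: Zsq_bd.
Qed.

(** The event concerns the resampled matrix, whose law is that of H: [resampleE] is applied to a
    functional that ignores its first argument. *)
Let b2 i j : intg PP (fun x => \1_(~` goodset2 i j) x : R) /\
   Ex PP (fun x => \1_(~` goodset2 i j) x : R) <= delta.
Proof.
pose ph (h : C) (M : 'M[C]_N) : R := (~~ good K z F (g M))%:R.
have mph : meas2 ph.
  move=> d' T' h M mh mM.
  have hm := measurable_good z (mmeas_res z mM) K F.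
  have := measurable_indic (R := R) (D := setT) (measurableC hm).
  rewrite (_ : \1_(~` _) = (fun t => ph (h t) (M t))) //.
  apply: funext => t; rewrite indicE /ph; congr (nat_of_bool _)%:R.
  by apply/idP/idP => [|/negP ?]; [rewrite inE => /negP|rewrite inE].
have bd h M : `|ph h M| <= 1 by rewrite /ph; case: good; rewrite ?normr0 ?normr1.
have e2 x : \1_(~` goodset2 i j) x = ph (H i j x.1) (rmat2 H i j x).
  rewrite indicE /ph; congr (nat_of_bool _)%:R.
  by apply/idP/idP => [|/negP ?]; [rewrite inE => /negP|rewrite inE].
have [j1 j2 j3] := resampleE mH hH indep mph (intg_cst PP 1) (fun x => bd _ (rmat2 H i j x)) (fun x => bd (H i j x.1) (rmat H x.2)).
split; first exact: (intg_ext (fun x => esym (e2 x)) j1).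
rewrite (Ex_ext _ e2) j3; apply: le_trans hgood.
rewrite -Ex_indic; last exact: measurableC mgoodset.
rewrite -(Ex_snd (a := fun t => \1_(~` goodset) t)); last exact: intg_indic (measurableC mgoodset).
rewrite le_eqVlt; apply/orP; left; apply/eqP; apply: Ex_ext => x.
rewrite indicE /ph; congr (nat_of_bool _)%:R.
by apply/idP/idP => [/negP ?|]; [rewrite inE|rewrite inE => /negP].
Qed.

Let Bd_intg i j : intg PP (Bd i j) /\ Ex PP (Bd i j) <= 4 * delta.
Proof.
have mg := measurableC mgoodset; have mb := mbig i j.
have k1 := intg_indic P mg; have k2 := intg_indic P mb.
have [l1 l2] := b2 i j.
have p1 := intg_fst k1; have p2 := intg_fst k2; have p3 := intg_snd k2.
split; first by apply: intgD => //; apply: intgD => //; exact: intgD.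
rewrite /Bd (ExD (intgD (intgD p1 l1) p2) p3) (ExD (intgD p1 l1) p2) (ExD p1 l1).
rewrite (Ex_fst k1) (Ex_fst k2) (Ex_snd k2) (Ex_indic _ mg) (Ex_indic _ mb).
apply: (@le_trans _ _ (delta + delta + delta + delta)); last by lra.
apply: lerD; [apply: lerD; [exact: lerD|exact: hbig]|exact: hbig].
Qed.

Let t2 i j x := 4 * B * (theta * Z i j x ^+ 2 + theta^-1 * Bd i j x).

Let t2_intg i j : intg PP (t2 i j) /\ Ex PP (t2 i j) <= 4 * B * (9 * theta + theta^-1 * (4 * delta)).
Proof.
have [l1 l2] := Bd_intg i j; have [_ B0] := B_ge.
have a1 := intgZ theta (Zsq_intg i j); have a2 := intgZ theta^-1 l1.
split; first by apply: intgZ; exact: intgD.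
rewrite /t2 (ExZ _ (intgD a1 a2)) (ExD a1 a2) (ExZ _ (Zsq_intg i j)) (ExZ _ l1).
apply: ler_wpM2l; first by nneg.
apply: lerD; last by apply: ler_wpM2l => //; nneg.
by rewrite mulrC; apply: ler_wpM2r (Zsq_le i j); exact: ltW.
Qed.

Let bulk_crude_cst := 27 * m.+2%:R * Kc ^+ 6 * (3 * Kc ^+ 2) ^+ m.

(** On the good event the average of |<e_j, G w>| is at most N^(-1/2) |G w| <= sq / N^(1/2);
    elsewhere the crude bounds pay. *)
Let bulk_bound t : complex.Re (bulkM (rmat H t)) <=
  27 * m.+2%:R * K ^+ 5 * (sq / Num.sqrt N%:R) * Y t + bulk_crude_cst * \1_(~` goodset) t.
Proof.
apply: le_trans (ler_norm _) _; apply: le_trans (Re_le_normc _) _.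
have sN : 0 < Num.sqrt N%:R :> R by rewrite sqrtr_gt0 ltr0n.
have XY : `|XM (rmat H t)| ^+ m <= Y t by apply: lerXn2r; rewrite ?nnegrE ?lerDl //; nneg.
have bc0 : 0 <= bulk_crude_cst by rewrite /bulk_crude_cst; nneg.
have q0 : 0 <= 27 * m.+2%:R * K ^+ 5 * (sq / Num.sqrt N%:R) by nneg.
have [g1|g1] := boolP (good K z F (gH t)).
  rewrite -[X in X <= _]addr0; apply: lerD; last by apply: mulr_ge0.
  have := @bulk_le R N z s tau v w m F n0 Fe Fv Fw Fl K K1 FcS FcSo FcT FcTo hvw _ g1.
  move=> /le_trans; apply.
  rewrite [X in _ <= X](_ : _ = 27 * m.+2%:R * K ^+ 5 * Y t * (sq / Num.sqrt N%:R)); last by ring.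
  apply: ler_pM; [by nneg| | |].
  - by apply: mulr_ge0; [nneg | apply: sumr_ge0 => j _; nneg].
  - by apply: ler_wpM2l => //; nneg.
  have -> : sq / Num.sqrt N%:R = N%:R^-1 * (Num.sqrt N%:R * sq).
    have -> : (N%:R^-1 : R) = (Num.sqrt N%:R)^-1 * (Num.sqrt N%:R)^-1.
      by rewrite -invfM -expr2 sqr_sqrtr.
    by field; rewrite gt_eqF.
  apply: ler_wpM2l; first by nneg.
  apply: le_trans (sumG t) _; apply: ler_wpM2l; [by nneg | exact: norm_w].
rewrite -[X in X <= _]add0r; apply: lerD; first by apply: mulr_ge0.
rewrite indicE mem_set /=; last exact/negP.
rewrite mulr1.
have gc := good_c (herm_H hH t).
have := @bulk_le R N z s tau v w m F n0 Fe Fv Fw Fl Kc Kc1 FcS FcSo FcT FcTo hvw _ gc.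
move=> /le_trans; apply; rewrite /bulk_crude_cst.
rewrite [X in _ <= X](_ : _ = 27 * m.+2%:R * Kc ^+ 5 * (3 * Kc ^+ 2) ^+ m * Kc); last first.
  by rewrite (exprS Kc 5); ring.
apply: ler_pM; [by nneg| | |].
- by apply: mulr_ge0; [nneg | apply: sumr_ge0 => j _; nneg].
- apply: ler_wpM2l; first by nneg.
  by apply: lerXn2r; rewrite ?nnegrE; [nneg | nneg | exact: X_le (herm_H hH t)].
rewrite ler_pdivrMl ?ltr0n //.
have -> : N%:R * Kc = \sum_(j < N) Kc by rewrite sumr_const card_ord mulr_natl.
by apply: ler_sum => j _; exact: (good1 gc).
Qed.

(** Here K bounds the entries on the good event, rho truncates the entries of H, sq bounds |G w|
    there by Ward's identity, and delta bounds the probabilities of failure. The first line of the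
    bound is the true size, to be fed back into the moment itself; the second collects the
    exceptional events. *)
Lemma moment_ineq :
  Ex P (fun t => XM (rmat H t) ^+ m.+3) <=
  (2 * c1 * N%:R * sq + 27 * m.+2%:R * K ^+ 5 * (sq / Num.sqrt N%:R)) * Ex P Y
  + (N%:R ^+ 2 * (4 * B * (9 * theta + theta^-1 * (4 * delta))) + bulk_crude_cst * delta).
Proof.
have [ib ->] := moment_identity mH hH indep m n0 hz hmean hint hs htau Fe Fv Fw Fl hvw Kc1 good_c.
have mg := measurableC mgoodset.
have k1 := intg_indic P mg.
have bc0 : 0 <= bulk_crude_cst by rewrite /bulk_crude_cst; nneg.
set q := 27 * m.+2%:R * K ^+ 5 * (sq / Num.sqrt N%:R).
have hb : Ex P (fun t => complex.Re (bulkM (rmat H t))) <= q * Ex P Y + bulk_crude_cst * delta.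
  have a1 := intgZ q Y_intg; have a2 := intgZ bulk_crude_cst k1.
  apply: le_trans (Ex_le ib (intgD a1 a2) bulk_bound) _.
  rewrite (ExD a1 a2) (ExZ _ Y_intg) (ExZ _ k1) Ex_indic // lerD2l.
  exact: ler_wpM2l.
have hr : \sum_i \sum_j Ex PP (fun x => complex.Re (conjc (v i 0) * (H i j x.1 * remd i j x))) <=
  2 * c1 * N%:R * sq * Ex P Y + N%:R ^+ 2 * (4 * B * (9 * theta + theta^-1 * (4 * delta))).
  apply: (@le_trans _ _ (\sum_i \sum_j (Ex P (t1 i j) + 4 * B * (9 * theta + theta^-1 * (4 * delta))))).
    apply: ler_sum => i _; apply: ler_sum => j _.
    have [l1 l2] := t2_intg i j.
    have f1 := intg_fst (t1_intg i j).
    have [_ im _] := main_term mH hH indep m n0 hmean hint hs htau Fe Fv Fw Fl hvw Kc1 good_c i j.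
    apply: le_trans (Ex_le im (intgD f1 l1) (rem_bound i j)) _.
    by rewrite (ExD f1 l1) (Ex_fst (t1_intg i j)) lerD2l.
  under eq_bigr do rewrite big_split /= sumr_const card_ord.
  rewrite big_split /= sumr_const card_ord; apply: lerD; last first.
    by rewrite -mulrnA -[_ *+ (N * N)%N]mulr_natl natrM expr2.
  have <- : Ex P (fun t => \sum_i \sum_j t1 i j t) = \sum_i \sum_j Ex P (t1 i j).
    rewrite Ex_sum => [|i]; last by apply: intg_sum.
    by apply: eq_bigr => i _; rewrite Ex_sum.
  rewrite -ExZ; last exact: Y_intg.
  apply: Ex_le; [by apply: intg_sum => i; apply: intg_sum|by apply: intgZ; exact: Y_intg|].
  move=> t.
  have -> : \sum_i \sum_j t1 i j t = c1 * Y t * \1_goodset t * \sum_i \sum_j A_ i j t.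
    rewrite mulr_sumr; apply: eq_bigr => i _; rewrite mulr_sumr; apply: eq_bigr => j _.
    by rewrite /t1; ring.
  have [g1|g1] := boolP (good K z F (gH t)).
    rewrite indicE mem_set //= mulr1.
    rewrite [X in _ <= X](_ : _ = c1 * Y t * (2 * N%:R * sq)); last by ring.
    apply: ler_wpM2l; first exact: mulr_ge0.
    exact: sum_vA.
  rewrite indicE memNset /=; last exact/negP.
  by rewrite mulr0 mul0r; apply: mulr_ge0 => //; nneg.
apply: le_trans (lerD hb hr) _.
rewrite le_eqVlt; apply/orP; left; apply/eqP; ring.
Qed.

End MomentInequality.

(** * Tail bounds *)

Section SmallProbability.
Context (R : realType) d (T : measurableType d) (P : probability T R) (t : R).
Hypothesis t1 : 1 <= t.

(* The sets of interest, such as [inv_fails] below, need not be measurable. *)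
Definition small (A : set T) (n : nat) :=
  exists B, [/\ measurable B, A `<=` B & (P B <= ((t ^+ n)^-1)%:E)%E].

Let t0 : 0 < t. Proof. exact: lt_le_trans t1. Qed.

Lemma small_sub A B n : A `<=` B -> small B n -> small A n.
Proof. by move=> AB [D [mD BD PD]]; exists D; split => //; exact: subset_trans BD. Qed.

Lemma small_le A n k : (n <= k)%N -> small A k -> small A n.
Proof.
move=> nk [D [mD BD PD]]; exists D; split => //; apply: le_trans PD _.
by rewrite lee_fin lef_pV2 ?posrE ?exprn_gt0 // ler_weXn2l.
Qed.

Lemma small_seq (I : eqType) (r : seq I) (A : I -> set T) n l :
  (forall k, k \in r -> small (A k) (n + l)) -> (size r)%:R <= t ^+ l ->
  small [set w | exists2 k, k \in r & A k w] n.
Proof.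
move=> h hs.
suff [B [mB AB PB]] : exists B, [/\ measurable B, [set w | exists2 k, k \in r & A k w] `<=` B &
    (P B <= ((size r)%:R * (t ^+ (n + l))^-1)%:E)%E].
  exists B; split => //; apply: le_trans PB _; rewrite lee_fin exprD invfM mulrCA.
  by rewrite ler_piMr ?invr_ge0 ?exprn_ge0 ?(ltW t0) // ler_pdivrMr ?exprn_gt0 // mul1r.
elim: r h {hs} => [|i r IH] h.
  by exists set0; split => // [w [] //|]; rewrite measure0 mul0r.
have [|B [mB AB PB]] := IH; first by move=> k kr; apply: h; rewrite inE kr orbT.
have [D [mD AD PD]] := h i (mem_head _ _).
exists (D `|` B); split; first exact: measurableU.
  move=> w [k]; rewrite inE => /predU1P [->|kr] Ak; [left; exact: AD|right; apply: AB].
  by exists k.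
apply: le_trans (measureU2 _ mD mB) _; apply: le_trans (leeD PD PB) _.
by rewrite -EFinD lee_fin /= mulrSr mulrDl mul1r addrC.
Qed.

Lemma smallU A B n : 2 <= t -> small A n.+1 -> small B n.+1 -> small (A `|` B) n.
Proof.
move=> t2 hA hB.
apply: (@small_sub _ [set w | exists2 k, k \in [:: true; false] & (if k then A else B) w]).
  by move=> w [wA|wB]; [exists true|exists false].
by apply: (@small_seq _ _ _ _ 1) => [[]|] //=; rewrite addn1.
Qed.

End SmallProbability.

(** * Consequences of the hypotheses on H *)

Section Ensemble.
Context (R : realType) (C : R) (Cp : nat -> R) d (T : measurableType d) (P : probability T R) (N : nat).
Local Notation CC := R[i].
Variable H : 'I_N -> 'I_N -> T -> CC.
Hypothesis C0 : 0 < C.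
Hypothesis n0 : (0 < N)%N.
Hypothesis gw : gen_wigner C Cp P H.

Lemma gw_mH i j : measurable_fun setT (fun w => reim (H i j w)).
Proof. by case: gw => -[]. Qed.

Lemma gw_hH i j w : H j i w = conjc (H i j w).
Proof. by case: gw => -[_ ->]. Qed.

Lemma gw_indep : entries_independent P H.
Proof. by case: gw. Qed.

Let rN : R := Num.sqrt N%:R.
Let rN0 : 0 < rN. Proof. by rewrite sqrtr_gt0 ltr0n. Qed.

Let abs2E x : abs2 x = normc x ^+ 2 :> R. Proof. by rewrite normc_sq. Qed.

Let mn i j : measurable_fun setT (fun w => normc (H i j w)).
Proof. exact: cmeas_normc (cmeas_H gw_mH i j). Qed.

Lemma gw_moment p i j : intg P (fun w => (rN * normc (H i j w)) ^+ p) /\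
  Ex P (fun w => (rN * normc (H i j w)) ^+ p) <= Cp p.
Proof.
case: gw => _ _ _ _ /(_ p i j).
have e w : Num.sqrt (N%:R * abs2 (H i j w)) = rN * normc (H i j w).
  by rewrite sqrtrM ?ler0n // abs2E sqrtr_sqr ger0_norm ?normc_ge0.
under eq_integral do rewrite e.
move=> h.
have h0 w : 0 <= (rN * normc (H i j w)) ^+ p.
  by apply: exprn_ge0; apply: mulr_ge0; [exact: ltW | exact: normc_ge0].
have mf : measurable_fun setT (fun w => (rN * normc (H i j w)) ^+ p).
  by apply: measurable_funX; apply: measurable_funM (mn i j); exact: measurable_cst.
have ii : intg P (fun w => (rN * normc (H i j w)) ^+ p).
  apply/integrableP; split; first exact/measurable_EFinP.
  under eq_integral do rewrite /= ger0_norm //.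
  exact: le_lt_trans h (ltry _).
by split => //; rewrite -lee_fin -Ex_fin.
Qed.

Lemma gw_hint i j k : intg P (fun w => normc (H i j w) ^+ k).
Proof.
have [h _] := gw_moment k i j.
apply: (intg_ext _ (intgZ (rN ^- k) h)) => w.
by rewrite exprMn mulrA mulVf ?mul1r // expf_neq0 // gt_eqF.
Qed.

Lemma gw_tail r i j (t : R) : 0 < t -> (0 < r)%N ->
  fine (P (big_entry H (t / rN) i j)) <= Cp r / t ^+ r.
Proof.
move=> t0 r0; have [h1 h2] := gw_moment r i j.
have hm := @markov_Ex _ _ _ P (fun w => (rN * normc (H i j w)) ^+ r) (t ^+ r) (Cp r / t ^+ r).
have tr : 0 < t ^+ r by rewrite exprn_gt0.
rewrite -lee_fin fineK; last by apply: fin_num_measure; exact: mbig gw_mH _ _ _.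
apply: le_trans (hm tr h1 _ _); last 2 first.
- by move=> w; apply: exprn_ge0; apply: mulr_ge0; [exact: ltW | exact: normc_ge0].
- by rewrite divfK ?gt_eqF.
apply: le_measure; rewrite ?inE.
- exact: mbig gw_mH _ _ _.
- rewrite (_ : [set w | _] = setT `&` (fun w => (rN * normc (H i j w)) ^+ r) @^-1` [set` `[t ^+ r, +oo[%R]); last first.
    by rewrite setTI; apply/seteqP; split => w /=; rewrite in_itv /= andbT.
  by apply: (intg_meas h1) => //; exact: measurable_itv.
move=> w; rewrite /big_entry /= ltr_pdivrMr // => hw.
by apply: lerXn2r; rewrite ?nnegrE ?(ltW t0) //; [apply: mulr_ge0; [exact: ltW | exact: normc_ge0] | rewrite mulrC ltW].
Qed.

Let cH i j := cmeas_H gw_mH i j.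

Lemma gw_mean i j : Ec P (H i j) = 0.
Proof.
case: gw => _ _ /(_ i j) [h1 h2] _ _.
by rewrite /Ec /Ex h1 h2.
Qed.

Lemma gw_cintg2 i j : cintg P (fun w => H i j w * H i j w).
Proof.
apply: (cintg_dom (g := fun w => normc (H i j w) ^+ 2) _ _ (gw_hint i j 2)).
  by apply: cmeasM; exact: cH.
by move=> w; rewrite normcM expr2.
Qed.

Lemma gw_var : exists s : 'I_N -> 'I_N -> R,
  [/\ (forall i j, Ec P (fun w => H i j w * conjc (H i j w)) = N%:R^-1 * (s i j)%:C%C),
      (forall i j, Ex P (fun w => normc (H i j w) ^+ 2) = N%:R^-1 * s i j),
      (forall i j, C^-1 <= s i j <= C), (forall i j, s i j = s j i) &
      (forall i, \sum_j s i j = N%:R)].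
Proof.
case: gw => _ _ _ [S [h1 h2 h3]] _.
have e1 i j : Ex P (fun w => normc (H i j w) ^+ 2) = S i j.
  rewrite /Ex -[RHS]/(fine (S i j)%:E) -h1; congr fine; apply: eq_integral => w _.
  by rewrite abs2E.
have Nn : N%:R != 0 :> R by rewrite pnatr_eq0 -lt0n.
exists (fun i j => N%:R * S i j); split => //.
- move=> i j; rewrite /Ec.
  rewrite (@Ex_ext _ _ _ _ _ (fun w => normc (H i j w) ^+ 2)); last first.
    by move=> w; rewrite mul_conjc.
  rewrite [X in (_ +i* X)%C](@Ex_ext _ _ _ _ _ (fun=> 0)); last first.
    by move=> w; rewrite mul_conjc.
  rewrite e1 Ex_cst.
  have -> : (N%:R^-1 : CC) = (N%:R^-1)%:C%C by rewrite fmorphV rmorph_nat.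
  by rewrite -rmorphM /= mulKf.
- by move=> i j; rewrite e1 mulKf.
- by move=> i j; rewrite -!e1; congr (_ * _); apply: Ex_ext => w; rewrite (gw_hH i j) normc_conj.
- by move=> i; rewrite -mulr_sumr h3 mulr1.
Qed.

(** The pseudo-variance, normalised like s. Nothing is assumed about it, and only its bound by 2 C
    enters. *)
Definition tau i j : CC := N%:R * Ec P (fun w => H i j w * H i j w).

Lemma gw_tau i j : Ec P (fun w => H i j w * H i j w) = N%:R^-1 * tau i j.
Proof. by rewrite /tau mulKf // pnatr_eq0 -lt0n. Qed.

Lemma gw_tau_le i j : normc (tau i j) <= 2 * C.
Proof.
have [s [_ h1 h2 _ _]] := gw_var.
rewrite /tau normcM normc_nat.
have [i1 i2] := gw_cintg2 i j.
have b (f : CC -> R) : (forall x, `|f x| <= normc x) ->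
   intg P (fun w => f (H i j w * H i j w)) ->
   `|Ex P (fun w => f (H i j w * H i j w))| <= N%:R^-1 * s i j.
  move=> hf hi; rewrite -h1; apply: le_trans (Ex_abs hi) _.
  apply: Ex_le; [exact: intg_norm|exact: gw_hint|move=> w].
  by apply: le_trans (hf _) _; rewrite normcM expr2.
have b1 := b _ (@Re_le_normc R) i1; have b2 := b _ (@Im_le_normc R) i2.
have /andP [_ sC] := h2 i j.
apply: (@le_trans _ _ (N%:R * (N%:R^-1 * s i j + N%:R^-1 * s i j))).
  apply: ler_wpM2l => //; apply: le_trans (normc_le_ReIm _) _; exact: lerD.
have Nn : N%:R != 0 :> R by rewrite pnatr_eq0 -lt0n.
rewrite mulrDr mulVKf //; lra.
Qed.

(** The interval from 1/C to C contains a variance s_ij, so it is not empty. *)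
Lemma C_ge1 : 1 <= C.
Proof.
have [s [_ _ h2 _ _]] := gw_var.
have /andP [a b] := h2 (Ordinal n0) (Ordinal n0).
have ab : C * C^-1 <= C * C by rewrite ler_pM2l //; exact: le_trans a b.
rewrite divff ?gt_eqF // in ab; rewrite leNgt; apply/negP => C1.
have : C * C < 1 * 1 by apply: ltr_pM => //; exact: ltW.
lra.
Qed.

Lemma gw_c4 : Cp 4 <= N%:R -> forall i j, Ex P (fun w => normc (H i j w) ^+ 4) <= 1.
Proof.
move=> h i j; have [h1 h2] := gw_moment 4 i j.
have e w : rN ^- 4 * (rN * normc (H i j w)) ^+ 4 = normc (H i j w) ^+ 4.
  by rewrite exprMn mulrA mulVf ?mul1r // expf_neq0 // gt_eqF.
rewrite -(Ex_ext _ e) (ExZ _ h1) mulrC ler_pdivrMr ?exprn_gt0 // mul1r.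
apply: le_trans h2 _; apply: le_trans h _.
have -> : rN ^+ 4 = N%:R * N%:R by rewrite (exprM rN 2 2) sqr_sqrtr.
by rewrite ler_peMl // ler1n.
Qed.

End Ensemble.

(** * Choice of the parameters as powers of t *)

Section Numerics.
Variables (R : realType) (t : R).
Hypothesis t1 : 1 <= t.
Let t0 : 0 < t. Proof. exact: lt_le_trans t1. Qed.
Let tp k : 0 < t ^+ k. Proof. exact: exprn_gt0. Qed.
Let tp0 k : 0 <= t ^+ k. Proof. exact: ltW. Qed.
Let tpn k : t ^+ k != 0. Proof. by rewrite gt_eqF. Qed.
Let mono k l : (k <= l)%N -> t ^+ k <= t ^+ l. Proof. exact: ler_weXn2l. Qed.

Definition B_exp kc m := (4 * kc + (2 * kc).+1 * m.+2).+1.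

Lemma crude_cst_le kc m : 1 + 3 * m.+2%:R <= t -> crude_cst m (t ^+ kc) <= t ^+ (B_exp kc m).
Proof.
move=> ht; have t3 : 3 <= t by move: ht; rewrite mulrSr; have : 0 <= m.+1%:R :> R by []; lra.
set L := 3 * (t ^+ kc) ^+ 2.
have L0 : 0 <= L by rewrite /L; nneg.
have hL : L <= t ^+ (2 * kc).+1.
  by rewrite /L -exprM mulnC exprS; apply: ler_wpM2r.
have hLk k : L ^+ k <= t ^+ ((2 * kc).+1 * k) by rewrite exprM; apply: lerXn2r; rewrite ?nnegrE.
rewrite /crude_cst -/L.
have h1 : (t ^+ kc) ^+ 2 * L ^+ m.+2 <= t ^+ (4 * kc + (2 * kc).+1 * m.+2).
  rewrite -exprM exprD; apply: ler_pM => //; [by nneg | by apply: mono; lia].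
have h2 : t ^+ kc * (m.+2%:R * L ^+ m.+1) * (3 * (t ^+ kc) ^+ 3) <=
  3 * m.+2%:R * t ^+ (4 * kc + (2 * kc).+1 * m.+2).
  have -> : t ^+ kc * (m.+2%:R * L ^+ m.+1) * (3 * (t ^+ kc) ^+ 3) =
    3 * m.+2%:R * ((t ^+ kc) ^+ 4 * L ^+ m.+1) by ring.
  apply: ler_wpM2l; first by nneg.
  rewrite -exprM mulnC exprD; apply: ler_pM => //; first by nneg.
  by apply: le_trans (hLk _) _; apply: mono; lia.
apply: le_trans (lerD h1 h2) _.
rewrite -{1}[t ^+ (4 * kc + _)]mul1r -mulrDl /B_exp exprS.
exact: ler_wpM2r.
Qed.

Definition bulk_exp kc m := (6 * kc + (2 * kc).+1 * m).+1.

Lemma bulk_crude_le kc m : 3 <= t -> 27 * m.+2%:R <= t ->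
  27 * m.+2%:R * (t ^+ kc) ^+ 6 * (3 * (t ^+ kc) ^+ 2) ^+ m <= t ^+ (bulk_exp kc m).
Proof.
move=> t3 ht.
rewrite /bulk_exp (exprS t) (exprD t) -mulrA; apply: ler_pM => //; first by nneg.
apply: ler_pM; [by nneg | by nneg | by rewrite -exprM mulnC |].
rewrite exprM; apply: lerXn2r; rewrite ?nnegrE //; first by nneg.
by rewrite -exprM mulnC exprS; apply: ler_wpM2r.
Qed.

(** The choice theta = t^-l and delta = t^(-2l) makes both 9 theta and 4 delta / theta of order
    t^-l; then l only has to beat N^2 = t^(2q), the crude constants and the target t^M3. *)
Lemma tail_numerics (B CB : R) q M1 M2 M3 l : 106 <= t ->
  0 <= B -> B <= t ^+ M1 -> CB <= t ^+ M2 ->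
  (l = 2 * q + M1 + M2 + M3 + 5)%N ->
  (t ^+ q) ^+ 2 * (4 * B * (9 * (t ^+ l)^-1 + (t ^+ l) * (4 * (t ^+ (2 * l))^-1))) + CB * (t ^+ (2 * l))^-1
   <= (t ^+ M3)^-1 / 2.
Proof.
move=> ht B0 hB hCB hl.
have -> : t ^+ l * (4 * (t ^+ (2 * l))^-1) = 4 * (t ^+ l)^-1.
  by rewrite mulnC exprM expr2; field; rewrite tpn.
have h1 : (t ^+ q) ^+ 2 * (4 * B * (9 * (t ^+ l)^-1 + 4 * (t ^+ l)^-1)) <= 52 * (t ^+ (M3 + 5))^-1.
  have -> : (t ^+ q) ^+ 2 * (4 * B * (9 * (t ^+ l)^-1 + 4 * (t ^+ l)^-1)) =
    52 * ((t ^+ q) ^+ 2 * B * (t ^+ l)^-1) by ring.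
  apply: ler_wpM2l => //; rewrite ler_pdivrMr //.
  have -> : t ^+ l = t ^+ (M3 + 5) * (t ^+ (q * 2) * t ^+ (M1 + M2)).
    by rewrite -!exprD; congr (_ ^+ _); rewrite hl; lia.
  rewrite mulKf //; rewrite -exprM; apply: ler_wpM2l => //; apply: le_trans hB _; apply: mono; lia.
have h2 : CB * (t ^+ (2 * l))^-1 <= (t ^+ (M3 + 5))^-1.
  rewrite ler_pdivrMr //.
  have -> : t ^+ (2 * l) = t ^+ (M3 + 5) * t ^+ (2 * l - (M3 + 5)).
    by rewrite -exprD; congr (_ ^+ _); lia.
  rewrite mulKf //.
  by apply: le_trans hCB _; apply: mono; lia.
apply: le_trans (lerD h1 h2) _.
have -> : 52 * (t ^+ (M3 + 5))^-1 + (t ^+ (M3 + 5))^-1 = 53 * (t ^+ (M3 + 5))^-1 by ring.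
rewrite addnC exprD invfM mulrA [X in _ <= X]mulrC; apply: ler_wpM2r; first by rewrite invr_ge0.
have h5 : t <= t ^+ 5 by rewrite -{1}[t]expr1; apply: mono.
rewrite ler_pdivrMr //; lra.
Qed.

(** The value of sq is dictated by K <= sq^2 Im z, with K = t^2 and Im z >= t^96 / N. In the first
    term all powers of N cancel and t^(16 - 48) is left; the spare factor t absorbs the constants
    and yields t^-31, that is, psi^3 / t for psi = t^-10. *)
Lemma psi_numerics (rN : R) q m : 0 < rN -> rN ^+ 2 = t ^+ q -> (36 <= q)%N ->
  1627 * m.+2%:R ^+ 2 <= t -> 12 <= t ->
  let K := t ^+ 2 in let rho := t / rN in let sq := t * rN / t ^+ 48 in
  12 * rho * K ^+ 3 <= (t ^+ 10)^-1 /\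
  2 * (800 * m.+2%:R ^+ 2 * K ^+ 6 * rho ^+ 3) * (t ^+ q) * sq +
    27 * m.+2%:R * K ^+ 5 * (sq / rN) <= t^-1 * (t ^+ 10)^-1 ^+ 3.
Proof.
move=> r0 hr hq ht t12 K rho sq.
have rn : rN != 0 by rewrite gt_eqF.
have h18 : t ^+ 18 <= rN.
  rewrite -(ler_pXn2r (n := 2)) ?nnegrE ?(ltW r0) // hr -exprM; exact: mono.
split.
  rewrite /rho /K -exprM.
  have -> : 12 * (t / rN) * t ^+ (2 * 3) = 12 * t ^+ 7 / rN by field.
  rewrite ler_pdivrMr // [X in _ <= X]mulrC ler_pdivlMr //.
  apply: le_trans h18; have -> : 12 * t ^+ 7 * t ^+ 10 = 12 * t ^+ 17 by ring.
  by rewrite (exprS t 17); apply: ler_wpM2r.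
have k1 : 1 <= m.+2%:R :> R by rewrite ler1n.
set k : R := m.+2%:R in ht k1 *.
have kk : k <= k ^+ 2 by rewrite expr2 ler_peMl //; lra.
rewrite -hr /K /rho /sq.
have -> : 2 * (800 * k ^+ 2 * (t ^+ 2) ^+ 6 * (t / rN) ^+ 3) * rN ^+ 2 * (t * rN / t ^+ 48) +
  27 * k * (t ^+ 2) ^+ 5 * (t * rN / t ^+ 48 / rN) =
  (1600 * k ^+ 2 * t ^+ 16 + 27 * k * t ^+ 11) / t ^+ 48.
  by field; rewrite rn gt_eqF.
have -> : t^-1 * (t ^+ 10)^-1 ^+ 3 = t ^+ 17 / t ^+ 48 by field; rewrite gt_eqF.
apply: ler_wpM2r; first by rewrite invr_ge0.
apply: (@le_trans _ _ (1600 * k ^+ 2 * t ^+ 16 + 27 * k ^+ 2 * t ^+ 16)).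
  rewrite lerD2l; apply: ler_pM; [by nneg|by []| |exact: mono].
  by apply: ler_wpM2l.
rewrite -mulrDl (exprS t 16); apply: ler_wpM2r => //; lra.
Qed.

(** The moment appears on both sides: its coefficient on the right is at most 2^p / t <= 1/2 and is
    moved to the left. *)
Lemma absorb (EX EY Psi tail psi : R) p : 0 <= EY -> 0 <= EX -> 0 <= psi ->
  Psi <= t^-1 * psi ^+ 3 -> EX <= Psi * EY + tail -> tail <= psi ^+ p / 2 ->
  psi ^+ 3 * EY <= 2 ^+ p * (EX + psi ^+ p) -> 2 ^+ p.+1 <= t ->
  EX <= 2 * psi ^+ p.
Proof.
move=> EY0 EX0 psi0 hP hX htail hY ht.
have h1 : Psi * EY <= t^-1 * (2 ^+ p * (EX + psi ^+ p)).
  apply: le_trans (ler_wpM2r EY0 hP) _; rewrite -mulrA; apply: ler_wpM2l => //.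
  by rewrite invr_ge0 ltW.
have q0 : 0 <= EX + psi ^+ p by nneg.
have h2 : t^-1 * (2 ^+ p * (EX + psi ^+ p)) <= (EX + psi ^+ p) / 2.
  rewrite mulrA [X in _ <= X]mulrC; apply: ler_wpM2r => //.
  rewrite mulrC ler_pdivrMr //; move: ht; rewrite exprS; lra.
lra.
Qed.

(** Raises the exponent m to m + 3 with the help of psi^3: the left side is at most (a + psi)^(m+3),
    and a + psi is at most twice the larger term. *)
Lemma pow_split (a psi xi : R) m : 0 <= a -> 0 <= xi -> xi <= psi ->
  psi ^+ 3 * (a + xi) ^+ m <= 2 ^+ m.+3 * (a ^+ m.+3 + psi ^+ m.+3).
Proof.
move=> a0 xi0 hx; have p0 : 0 <= psi by apply: le_trans hx.
apply: (@le_trans _ _ ((a + psi) ^+ m.+3)).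
  rewrite -[m.+3]/(3 + m)%N exprD; apply: ler_pM; [by nneg|by nneg| |].
    by apply: lerXn2r; rewrite ?nnegrE ?addr_ge0 // lerDr.
  by apply: lerXn2r; rewrite ?nnegrE ?addr_ge0 // lerD2l.
have [ap|pa] := leP a psi.
  apply: (@le_trans _ _ ((2 * psi) ^+ m.+3)).
    by apply: lerXn2r; rewrite ?nnegrE ?addr_ge0 ?mulr_ge0 //; lra.
  by rewrite exprMn ler_wpM2l ?exprn_ge0 // lerDr exprn_ge0.
apply: (@le_trans _ _ ((2 * a) ^+ m.+3)).
  by apply: lerXn2r; rewrite ?nnegrE ?addr_ge0 ?mulr_ge0 //; lra.
by rewrite exprMn ler_wpM2l ?exprn_ge0 // lerDl exprn_ge0.
Qed.

End Numerics.

(** * The finite family of test vectors *)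

Section Family.
Context (R : realType) (N : nat).
Local Notation CC := R[i].
Variables (s : 'I_N -> 'I_N -> R) (tau : 'I_N -> 'I_N -> CC) (v w : 'cV[CC]_N).
Local Notation cs := (cof s).
Local Notation En := (ord_enum N).

(** All vectors at which the expansion evaluates the resolvent. The weights s and tau occur in full
    and with the diagonal removed, because [offd] enters the coefficient of x but not that of conj
    x. *)
Definition fam : seq 'cV[CC]_N :=
  map (@basis R N) En ++ [:: v; w] ++ map (lvec v cs) En ++ map (rvec v cs) En ++
  map (lvec v (off_arr cs)) En ++ map (rvec v (off_arr cs)) En ++
  map (lvec v tau) En ++ map (rvec v tau) En ++
  map (lvec v (off_arr tau)) En ++ map (rvec v (off_arr tau)) En.

Lemma fam_size : size fam = (9 * N + 2)%N.
Proof.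
have e : size En = N by rewrite -(size_map val) val_ord_enum size_iota.
by rewrite /fam !size_cat !size_map e /=; lia.
Qed.

Lemma fam_basis i : basis R i \in fam.
Proof. by rewrite /fam mem_cat map_f // mem_ord_enum. Qed.
Lemma fam_v : v \in fam.
Proof. by rewrite /fam mem_cat mem_cat !inE eqxx !orbT. Qed.
Lemma fam_w : w \in fam.
Proof. by rewrite /fam mem_cat mem_cat !inE eqxx !orbT. Qed.
Lemma fam_s j : lvec v cs j \in fam /\ rvec v cs j \in fam.
Proof. by split; rewrite /fam !mem_cat map_f ?mem_ord_enum ?orbT. Qed.
Lemma fam_so j : lvec v (off_arr cs) j \in fam /\ rvec v (off_arr cs) j \in fam.
Proof. by split; rewrite /fam !mem_cat map_f ?mem_ord_enum ?orbT. Qed.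
Lemma fam_t j : lvec v tau j \in fam /\ rvec v tau j \in fam.
Proof. by split; rewrite /fam !mem_cat map_f ?mem_ord_enum ?orbT. Qed.
Lemma fam_to j : lvec v (off_arr tau) j \in fam /\ rvec v (off_arr tau) j \in fam.
Proof. by split; rewrite /fam !mem_cat map_f ?mem_ord_enum ?orbT. Qed.

Lemma vnorm_mul_le (u u' : 'cV[CC]_N) (B : R) : 0 <= B ->
  (forall k, normc (u k 0) <= B * normc (u' k 0)) -> vnorm u <= B * vnorm u'.
Proof.
move=> B0 h; rewrite -(ler_pXn2r (n := 2)) ?nnegrE; try by nneg.
rewrite exprMn !vnorm_sq /sqn mulr_sumr; apply: ler_sum => k _.
by rewrite -exprMn; apply: lerXn2r; rewrite ?nnegrE; try by nneg.
Qed.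

Lemma lvec_norm c j (B : R) : 0 <= B -> (forall k, normc (c k j) <= B) ->
  vnorm (lvec v c j) <= B * vnorm v.
Proof.
move=> B0 h; apply: vnorm_mul_le => // k; rewrite mxE mulrC.
by apply: nM_le (lexx _); rewrite normc_conj.
Qed.

Lemma rvec_norm c j (B : R) : 0 <= B -> (forall k, normc (c k j) <= B) ->
  vnorm (rvec v c j) <= B * vnorm v.
Proof.
move=> B0 h; apply: vnorm_mul_le => // k; rewrite mxE mulrC.
by apply: nM_le => //; rewrite normc_conj.
Qed.

Variable C : R.
Hypothesis C1 : 1 <= C.
Hypothesis hs : forall i j, `|s i j| <= C.
Hypothesis ht : forall i j, normc (tau i j) <= 2 * C.
Hypothesis hv : vnorm v <= 1.
Hypothesis hw : vnorm w <= 1.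

Lemma fam_norm x : x \in fam -> vnorm x <= 2 * C.
Proof.
have C1' := C1; have hv' := hv; have hw' := hw; have C0 : 0 <= 2 * C by lra.
have one : 2 * C * vnorm v <= 2 * C by rewrite -[X in _ <= X]mulr1; apply: ler_wpM2l.
have cs_le i j : normc (cs i j) <= 2 * C by rewrite normc_real; apply: le_trans (hs i j) _; lra.
have off_le c : (forall i j, normc (c i j) <= 2 * C) -> forall i j, normc (off_arr c i j) <= 2 * C.
  move=> h i j; rewrite -[2 * C]mul1r; apply: nM_le => //; exact: offd_le.
rewrite /fam !mem_cat => /orP [/mapP [i _ ->]|]; first by rewrite vnorm_basis; lra.
move=> /orP []; first by rewrite !inE => /orP [] /eqP ->; lra.
by repeat (case/orP => [/mapP [j _ ->]|]); [..|move=> /mapP [j _ ->]];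
  apply: le_trans one; (apply: lvec_norm || apply: rvec_norm) => // k;
  (exact: cs_le || exact: ht || (apply: off_le; (exact: cs_le || exact: ht))).
Qed.

End Family.

(** * Smallness of [fD], given a rough bound on the resolvent *)

Section Tail.
Context (R : realType) (C : R) (Cp : nat -> R) (q : nat).
Hypothesis C0 : 0 < C.
Hypothesis q36 : (36 <= q)%N.

Section One.
Context d (T : measurableType d) (P : probability T R) (N : nat).
Local Notation CC := R[i].
Variable H : 'I_N -> 'I_N -> T -> CC.
Variable t : R.
Hypothesis t200 : 200 <= t.
Hypothesis tC : 20 * C ^+ 2 <= t.
Hypothesis tN : t ^+ q = N%:R.
Hypothesis gw : gen_wigner C Cp P H.
Variable s : 'I_N -> 'I_N -> R.
Hypothesis hs : forall i j, Ec P (fun w => H i j w * conjc (H i j w)) = N%:R^-1 * (s i j)%:C%C.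
Hypothesis sC : forall i j, `|s i j| <= C.
Variable z : CC.
Hypothesis hz : 0 < complex.Im z.
Hypothesis hzN : t ^+ 96 <= complex.Im z * N%:R.
Hypothesis hzb : normc z <= 3 * N%:R ^+ 2.
Variables v w : 'cV[CC]_N.
Hypothesis hv : vnorm v <= 1.
Hypothesis hw : vnorm w <= 1.

Local Notation gH om := (res z (rmat H om)).
Local Notation tauH := (tau P H).
Local Notation F := (fam s tauH v w).

Let t0 : 0 < t. Proof. by apply: lt_le_trans t200. Qed.
Let t1 : 1 <= t. Proof. by apply: le_trans t200; rewrite ler1n. Qed.

Lemma N_gt0 : (0 < N)%N.
Proof. by rewrite -(ltr0n R) -tN exprn_gt0. Qed.

Let n0 := N_gt0.
Let C1 : 1 <= C. Proof. exact: C_ge1 C0 n0 gw. Qed.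

(** Test vectors have norm at most 2 C. Rescaling them to the unit ball turns 5 t into 20 C^2 t <=
    t^2, and the (9 N + 2)^2 <= t^(2q+1) pairs account for the loss of rate. *)
Lemma goodset_small n : (forall x y, vnorm x <= 1 -> vnorm y <= 1 ->
    small P t [set om | 5 * t < normc (sesq x (gH om) y) * (1 + normc z)] (n + (2 * q).+1)) ->
  fine (P (~` goodset H z F (t ^+ 2))) <= (t ^+ n)^-1.
Proof.
have hC0 := C0; have hC1 := C1; have ht2 := t200; have htC := tC; have ht0 := t0.
move=> h.
have mg : measurable (~` goodset H z F (t ^+ 2)).
  by apply: measurableC; apply: mgoodset; exact: gw_mH gw.
pose c := (2 * C)^-1.
have c0 : 0 < c by rewrite invr_gt0; lra.
pose A (k : 'cV[CC]_N * 'cV[CC]_N) :=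
  [set om | 5 * t < normc (sesq (c%:C%C *: k.1) (gH om) (c%:C%C *: k.2)) * (1 + normc z)].
have [B [mB AB PB]] : small P t (~` goodset H z F (t ^+ 2)) n.
  apply: (@small_sub _ _ _ _ _ _ [set om | exists2 k, k \in [seq (x, y) | x <- F, y <- F] & A k om]).
    move=> om /= /negP; rewrite /good -has_predC => /hasP [x hx /=].
    rewrite -has_predC => /hasP [y hy /=]; rewrite -ltNge => hxy.
    exists (x, y); first by apply/allpairsP; exists (x, y).
    rewrite /A /= sesqZl sesqZr !normcM normc_conj normc_real gtr0_norm //.
    have -> : c * (c * normc (sesq x (gH om) y)) * (1 + normc z) =
      c ^+ 2 * (normc (sesq x (gH om) y) * (1 + normc z)) by ring.
    have c2 : 0 < c ^+ 2 by rewrite exprn_gt0.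
    apply: le_lt_trans (_ : c ^+ 2 * t ^+ 2 < _); last by rewrite ltr_pM2l.
    have -> : c ^+ 2 * t ^+ 2 = t * (t / (4 * C ^+ 2)) by rewrite /c; field; rewrite gt_eqF.
    rewrite mulrC; apply: ler_wpM2l; first exact: ltW.
    by rewrite ler_pdivlMr ?mulr_gt0 ?exprn_gt0 //; move: tC; lra.
  apply: (@small_seq _ _ _ _ _ t1 _ _ _ _ (2 * q).+1).
    have hc x : x \in F -> vnorm (c%:C%C *: x) <= 1.
      move=> hx; rewrite vnormZ normc_real gtr0_norm // /c mulrC ler_pdivrMr ?mul1r; last by lra.
      apply: (fam_norm C1 sC _ hv hw hx) => i j; exact: gw_tau_le n0 gw i j.
    by move=> [x y] /allpairsP [[x' y'] /= [hx hy [-> ->]]]; apply: h => /=; exact: hc.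
  rewrite size_allpairs fam_size natrM natrD natrM -tN exprS mulnC exprM.
  have N1 : 1 <= t ^+ q by rewrite exprn_ege1.
  have : 9 * t ^+ q + 2 <= 11 * t ^+ q by lra.
  move=> h11; have h12 : 0 <= 9 * t ^+ q + 2 by lra.
  apply: le_trans (ler_pM h12 h12 h11 h11) _.
  have -> : 11 * t ^+ q * (11 * t ^+ q) = 121 * (t ^+ q) ^+ 2 by ring.
  by apply: ler_wpM2r; [nneg|lra].
rewrite -lee_fin fineK; last exact: fin_num_measure.
by apply: le_trans PB; apply: le_measure => //; rewrite inE.
Qed.

Let kc := (3 * q).+1.

(** Entries are at most 4 C^2 / Im z <= 4 C^2 N, and 1 + |z| is at most 4 N^2: a fixed power of t,
    without any exceptional event. *)
Lemma good_crude M : hermm M -> good (t ^+ kc) z F (res z M).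
Proof.
have hC0 := C0; have hC1 := C1; have ht2 := t200; have htC := tC; have ht0 := t0.
move=> hM; apply/allP => x hx; apply/allP => y hy.
have hn u : u \in F -> vnorm u <= 2 * C.
  move=> hu; apply: (fam_norm C1 sC _ hv hw hu) => i j; exact: gw_tau_le n0 gw i j.
have h1 := res_entry_bound hM hz x y.
have h2 : normc (sesq x (res z M) y) * complex.Im z <= (2 * C) * (2 * C).
  by apply: le_trans h1 _; apply: ler_pM; rewrite ?sqrtr_ge0 //; exact: hn.
have N1 : 1 <= t ^+ q by rewrite exprn_ege1.
have h3 : 1 <= complex.Im z * N%:R by apply: le_trans hzN; rewrite exprn_ege1.
set a := normc _ in h2 *; have a0 : 0 <= a by exact: normc_ge0.
have h4 : a <= 4 * C ^+ 2 * t ^+ q.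
  have : a * 1 <= a * (complex.Im z * N%:R) by apply: ler_wpM2l.
  rewrite mulr1 mulrA -tN => /le_trans; apply.
  by apply: ler_wpM2r; [lra | apply: le_trans h2 _; rewrite le_eqVlt; apply/orP; left; apply/eqP; ring].
have h5 : 1 + normc z <= 4 * (t ^+ q) ^+ 2.
  have : 1 <= (t ^+ q) ^+ 2 by rewrite exprn_ege1.
  move: hzb; rewrite -tN; lra.
apply: le_trans (ler_pM a0 _ h4 h5) _; first by nneg.
have -> : t ^+ kc = t * (t ^+ q) ^+ 3 by rewrite /kc exprS mulnC exprM.
have -> : 4 * C ^+ 2 * t ^+ q * (4 * (t ^+ q) ^+ 2) = 16 * C ^+ 2 * (t ^+ q) ^+ 3 by ring.
apply: ler_wpM2r; first by nneg.
by have := sqr_ge0 C; move: tC; lra.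
Qed.

Variable m : nat.
Hypothesis modd : odd m.
Hypothesis tm : 1627 * m.+2%:R ^+ 2 <= t.
Hypothesis tm2 : 2 ^+ m.+4 <= t.
Hypothesis t4 : Cp 4 <= t.

Let M1 := B_exp kc m.
Let M2 := bulk_exp kc m.
Let M3 := (10 * m.+3)%N.
Definition lexp := (2 * q + B_exp (3 * q).+1 m + bulk_exp (3 * q).+1 m + 10 * m.+3 + 5)%N.
Hypothesis tl : Cp (2 * lexp).+1 <= t.
Hypothesis apriori : forall x y, vnorm x <= 1 -> vnorm y <= 1 ->
    small P t [set om | 5 * t < normc (sesq x (gH om) y) * (1 + normc z)] (2 * lexp + (2 * q).+1).

Local Notation X om := (complex.Re (fD z s v w (gH om))).

Lemma dot_le1 : normc ((adjm v *m w) 0 0) <= 1.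
Proof.
by apply: le_trans (dot_le v w) _; rewrite mulr_ile1 ?sqrtr_ge0.
Qed.

Let X_intg k : intg P (fun om => X om ^+ k).
Proof.
have ht0 := t0; have Kc1 : 1 <= t ^+ kc by rewrite exprn_ege1.
exact: (@Xpow_intg _ _ _ P _ H (gw_mH gw) (gw_hH gw) z s v w n0 F (fam_basis s tauH v w) (fam_v s tauH v w)
    (fam_w s tauH v w) (fun l => proj1 (fam_s s tauH v w l)) dot_le1 _ Kc1 good_crude).
Qed.

(** The even exponent m + 3 gives X^(m+3) = |X|^(m+3), which [pow_split] needs to close the
    recursion of [moment_ineq]. *)
Lemma moment_small : Ex P (fun om => X om ^+ m.+3) <= 2 * (t ^+ 10)^-1 ^+ m.+3.
Proof.
have hC0 := C0; have hC1 := C1; have ht2 := t200; have htC := tC; have ht0 := t0.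
have hH := gw_hH gw; have mH := gw_mH gw.
set rN : R := Num.sqrt N%:R.
have rN0 : 0 < rN by rewrite sqrtr_gt0 ltr0n.
have rN2 : rN ^+ 2 = t ^+ q by rewrite sqr_sqrtr // tN.
have k1 : 1 <= m.+2%:R :> R by rewrite ler1n.
have kk : m.+2%:R <= m.+2%:R ^+ 2 :> R by rewrite expr2 ler_peMl //; lra.
have t12 : 12 <= t by lra.
have [n1 n2] := psi_numerics t1 rN0 rN2 q36 tm t12.
set K := t ^+ 2 in n1 n2; set rho := t / rN in n1 n2; set sq := t * rN / t ^+ 48 in n2.
have psi1 : (t ^+ 10)^-1 <= 1 by rewrite invf_le1 ?exprn_gt0 // exprn_ege1.
have hs2 := @gw_tau _ _ _ P _ H n0.
set theta := (t ^+ lexp)^-1; set delta := (t ^+ (2 * lexp))^-1.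
have Kc1 : 1 <= t ^+ kc by rewrite exprn_ege1.
have K1 : 1 <= K by rewrite exprn_ege1.
have rho0 : 0 <= rho by rewrite /rho; nneg.
have theta0 : 0 < theta by rewrite invr_gt0 exprn_gt0.
have sq0 : 0 <= sq by rewrite /sq; nneg.
have hsq : K <= sq ^+ 2 * complex.Im z.
  have -> : sq ^+ 2 * complex.Im z = K * ((complex.Im z * N%:R) / t ^+ 96).
    by rewrite -tN -rN2 /sq /K; field; rewrite gt_eqF.
  by rewrite ler_peMr //; [rewrite /K; nneg | rewrite ler_pdivlMr ?exprn_gt0 // mul1r].
have c4 : forall i j, Ex P (fun w => normc (H i j w) ^+ 4) <= 1.
  apply: (gw_c4 n0 gw); apply: le_trans t4 _; rewrite -tN.
  by apply: ler_eXnr => //; apply: leq_trans q36.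
have hbig i j : fine (P (big_entry H rho i j)) <= delta.
  apply: le_trans (gw_tail n0 gw i j ht0 (ltn0Sn (2 * lexp))) _.
  by rewrite exprS invfM mulrA ler_piMl ?invr_ge0 ?exprn_ge0 ?(ltW t0) // ler_pdivrMr // mul1r.
have hB : crude_cst m (t ^+ kc) <= t ^+ M1 by apply: crude_cst_le => //; move: tm; lra.
have hCB : 27 * m.+2%:R * (t ^+ kc) ^+ 6 * (3 * (t ^+ kc) ^+ 2) ^+ m <= t ^+ M2.
  by apply: bulk_crude_le => //; move: tm; lra.
have B0 : 0 <= crude_cst m (t ^+ kc).
  by rewrite /crude_cst; nneg.
have htail := tail_numerics (M3 := M3) (l := lexp) t1 (_ : 106 <= t) B0 hB hCB erefl.
have hXi := @moment_ineq _ _ _ P _ H mH hH (gw_indep gw) z s tauH v w m n0 hz (gw_mean gw) (gw_hint n0 gw) hs hs2 F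
  (fam_basis s tauH v w) (fam_v s tauH v w) (fam_w s tauH v w) (fun l => proj1 (fam_s s tauH v w l))
  (fam_s s tauH v w) (fam_so s tauH v w) (fam_t s tauH v w) (fam_to s tauH v w) hv dot_le1 _ Kc1 good_crude
  K rho theta delta sq
  K1 rho0 theta0 (le_trans n1 psi1) sq0 hsq c4 (goodset_small apriori) hbig.
have iY : intg P (fun om => (`|X om| + 12 * rho * K ^+ 3) ^+ m).
  exact: (@Y_intg _ _ _ P _ H mH hH z s v w m n0 F (fam_basis s tauH v w) (fam_v s tauH v w)
    (fam_w s tauH v w) (fun l => proj1 (fam_s s tauH v w l)) dot_le1 _ Kc1 good_crude K rho K1 rho0).
have absX om : `|X om| ^+ m.+3 = X om ^+ m.+3 by rewrite -normrX ger0_norm // exprn_even_ge0 //= modd.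
have iX : intg P (fun om => X om ^+ m.+3).
  exact: X_intg.
set psi : R := (t ^+ 10)^-1 in n1 n2 psi1 *.
have psi0 : 0 <= psi by rewrite invr_ge0 exprn_ge0 // ltW.
have xi0 : 0 <= 12 * rho * K ^+ 3.
  by apply: mulr_ge0; [exact: mulr_ge0 | apply: exprn_ge0; apply: le_trans K1].
rewrite tN in n2 htail.
apply: (absorb t1 _ _ psi0 n2 _ _ _ tm2 (EY := Ex P (fun om => (`|X om| + 12 * rho * K ^+ 3) ^+ m))).
- by apply: Ex_ge0 => om; apply: exprn_ge0; exact: addr_ge0.
- by apply: Ex_ge0 => om; rewrite -absX exprn_ge0.
- exact: hXi.
- rewrite (_ : psi ^+ m.+3 = (t ^+ M3)^-1); last by rewrite /psi exprVn -exprM.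
  by rewrite /theta /delta invrK; apply: htail; lra.
rewrite -(ExZ _ iY).
have ic := intg_cst P (psi ^+ m.+3).
rewrite -(Ex_cst P (psi ^+ m.+3)) -(ExD iX ic) -(ExZ _ (intgD iX ic)).
apply: Ex_le; [exact: intgZ|by apply: intgZ; exact: intgD|move=> om].
by rewrite -absX; apply: pow_split => //.
Qed.

(** Markov's inequality: the gap between t^-9 and the typical size t^-10 is gained m + 3 times, and
    one of these powers of t pays for the factor 2. *)
Lemma Re_fD_small n : (n <= m.+2)%N ->
  small P t [set om | (t ^+ 9)^-1 <= `|X om|] n.
Proof.
move=> nm; have ht0 := t0; have ht1 := t1; have ht2 := t200.
have absX om : `|X om| ^+ m.+3 = X om ^+ m.+3 by rewrite -normrX ger0_norm // exprn_even_ge0 //= modd.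
exists [set om | (t ^+ 9)^-1 ^+ m.+3 <= X om ^+ m.+3]; split.
- rewrite (_ : [set om | _] = setT `&` (fun om => X om ^+ m.+3) @^-1` [set` `[(t ^+ 9)^-1 ^+ m.+3, +oo[%R]); last first.
    by rewrite setTI; apply/seteqP; split => om /=; rewrite in_itv /= andbT.
  by apply: (intg_meas (X_intg m.+3)) => //; exact: measurable_itv.
- by move=> om /= h; rewrite -absX; apply: lerXn2r; rewrite ?nnegrE ?invr_ge0 ?exprn_ge0 // ltW.
have q0 : 0 < (t ^+ 9)^-1 ^+ m.+3 by rewrite exprn_gt0 // invr_gt0 exprn_gt0.
have X0 om : 0 <= X om ^+ m.+3 by rewrite -absX exprn_ge0.
apply: (markov_Ex q0 (X_intg m.+3) X0).
apply: le_trans moment_small _.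
have -> : (t ^+ 10)^-1 ^+ m.+3 = (t ^+ m.+3)^-1 * (t ^+ 9)^-1 ^+ m.+3.
  by rewrite (exprS t 9) invfM exprMn (exprVn t).
rewrite mulrA; apply: ler_wpM2r; first by nneg.
rewrite (exprS t m.+2) invfM mulrA ler_pdivrMr ?exprn_gt0 //.
apply: le_trans (_ : 1 <= _); first by rewrite ler_pdivrMr // mul1r; lra.
by rewrite mulrC ler_pdivlMr ?exprn_gt0 // mul1r ler_weXn2l.
Qed.

End One.

Theorem fD_small n : exists n' t0, forall d (T : measurableType d) (P : probability T R) (N : nat)
  (H : 'I_N -> 'I_N -> T -> R[i]) (t : R), t0 <= t -> t ^+ q = N%:R -> gen_wigner C Cp P H ->
  forall s : 'I_N -> 'I_N -> R,
  (forall i j, Ec P (fun w => H i j w * conjc (H i j w)) = N%:R^-1 * (s i j)%:C%C) ->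
  (forall i j, `|s i j| <= C) ->
  forall z, 0 < complex.Im z -> t ^+ 96 <= complex.Im z * N%:R -> normc z <= 3 * N%:R ^+ 2 ->
  (forall x y, vnorm x <= 1 -> vnorm y <= 1 ->
    small P t [set om | 5 * t < normc (sesq x (res z (rmat H om)) y) * (1 + normc z)] n') ->
  forall v w, vnorm v <= 1 -> vnorm w <= 1 ->
  small P t [set om | (t ^+ 8)^-1 < normc (fD z s v w (res z (rmat H om)))] n.
Proof.
(* Odd, so that m + 3 is even, and large enough for the rate n + 1 <= m + 2; the extra 1 pays for
   the union of real and imaginary part. *)
pose m := (2 * n).+1.
pose l := lexp m.
exists (2 * l + (2 * q).+1)%N.
exists (200 + 20 * C ^+ 2 + 1627 * m.+2%:R ^+ 2 + 2 ^+ m.+4 + `|Cp 4| + `|Cp (2 * l).+1|).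
move=> d T P N H t ht tN gw s hs sC z hz hzN hzb ap v w hv hw.
have a1 := sqr_ge0 C; have a2 := sqr_ge0 (m.+2%:R : R); have a3 : 0 <= 2 ^+ m.+4 :> R by nneg.
have a4 := normr_ge0 (Cp 4); have a5 := normr_ge0 (Cp (2 * l).+1).
have a6 := ler_norm (Cp 4); have a7 := ler_norm (Cp (2 * l).+1).
have t200 : 200 <= t by lra.
have t0 : 0 < t by lra.
have odm : odd m by rewrite /= mul2n odd_double.
have main v' : vnorm v' <= 1 -> small P t [set om | (t ^+ 9)^-1 <= `|complex.Re (fD z s v' w (res z (rmat H om)))|] n.+1.
  move=> hv'; have tC : 20 * C ^+ 2 <= t by lra.
  have tm : 1627 * m.+2%:R ^+ 2 <= t by lra.
  have tm2 : 2 ^+ m.+4 <= t by lra.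
  have t4 : Cp 4 <= t by lra.
  have tl : Cp (2 * lexp m).+1 <= t by move: a7 a5; rewrite -/l; lra.
  apply: (Re_fD_small t200 tC tN gw hs sC hz hzN hzb hv' hw odm tm tm2 t4 tl ap).
  by rewrite /m ltnS mul2n -addnn; do 2 apply: leqW; exact: leq_addr.
(* [fD] is conjugate linear in v, so its real part at i v is its imaginary part at v. *)
have hiv : vnorm ('i%C *: v) <= 1.
  by rewrite vnormZ /normc /= expr0n expr1n /= add0r sqrtr1 mul1r.
have t1 : 1 <= t by lra.
have t2 : 2 <= t by lra.
apply: small_sub (smallU t1 t2 (main v hv) (main _ hiv)).
move=> om /=; have -> : fD z s ('i%C *: v) w (res z (rmat H om)) = - 'i%C * fD z s v w (res z (rmat H om)).
  have lvZ l' : lv s ('i%C *: v) l' = 'i%C *: lv s v l'.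
    by apply/matrixP => i k; rewrite !mxE mulrA.
  have ci : conjc 'i%C = - 'i%C :> R[i] by rewrite /= ; congr (_ +i* _)%C; rewrite oppr0.
  have e1 : (adjm ('i%C *: v) *m w) 0 0 = - 'i%C * (adjm v *m w) 0 0.
    by rewrite adjmZ -scalemxAl mxE ci.
  rewrite /fD e1 sesqZl ci; under eq_bigr do rewrite lvZ sesqZl ci.
  rewrite !mulrDr; congr (_ + _ + _); first by rewrite mulrCA.
  by rewrite mulrCA !mulr_sumr; apply: eq_bigr => l' _; ring.
set x := fD _ _ _ _ _; move=> h; apply: contrapT => /not_orP [/negP h1 /negP h2].
rewrite -!ltNge in h1 h2.
have : normc x <= 2 * (t ^+ 9)^-1.
  apply: le_trans (normc_le_ReIm _) _.
  have : `|complex.Im x| < (t ^+ 9)^-1.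
    by move: h2; case: (x) => a b /=; rewrite !(mul0r, oppr0, mulN1r, sub0r, opprK).
  lra.
rewrite leNgt => /negP; apply; apply: le_lt_trans h.
by rewrite (exprS t 8) invfM mulrA ler_piMl ?invr_ge0 ?exprn_ge0 ?(ltW t0) // ler_pdivrMr // mul1r; lra.
Qed.

End Tail.

(** * The semicircle law and stability *)

Section Semicircle.
Variable R : rcfType.
Local Notation CC := R[i].
Implicit Types z m : CC.

Let mplus z : CC := (- z + sqrtc (z ^+ 2 - 4)) / 2.
Let mminus z : CC := (- z - sqrtc (z ^+ 2 - 4)) / 2.

(* the Stieltjes transform of the semicircle law: the root of m^2 + z m + 1 in the upper half plane *)
Definition msc z := if 0 < complex.Im (mplus z) then mplus z else mminus z.
(** The difference of the two roots 1/m and m. Its square is z^2 - 4, so it measures the distance to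
    the spectral edges, where the equation for the mean degenerates. *)
Definition rsc z := (msc z)^-1 - msc z.

Lemma normcV (x : CC) : normc x^-1 = (normc x)^-1.
Proof.
have [->|x0] := eqVneq x 0; first by rewrite invr0 normc0 invr0.
have nx : normc x != 0 by apply: contra x0 => /eqP /eq0_normc ->.
by apply: (mulfI nx); rewrite -normcM !divff // normc1.
Qed.

Lemma msc_eq z : msc z ^+ 2 + z * msc z + 1 = 0.
Proof.
have n4 : (4 : CC) != 0 by rewrite pnatr_eq0.
have h : (sqrtc (z ^+ 2 - 4)) ^+ 2 = z ^+ 2 - 4 by exact: sqr_sqrtc.
rewrite /msc; case: ifP => _; rewrite /mplus /mminus; set w := sqrtc _ in h *.
  have -> : ((- z + w) / 2) ^+ 2 + z * ((- z + w) / 2) + 1 = (w ^+ 2 - (z ^+ 2 - 4)) / 4 by field.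
  by rewrite h subrr mul0r.
have -> : ((- z - w) / 2) ^+ 2 + z * ((- z - w) / 2) + 1 = (w ^+ 2 - (z ^+ 2 - 4)) / 4 by field.
by rewrite h subrr mul0r.
Qed.

Lemma msc_neq0 z : msc z != 0.
Proof.
apply/eqP => h; have := msc_eq z; rewrite h expr0n /= mulr0 !add0r => /eqP.
by rewrite oner_eq0.
Qed.

Lemma msc_inv z : z + msc z = - (msc z)^-1.
Proof.
have h := msc_eq z; have m0 := msc_neq0 z.
apply: (mulIf m0); rewrite mulNr mulVf //; apply/eqP; rewrite -subr_eq0 opprK; apply/eqP.
by rewrite -[RHS]h; ring.
Qed.

Lemma Im_inv (x : CC) : complex.Im x^-1 = - complex.Im x / normc x ^+ 2.
Proof. by rewrite normc_sq; case: x => a b /=; rewrite mulNr. Qed.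

(** The two candidates have product 1, so their imaginary parts have opposite signs or both vanish;
    the latter is excluded because their sum is -z. *)
Lemma msc_im z : 0 < complex.Im z -> 0 < complex.Im (msc z).
Proof.
move=> hz; rewrite /msc; case: (ltP 0 (complex.Im (mplus z))) => // hp.
have hs : mplus z + mminus z = - z by rewrite /mplus /mminus; field.
have hm : mplus z * mminus z = 1.
  rewrite /mplus /mminus; have h : (sqrtc (z ^+ 2 - 4)) ^+ 2 = z ^+ 2 - 4 by exact: sqr_sqrtc.
  set w := sqrtc _ in h *; have -> : (- z + w) / 2 * ((- z - w) / 2) = (z ^+ 2 - w ^+ 2) / 4 by field.
  by rewrite h; field.
move: hs hm hp; move: (mplus z) (mminus z) => a b hs hm hp.
have ba : b = a^-1.
  have a0 : a != 0 by apply/eqP => a0; move/eqP: hm; rewrite a0 mul0r eq_sym oner_eq0.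
  by rewrite -[LHS](mulKf a0) hm mulr1.
have := congr1 (@complex.Im R) hs; rewrite ImD ImN ba Im_inv; rewrite le_eqVlt in hp.
case/orP: hp => [/eqP -> | hp]; first by rewrite oppr0 mul0r addr0; lra.
by move=> _; rewrite divr_gt0 ?oppr_gt0 // exprn_gt0 // lt_def normc_ge0 andbT; apply/eqP => /eq0_normc a0;
  move: hp; rewrite a0 ltxx.
Qed.

Lemma normc_gt0 (x : CC) : x != 0 -> 0 < normc x.
Proof.
move=> x0; rewrite lt_def normc_ge0 andbT; apply: contra x0 => /eqP h.
by apply/eqP; exact: eq0_normc.
Qed.

(** The imaginary part of z + m = -1/m reads Im z + Im m = Im m / |m|^2. *)
Lemma msc_le1 z : 0 < complex.Im z -> normc (msc z) <= 1.
Proof.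
move=> hz; have i0 := msc_im hz; have n0 := normc_gt0 (msc_neq0 z).
have := congr1 (@complex.Im R) (msc_inv z); rewrite ImD ImN Im_inv.
set b := complex.Im (msc z) in i0 *; set a := normc _ in n0 *.
rewrite mulNr opprK => h.
have a2 : 0 < a ^+ 2 by rewrite exprn_gt0.
have : b <= b / a ^+ 2 by rewrite -h lerDr ltW.
rewrite ler_pdivlMr // ger_pMr // => h2.
by rewrite -(@expr_le1 _ 2) // ltW.
Qed.

Lemma msc_le z : 0 < complex.Im z -> normc (msc z) * (1 + normc z) <= 3.
Proof.
move=> hz; have h1 := msc_le1 hz; have n0 := normc_gt0 (msc_neq0 z).
have h : normc z <= (normc (msc z))^-1 + normc (msc z).
  rewrite -normcV -[normc (msc z)^-1]normcNE -msc_inv -[X in normc X <= _](addrK (msc z)); exact: normcB.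
have : normc (msc z) * (1 + normc z) <= normc (msc z) * (1 + ((normc (msc z))^-1 + normc (msc z))).
  by apply: ler_wpM2l; [exact: ltW | rewrite lerD2l].
rewrite !mulrDr divff ?gt_eqF // -expr2 mulr1.
have : normc (msc z) ^+ 2 <= 1 by apply: exprn_ile1 => //; exact: ltW.
lra.
Qed.

Lemma msc_eta z : 0 < complex.Im z -> normc (msc z) * complex.Im z <= 1.
Proof.
move=> hz; have n0 := normc_gt0 (msc_neq0 z).
rewrite mulrC -ler_pdivlMr // mul1r -normcV -normcNE -msc_inv.
apply: le_trans (Im_le_normc _); apply: le_trans (ler_norm _).
by rewrite ImD lerDl ltW // msc_im.
Qed.

(** Subtracting the quadratic equations gives (m - m') (m + m' + z) = - (z - z') m', and the second
    factor has imaginary part at least Im z. *)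
Lemma msc_lip z z' : 0 < complex.Im z -> 0 < complex.Im z' ->
  normc (msc z - msc z') * complex.Im z <= normc (z - z').
Proof.
move=> hz hz'.
have e : (msc z - msc z') * (msc z + msc z' + z) = - ((z - z') * msc z').
  apply/eqP; rewrite -subr_eq0; apply/eqP.
  rewrite -[RHS](subrr 0) -{1}(msc_eq z) -(msc_eq z'); ring.
have := congr1 (@normc R) e; rewrite normcNE !normcM => h.
apply: le_trans (_ : normc (msc z - msc z') * normc (msc z + msc z' + z) <= _).
  apply: ler_wpM2l; first exact: normc_ge0.
  apply: le_trans (Im_le_normc _); apply: le_trans (ler_norm _).
  by rewrite !ImD lerDr addr_ge0 // ltW // msc_im.
by rewrite h ler_piMr ?normc_ge0 // msc_le1.
Qed.

Lemma rsc_sq z : rsc z ^+ 2 = (z - 2) * (z + 2).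
Proof.
have e : z = - (msc z + (msc z)^-1) by rewrite -[LHS](addrK (msc z)) msc_inv; ring.
have -> : (z - 2) * (z + 2) = (- (msc z + (msc z)^-1) - 2) * (- (msc z + (msc z)^-1) + 2) by rewrite -e.
rewrite /rsc; have := msc_neq0 z; move: (msc z) => m m0; field; exact: m0.
Qed.

(** |rsc|^2 = |z - 2| |z + 2|, and both factors shrink with Im z. So along the descent the regime
    away from the edges can be left but not re-entered, which is what the induction on [inv]
    needs. *)
Lemma rsc_mono z z' : complex.Re z' = complex.Re z -> 0 < complex.Im z' -> complex.Im z' <= complex.Im z ->
  normc (rsc z') <= normc (rsc z).
Proof.
move=> hre h0 him.
have mono (c : R) : normc (z' + c%:C%C) <= normc (z + c%:C%C).
  rewrite -(ler_pXn2r (n := 2)) ?nnegrE ?normc_ge0 // !normc_sq !ReD !ImD hre /= !addr0.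
  by rewrite lerD2l; apply: lerXn2r; rewrite ?nnegrE //; lra.
rewrite -(ler_pXn2r (n := 2)) ?nnegrE ?normc_ge0 // -!normcX !rsc_sq !normcM.
have e2 (c : nat) : (c%:R : CC) = (c%:R)%:C%C by rewrite rmorph_nat.
apply: ler_pM; rewrite ?normc_ge0 //.
  by have := mono (-2); rewrite rmorphN /= -e2.
by have := mono 2; rewrite -e2.
Qed.

End Semicircle.

(** * Stability of the vector equation for the diagonal entries *)

Section Stability.
Variable R : rcfType.
Local Notation CC := R[i].
Variables (n : nat) (C : R) (s : 'I_n -> 'I_n -> R) (z : CC) (g d : 'I_n -> CC) (delta : R).
Hypothesis n0 : (0 < n)%N.
Hypothesis C1 : 1 <= C.
Hypothesis sC : forall i j, C^-1 <= s i j.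
Hypothesis s_sym : forall i j, s i j = s j i.
Hypothesis s_sum : forall i, \sum_j s i j = n%:R.
Hypothesis hz : 0 < complex.Im z.
Hypothesis hd : forall i, d i = 1 + z * g i + n%:R^-1 * \sum_l g l * ((s i l)%:C%C * g i).
Hypothesis hdd : forall i, normc (d i) <= delta.

Local Notation m := (msc z).
Definition dev i : CC := g i - msc z.
Definition mdev : CC := n%:R^-1 * \sum_i dev i.
Let eps := dev.
Let x := mdev.
Let a i := eps i - x.
Let S (f : 'I_n -> CC) i : CC := n%:R^-1 * \sum_l (s i l)%:C%C * f l.
Let av (f : 'I_n -> CC) : CC := n%:R^-1 * \sum_i f i.

Let nC : (n%:R : CC) != 0. Proof. by rewrite pnatr_eq0 -lt0n. Qed.
Let nR : 0 < n%:R :> R. Proof. by rewrite ltr0n. Qed.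

Let avD f h : av (fun i => f i + h i) = av f + av h.
Proof. by rewrite /av big_split mulrDr. Qed.
Let avN f : av (fun i => - f i) = - av f.
Proof. by rewrite /av sumrN mulrN. Qed.
Let avZ c f : av (fun i => c * f i) = c * av f.
Proof. by rewrite /av -mulr_sumr mulrCA. Qed.
Let av_cst c : av (fun=> c) = c.
Proof. by rewrite /av sumr_const card_ord -[c *+ n]mulr_natl mulKf. Qed.
Let av_ext f h : (forall i, f i = h i) -> av f = av h.
Proof. by move=> e; rewrite /av; congr (_ * _); apply: eq_bigr. Qed.

Let s_sumC i : \sum_l (s i l)%:C%C = n%:R :> CC.
Proof. by rewrite -rmorph_sum s_sum rmorph_nat. Qed.

Let avS f : av (S f) = av f.
Proof.
rewrite /av /S -mulr_sumr exchange_big /=; congr (_ * _).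
rewrite mulr_sumr; apply: eq_bigr => l _; rewrite -mulr_suml.
under eq_bigr do rewrite s_sym.
by rewrite s_sumC mulKf.
Qed.

Let S_cst c i : S (fun=> c) i = c.
Proof. by rewrite /S -mulr_suml s_sumC mulKf. Qed.

Let S_D f h i : S (fun l => f l + h l) i = S f i + S h i.
Proof. by rewrite /S -mulrDr -big_split; congr (_ * _); apply: eq_bigr => l _; rewrite mulrDr. Qed.

Let av_a : av a = 0.
Proof. by rewrite /a (avD eps (fun=> - x)) av_cst subrr. Qed.

Let S_eps i : S eps i = x + S a i.
Proof. by rewrite -[x in RHS](S_cst _ i) -S_D /S; congr (_ * _); apply: eq_bigr => l _; rewrite /a addrC subrK. Qed.

(** The equation for g minus the one for msc, multiplied by m, with z + m replaced by -1/m. *)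
Let eq1 i : eps i = m ^+ 2 * S eps i + m * (eps i * S eps i) - m * d i.
Proof.
have m0 := msc_neq0 z; have minv := msc_inv z.
have e : n%:R^-1 * (\sum_l g l * ((s i l)%:C%C * g i)) = (m + S eps i) * g i.
  rewrite -[m in RHS](S_cst _ i) -S_D /S -mulrA mulr_suml; congr (_ * _); apply: eq_bigr => l _.
  by rewrite /eps /dev; ring.
rewrite hd e.
have -> : g i = eps i + m by rewrite /eps /dev subrK.
have -> : 1 + z * (eps i + m) + (m + S eps i) * (eps i + m) =
  1 + (z + m) * (eps i + m) + S eps i * (eps i + m) by ring.
by rewrite minv; field.
Qed.

Let quad i : eps i * S eps i = x ^+ 2 + x * (a i + S a i) + a i * S a i.
Proof.
have e : eps i = x + a i by rewrite /a addrC subrK.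
by rewrite S_eps e; ring.
Qed.

Let avquad : av (fun i => eps i * S eps i) = x ^+ 2 + av (fun i => a i * S a i).
Proof.
rewrite (av_ext quad) (avD (fun i => x ^+ 2 + x * (a i + S a i)) (fun i => a i * S a i)).
rewrite (avD (fun=> x ^+ 2) (fun i => x * (a i + S a i))) av_cst (avZ x (fun i => a i + S a i)).
by rewrite (avD a (S a)) avS av_a addr0 mulr0 addr0.
Qed.

Let av1 : x = m ^+ 2 * x + m * (x ^+ 2 + av (fun i => a i * S a i)) - m * av d.
Proof.
rewrite {1}/x /mdev -/(av eps) (av_ext eq1).
rewrite (avD (fun i => m ^+ 2 * S eps i + m * (eps i * S eps i)) (fun i => - (m * d i))).
rewrite (avD (fun i => m ^+ 2 * S eps i) (fun i => m * (eps i * S eps i))).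
by rewrite (avN (fun i => m * d i)) (avZ _ (S eps)) (avZ _ (fun i => eps i * S eps i)) (avZ _ d) avS avquad.
Qed.

(** The mean satisfies a scalar quadratic equation whose source is quadratic in the fluctuations a:
    S preserves averages, and the cross terms vanish since a has mean zero. *)
Let eqx : x * rsc z - x ^+ 2 = av (fun i => a i * S a i) - av d.
Proof.
have m0 := msc_neq0 z; have h := av1; rewrite /rsc.
have -> : x * (m^-1 - m) - x ^+ 2 = m^-1 * (x - m ^+ 2 * x - m * x ^+ 2) by field.
by rewrite {1}h; field.
Qed.

Let eqa i : a i = m ^+ 2 * S a i + m * (x * (a i + S a i) + a i * S a i - av (fun i => a i * S a i))
  - m * (d i - av d).
Proof.
have h := av1.
rewrite {1}/a eq1 {1}h quad S_eps; ring.
Qed.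

Variable L : R.
Hypothesis hL : forall i, normc (dev i) <= L.
Hypothesis L_small : 12 * L <= C^-1.
Hypothesis d_small : 16 * C ^+ 2 * delta <= 1.

Let av_le f B : (forall i, normc (f i) <= B) -> normc (av f) <= B.
Proof.
move=> h; rewrite /av normcM normcV normc_nat ler_pdivrMl //.
apply: le_trans (normc_sum _ _ _) _; apply: le_trans (ler_sum _ (fun i _ => h i)) _.
by rewrite sumr_const card_ord mulr_natl.
Qed.

(* Doeblin contraction: subtracting the common lower bound 1/C from the kernel does not change S a. *)
Let Sa_le A : (forall i, normc (a i) <= A) -> forall i, normc (S a i) <= (1 - C^-1) * A.
Proof.
move=> h i.
have -> : S a i = n%:R^-1 * \sum_l (s i l - C^-1)%:C%C * a l.
  rewrite /S; congr (_ * _); apply/eqP; rewrite -subr_eq0 -sumrB; apply/eqP.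
  rewrite (eq_bigr (fun l => (C^-1)%:C%C * a l)); last first.
    by move=> l _; rewrite -mulrBl -rmorphB /= opprB addrC subrK.
  rewrite -mulr_sumr; have := av_a; rewrite /av => /eqP; rewrite mulf_eq0 invr_eq0 (negPf nC) /= => /eqP ->.
  by rewrite mulr0.
rewrite normcM normcV normc_nat ler_pdivrMl //.
apply: le_trans (normc_sum _ _ _) _.
have -> : n%:R * ((1 - C^-1) * A) = \sum_l (s i l - C^-1) * A.
  by rewrite -mulr_suml sumrB s_sum sumr_const card_ord -mulr_natl; ring.
apply: ler_sum => l _; rewrite normcM normc_real ger0_norm ?subr_ge0 //.
by apply: ler_wpM2l; rewrite ?subr_ge0.
Qed.

(** At the index where |a| is maximal, contraction gives A <= (1 - 1/C) A + (2 L + 2 A) A + 2 delta,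
    and the quadratic term is absorbed because L is small. Then A^2 <= delta, and the equation for
    the mean follows with 2 delta. *)
Lemma stab_dev : (forall i, normc (dev i - mdev) <= 4 * C * delta) /\
  normc mdev * normc (rsc z - mdev) <= 2 * delta.
Proof.
have c1 := C1; have C0 : 0 < C by lra.
have m1 := msc_le1 hz.
have m2 : normc (m ^+ 2) <= 1 by rewrite normcX exprn_ile1 // normc_ge0.
pose i0 := Ordinal n0.
have [k _ hk] := @arg_maxP _ _ _ i0 xpredT (fun i => normc (a i)) isT.
set A := normc (a k).
have hA i : normc (a i) <= A by exact: hk.
have A0 : 0 <= A by exact: normc_ge0.
have hSa := Sa_le hA.
have xL : normc x <= L by exact: av_le.
have L0 : 0 <= L by apply: le_trans xL; exact: normc_ge0.
have d0 : 0 <= delta by apply: le_trans (hdd i0); exact: normc_ge0.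
have AL : A <= 2 * L.
  by rewrite /A /a; apply: le_trans (normcB _ _) _; have := hL k; rewrite -/eps; lra.
have c0 : 0 < C^-1 by rewrite invr_gt0.
have cC : C^-1 <= 1 by rewrite invf_le1.
have Sa1 i : normc (S a i) <= A by apply: le_trans (hSa i) _; rewrite ler_piMl //; lra.
have AA : normc (av (fun i => a i * S a i)) <= A * A.
  by apply: av_le => i; rewrite normcM; apply: ler_pM; rewrite ?normc_ge0.
have dd : normc (av d) <= delta by exact: av_le.
have key : A <= (1 - C^-1) * A + (L * (2 * A) + A * A + A * A) + 2 * delta.
  rewrite {1}/A eqa.
  apply: le_trans (normcB _ _) _; apply: lerD.
    apply: le_trans (normcD _ _) _; apply: lerD.
      by rewrite normcM -[X in _ <= X]mul1r; apply: ler_pM; rewrite ?normc_ge0.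
    rewrite normcM -[X in _ <= X]mul1r; apply: ler_pM; rewrite ?normc_ge0 //.
    apply: le_trans (normcB _ _) _; apply: lerD => //.
    apply: le_trans (normcD _ _) _; apply: lerD.
      rewrite normcM; apply: ler_pM; rewrite ?normc_ge0 //.
      by apply: le_trans (normcD _ _) _; have := Sa1 k; rewrite -/A; lra.
    by rewrite normcM; apply: ler_pM; rewrite ?normc_ge0.
  rewrite normcM -[X in _ <= X]mul1r; apply: ler_pM; rewrite ?normc_ge0 //.
  by apply: le_trans (normcB _ _) _; have := hdd k; lra.
have hA2 : A <= 4 * C * delta.
  have e : A * (C^-1 - 2 * L - 2 * A) <= 2 * delta by move: key; lra.
  (* As A <= 2 L, the loss is at most 6 L, which is half of 1/C by the smallness of L. *)
  have h1 : C^-1 / 2 <= C^-1 - 2 * L - 2 * A by move: L_small; lra.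
  have h2 : A * (C^-1 / 2) <= 2 * delta by apply: le_trans e; apply: ler_wpM2l.
  have -> : A = 2 * C * (A * (C^-1 / 2)) by field; rewrite gt_eqF.
  have -> : 4 * C * delta = 2 * C * (2 * delta) by ring.
  by apply: ler_wpM2l => //; lra.
split; first by move=> i; apply: le_trans (hA i) _.
rewrite -normcM (_ : mdev * (rsc z - mdev) = av (fun i => a i * S a i) - av d); last first.
  by rewrite -eqx /x; ring.
apply: le_trans (normcB _ _) _.
have : A * A <= delta.
  apply: le_trans (ler_pM A0 A0 hA2 hA2) _.
  have -> : 4 * C * delta * (4 * C * delta) = 16 * C ^+ 2 * delta * delta by ring.
  by rewrite ler_piMl.
by move: AA dd; lra.
Qed.

End Stability.

(** * The invariant carried along small steps in Im z *)

Section Invariant.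
Variable R : rcfType.
Local Notation CC := R[i].
Variables (n : nat) (C Th : R) (s : 'I_n -> 'I_n -> R).
Hypothesis n0 : (0 < n)%N.
Hypothesis C1 : 1 <= C.
Hypothesis sC : forall i j, C^-1 <= s i j.
Hypothesis s_sym : forall i j, s i j = s j i.
Hypothesis s_sum : forall i, \sum_j s i j = n%:R.
Hypothesis Th0 : 0 <= Th.
Hypothesis ThC : 120 * Th * C <= 1.

(* Near the edges, where [rsc z] is small, only the weaker bound 8 Th survives. *)
Definition inv (z : CC) (g : 'I_n -> CC) :=
  [/\ 6 * Th <= normc (rsc z) -> normc (mdev z g) <= Th, normc (mdev z g) <= 8 * Th &
      forall i, normc (dev z g i) <= 9 * Th].

Lemma mdev_le (z : CC) (g : 'I_n -> CC) B : (forall i, normc (dev z g i) <= B) -> normc (mdev z g) <= B.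
Proof.
move=> h; rewrite /mdev normcM normcV normc_nat ler_pdivrMl ?ltr0n //.
apply: le_trans (normc_sum _ _ _) _; apply: le_trans (ler_sum _ (fun i _ => h i)) _.
by rewrite sumr_const card_ord mulr_natl.
Qed.

(** The product |x| |rsc - x| is at most 2 Th^2, so x is near one of the two roots. One step moves x
    by at most Th, which rules out a jump to the wrong root where the roots are separated; otherwise
    both roots are O(Th). *)
Lemma inv_step (z z' : CC) (g g' d : 'I_n -> CC) :
  complex.Re z' = complex.Re z -> 0 < complex.Im z' -> complex.Im z' <= complex.Im z ->
  (forall i, d i = 1 + z' * g' i + n%:R^-1 * \sum_l g' l * ((s i l)%:C%C * g' i)) ->
  (forall i, normc (d i) <= Th ^+ 2) -> inv z g ->
  (forall i, normc (g' i - g i) <= Th / 2) -> normc (msc z - msc z') <= Th / 2 ->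
  inv z' g'.
Proof.
move=> hre h0 him hd hdd [i1 i2 i3] hg hm.
have C1' := C1; have ThC' := ThC; have Th0' := Th0.
have C0 : 0 < C by lra.
have TC : 120 * Th <= C^-1 by rewrite -[C^-1]mul1r ler_pdivlMr.
have hdev i : normc (dev z' g' i - dev z g i) <= Th.
  have -> : dev z' g' i - dev z g i = (g' i - g i) + (msc z - msc z') by rewrite /dev; ring.
  by apply: le_trans (normcD _ _) _; have := hg i; lra.
have hmdev : normc (mdev z' g' - mdev z g) <= Th.
  have -> : mdev z' g' - mdev z g = mdev 0 (fun i => dev z' g' i - dev z g i + msc 0).
    by rewrite /mdev -mulrBr -sumrB; congr (_ * _); apply: eq_bigr => i _; rewrite [RHS]addrK.
  by apply: mdev_le => i; rewrite /dev addrK; exact: hdev.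
have L i : normc (dev z' g' i) <= 10 * Th.
  by rewrite -[dev z' g' i](subrK (dev z g i)); apply: le_trans (normcD _ _) _; have := hdev i; have := i3 i; lra.
have dsm : 16 * C ^+ 2 * Th ^+ 2 <= 1.
  have -> : 16 * C ^+ 2 * Th ^+ 2 = (4 * Th * C) ^+ 2 by ring.
  by apply: exprn_ile1; [rewrite !mulr_ge0 // ltW | lra].
have Lsm : 12 * (10 * Th) <= C^-1 by lra.
have [a1 a2] := stab_dev n0 C1 sC s_sym s_sum h0 hd hdd L Lsm dsm.
have x0 := normc_ge0 (mdev z' g').
set x := normc (mdev z' g') in a2 x0 *; set y := normc (_ - _) in a2.
have y0 : 0 <= y by exact: normc_ge0.
have ry : normc (rsc z') <= x + y.
  by rewrite -[rsc z'](subrK (mdev z' g')) addrC; exact: normcD.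
have yr : x <= normc (rsc z') + y.
  rewrite /x -[mdev z' g'](subKr (rsc z')); exact: normcB.
(* For |rsc| >= 6 Th, x is within Th of its previous value, hence at most 2 Th. For |rsc| < 6 Th, x
   > 8 Th forces |rsc - x| > 2 Th and a product above 16 Th^2. *)
have x8 : x <= 8 * Th.
  rewrite leNgt; apply/negP => hx.
  have [r6|r6] := leP (6 * Th) (normc (rsc z')).
    have := i1 (le_trans r6 (rsc_mono hre h0 him)).
    have : x <= normc (mdev z' g' - mdev z g) + normc (mdev z g).
      by rewrite /x -{1}[mdev z' g'](subrK (mdev z g)); exact: normcD.
    lra.
  have : 8 * Th * (2 * Th) < x * y by apply: ltr_pM; lra.
  nra.
split=> //.
  (* Here x <= 2 Th, so |rsc - x| >= 4 Th; with x > Th the product would be at least 4 Th^2. *)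
  move=> r6; have h1 := i1 (le_trans r6 (rsc_mono hre h0 him)).
  have : x <= normc (mdev z' g' - mdev z g) + normc (mdev z g).
    by rewrite /x -{1}[mdev z' g'](subrK (mdev z g)); exact: normcD.
  move=> h2; rewrite leNgt; apply/negP; rewrite -/x => hx.
  have x2 : x <= 2 * Th by lra.
  have y4 : 4 * Th <= y by lra.
  have T0 : 0 < Th by lra.
  have TT : 0 < Th ^+ 2 by rewrite exprn_gt0.
  have : Th * (4 * Th) <= x * y by apply: ler_pM => //; lra.
  lra.
move=> i; rewrite -[dev z' g' i](subrK (mdev z' g')); apply: le_trans (normcD _ _) _.
have : 4 * C * Th ^+ 2 <= Th.
  have -> : 4 * C * Th ^+ 2 = (4 * C * Th) * Th by ring.
  by rewrite ler_piMl //; lra.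
have := a1 i; rewrite -/x; lra.
Qed.

Lemma inv_start (z : CC) (M : 'M[CC]_n) : hermm M -> 0 < complex.Im z -> 2 <= Th * complex.Im z ->
  inv z (fun i => res z M i i).
Proof.
move=> hM hz hTh.
have h i : normc (dev z (fun i => res z M i i) i) <= Th.
  rewrite /dev; apply: le_trans (normcB _ _) _.
  have h1 := res_entry_bound hM hz (basis R i) (basis R i).
  rewrite sesq_basis !sqn_basis !sqrtr1 mulr1 in h1.
  have h2 := msc_eta hz.
  by rewrite -(ler_pM2r hz) mulrDl; lra.
have Th0' := Th0; have hm := mdev_le h.
by split => // [|i]; [lra | have := h i; lra].
Qed.

(** With the diagonal entries replaced by msc, the operator z + S[G] becomes z + m = -1/m, and the
    error is solved for <v, G w>. The replacement costs 9 Th K, and the factor 3 is [msc_le]. *)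
Lemma iso_bound (z : CC) (G : 'M[CC]_n) v w (d K : R) : 0 < complex.Im z -> vnorm v <= 1 -> vnorm w <= 1 ->
  0 <= K -> inv z (fun i => G i i) -> normc (fD z s v w G) <= d ->
  (forall l, normc (sesq (lv s v l) G w) <= K) ->
  normc (sesq v G w) * (1 + normc z) <= 3 * (1 + d + 9 * Th * K).
Proof.
move=> hz hv hw K0 [_ _ hi] hd hK.
have n0C : (n%:R : CC) != 0 by rewrite pnatr_eq0 -lt0n.
have m0 := msc_neq0 z.
have Th0' := Th0.
pose av : CC := n%:R^-1 * \sum_l dev z (fun i => G i i) l * sesq (lv s v l) G w.
have e : sesq v G w = - (msc z * (fD z s v w G - (adjm v *m w) 0 0 - av)).
  have -> : fD z s v w G - (adjm v *m w) 0 0 - av = (z + msc z) * sesq v G w.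
    (* The rows of s sum to n, so the average of the vectors [lv l] over l is v. *)
    have e1 : sesq v G w = n%:R^-1 * \sum_l sesq (lv s v l) G w.
      under eq_bigr do rewrite /lv sesq_lvec.
      rewrite exchange_big /= mulr_sumr sesq_suml; apply: eq_bigr => i _.
      rewrite -mulr_suml -mulr_sumr -rmorph_sum s_sum rmorph_nat.
      by rewrite [_ * n%:R]mulrC -[n%:R * _ * _]mulrA mulKf.
    have e2 : av = n%:R^-1 * (\sum_l G l l * sesq (lv s v l) G w) - msc z * sesq v G w.
      rewrite {1}e1 [msc z * (_ * _)]mulrCA /av -mulrBr [msc z * \sum_(_ <- _ | _) _]mulr_sumr -sumrB; congr (_ * _); apply: eq_bigr => l _.
      by rewrite /dev mulrBl.
    by rewrite e2 /fD; ring.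
  by rewrite msc_inv !mulNr mulrN mulVKf // opprK.
have hav : normc av <= 9 * Th * K.
  rewrite /av normcM normcV normc_nat ler_pdivrMl ?ltr0n //.
  apply: le_trans (normc_sum _ _ _) _.
  have -> : n%:R * (9 * Th * K) = \sum_(l < n) 9 * Th * K by rewrite sumr_const card_ord mulr_natl.
  by apply: ler_sum => l _; rewrite normcM; apply: ler_pM; rewrite ?normc_ge0.
have hvw : normc ((adjm v *m w) 0 0) <= 1.
  by apply: le_trans (dot_le v w) _; rewrite mulr_ile1 ?sqrtr_ge0.
rewrite e normcNE normcM mulrAC.
apply: ler_pM; [|exact: normc_ge0|exact: msc_le|].
  by rewrite mulr_ge0 ?normc_ge0 // addr_ge0 ?normc_ge0.
apply: le_trans (normcB _ _) _; apply: lerD => //.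
by apply: le_trans (normcB _ _) _; lra.
Qed.

End Invariant.

(** * Descent in the imaginary part *)

Section Grid.
Context (R : realType).
Local Notation CC := R[i].
Variables (N : nat) (C t : R) (s : 'I_N -> 'I_N -> R) (q : nat).
Hypothesis n0 : (0 < N)%N.
Hypothesis C1 : 1 <= C.
Hypothesis sC : forall i j, C^-1 <= s i j.
Hypothesis s_sym : forall i j, s i j = s j i.
Hypothesis s_sum : forall i, \sum_j s i j = N%:R.
Hypothesis q5 : (5 <= q)%N.
Hypothesis t2 : 2 <= t.
Hypothesis tC : 120 * C <= t.
Hypothesis tN : t ^+ q = N%:R.

Lemma fD_diag (z : CC) i (G : 'M[CC]_N) :
  fD z s (basis R i) (basis R i) G =
  1 + z * G i i + N%:R^-1 * \sum_l G l l * ((s i l)%:C%C * G i i).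
Proof.
have hl l : lv s (basis R i) l = (s i l)%:C%C *: basis R i.
  apply/matrixP => k j; rewrite !mxE ord1 eqxx andbT.
  by have [->|_] := eqVneq k i; rewrite ?(mul1r, mulr1, mul0r, mulr0) // /cof /= oppr0.
rewrite /fD basis_dot mxE !eqxx sesq_basis; congr (_ + _ + _ * _); apply: eq_bigr => l _.
by rewrite hl sesqZl sesq_basis /= oppr0.
Qed.

Definition grid_pt (E eta eta' : R) (j : nat) : CC :=
  (E +i* (eta - j%:R * ((eta - eta') / N%:R ^+ 5)))%C.

Let Nt : N%:R^-1 <= (t ^+ 4)^-1 / 2 :> R.
Proof.
have t2' := t2; have t0 : 0 < t by lra.
rewrite -tN -invfM lef_pV2 ?posrE ?exprn_gt0 // ?mulr_gt0 ?exprn_gt0 //.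
apply: le_trans (_ : t ^+ 5 <= _); last by apply: ler_weXn2l => //; lra.
by rewrite (exprSr t 4); apply: ler_wpM2l => //; apply: exprn_ge0; exact: ltW.
Qed.

(** Iterates [inv_step] with Th = t^-4 over N^5 equal steps; the bound t^-8 on the error is Th^2. *)
Lemma inv_grid (M : 'M[CC]_N) (E eta eta' : R) : hermm M ->
  1 <= eta' * N%:R -> eta' <= eta -> eta <= N%:R ^+ 2 ->
  (forall j i, (j <= N ^ 5)%N -> let z := grid_pt E eta eta' j in
     normc (fD z s (basis R i) (basis R i) (res z M)) <= (t ^+ 8)^-1) ->
  inv (t ^+ 4)^-1 (E +i* eta)%C (fun i => res (E +i* eta)%C M i i) ->
  inv (t ^+ 4)^-1 (E +i* eta')%C (fun i => res (E +i* eta')%C M i i).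
Proof.
move=> hM h1 h2 h3 hd hi.
have t2' := t2; have t0 : 0 < t by lra.
have N0 : 0 < N%:R :> R by rewrite ltr0n.
have N50 : 0 < N%:R ^+ 5 :> R by rewrite exprn_gt0.
set h := (eta - eta') / N%:R ^+ 5.
have hh : 0 <= h by rewrite divr_ge0 ?subr_ge0 // ltW.
have e0 : 0 < eta' by rewrite -(pmulr_lgt0 _ N0); lra.
(* The step is at most N^-3 and the resolvent is Lipschitz with constant N^2 for Im z >= 1/N, so
   each step moves the entries by at most 1/N <= Th / 2. *)
have hN : h * N%:R ^+ 2 <= N%:R^-1.
  rewrite /h mulrAC ler_pdivrMr // -[N%:R ^+ 5]mulr1.
  have -> : N%:R^-1 * (N%:R ^+ 5 * 1) = N%:R ^+ 2 * N%:R ^+ 2 :> R by field; rewrite gt_eqF.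
  by apply: ler_wpM2r; [apply: exprn_ge0; exact: ltW | lra].
have hp j : (j <= N ^ 5)%N -> eta' <= eta - j%:R * h.
  move=> hj; have : j%:R * h <= N%:R ^+ 5 * h.
    by apply: ler_wpM2r => //; rewrite -natrX ler_nat.
  by rewrite [X in _ <= X]mulrC /h divfK ?gt_eqF //; lra.
have imv j : complex.Im (grid_pt E eta eta' j) = eta - j%:R * h by [].
suff main j : (j <= N ^ 5)%N -> inv (t ^+ 4)^-1 (grid_pt E eta eta' j) (fun i => res (grid_pt E eta eta' j) M i i).
  have := main _ (leqnn _); rewrite /grid_pt natrX.
  by rewrite [_ ^+ 5 * _]mulrC divfK ?gt_eqF // opprB addrC subrK.
elim: j => [_|j IH hj].
  by rewrite /grid_pt mul0r subr0.
have hj' := ltnW hj; have iv := IH hj'.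
have Th0 : 0 <= (t ^+ 4)^-1 by rewrite invr_ge0 exprn_ge0 // ltW.
have ThC : 120 * (t ^+ 4)^-1 * C <= 1.
  rewrite mulrAC ler_pdivrMr ?exprn_gt0 // mul1r; apply: le_trans tC _.
  by apply: ler_eXnr => //; lra.
have p1 := hp _ hj'; have p2 := hp _ hj.
have i1 : 0 < complex.Im (grid_pt E eta eta' j) by rewrite imv; lra.
have i2 : 0 < complex.Im (grid_pt E eta eta' j.+1) by rewrite imv; lra.
have dz : normc (grid_pt E eta eta' j.+1 - grid_pt E eta eta' j) = h.
  rewrite /grid_pt /= subrr expr0n /= add0r sqrtr_sqr.
  have -> : eta - j.+1%:R * h - (eta - j%:R * h) = - h by rewrite -/h mulrSr; ring.
  by rewrite normrN ger0_norm.
have im_ge x : eta' <= x -> 1 <= x * N%:R by move=> hx; apply: le_trans h1 _; apply: ler_wpM2r; rewrite // ltW.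
apply: (inv_step n0 C1 sC s_sym s_sum Th0 ThC (z := grid_pt E eta eta' j) (g := fun i => res (grid_pt E eta eta' j) M i i)
  (d := fun i => fD (grid_pt E eta eta' j.+1) s (basis R i) (basis R i) (res (grid_pt E eta eta' j.+1) M))) => //.
- by rewrite !imv lerD2l lerN2; apply: ler_wpM2r => //; rewrite ler_nat.
- by move=> i; exact: fD_diag.
- by move=> i; apply: le_trans (hd _ i hj) _; rewrite exprVn -exprM.
- move=> i; apply: le_trans Nt; apply: le_trans hN.
  have := res_lipschitz hM i2 i1 (v := basis R i) (w := basis R i).
  rewrite !vnorm_basis !sesq_basis dz => /(_ (lexx _) (lexx _)) /le_trans; apply.
  apply: ler_wpM2l => //; rewrite -[N%:R ^+ 2]invrK lef_pV2 ?posrE ?invr_gt0 ?exprn_gt0 ?mulr_gt0 //.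
  rewrite -exprVn expr2; apply: ler_pM; rewrite ?invr_ge0 ?(ltW N0) //.
    by rewrite -[N%:R^-1]mul1r ler_pdivrMr //; apply: im_ge.
  by rewrite -[N%:R^-1]mul1r ler_pdivrMr //; apply: im_ge.
apply: le_trans Nt; apply: le_trans hN.
have := msc_lip i1 i2; rewrite [X in _ <= X -> _]normcBC dz => hm.
have N1 : 1 <= N%:R :> R by rewrite ler1n.
have := im_ge _ p1; rewrite -imv => h4.
set a := normc _ in hm *; have a0 : 0 <= a by exact: normc_ge0.
apply: (@le_trans _ _ (h * N%:R)).
  apply: le_trans (_ : a * complex.Im (grid_pt E eta eta' j) * N%:R <= _).
    by rewrite -mulrA ler_peMr.
  by apply: ler_wpM2r; rewrite // ltW.
by apply: ler_wpM2l => //; rewrite expr2 ler_peMr // ltW.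
Qed.

End Grid.

(** * Induction over the scales of Im z *)

Section Bootstrap.
Context (R : realType) (C : R) (Cp : nat -> R) (q : nat).
Hypothesis C0 : 0 < C.
Hypothesis q200 : (200 <= q)%N.
Local Notation CC := R[i].

Definition is_profile d (T : measurableType d) (P : probability T R) N (H : 'I_N -> 'I_N -> T -> CC)
    (s : 'I_N -> 'I_N -> R) :=
  [/\ forall i j, Ec P (fun w => H i j w * conjc (H i j w)) = N%:R^-1 * (s i j)%:C%C,
      forall i j, C^-1 <= s i j <= C, forall i j, s i j = s j i &
      forall i, \sum_j s i j = N%:R].

Definition entry_large d (T : measurableType d) N (H : 'I_N -> 'I_N -> T -> CC) (K : R) (z : CC) v w :=
  [set om | K < normc (sesq v (res z (rmat H om)) w) * (1 + normc z)].

Definition inv_fails d (T : measurableType d) N (H : 'I_N -> 'I_N -> T -> CC) (t : R) (z : CC) :=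
  [set om | ~ inv (t ^+ 4)^-1 z (fun i => res z (rmat H om) i i)].

(* The descent visits Im z = N^2 t^-k; recall t^q = N. *)
Definition spec (t E : R) k : CC := (E +i* (t ^+ (2 * q) / t ^+ k))%C.

(** The rate n comes before the threshold t0, and t0 before N and the matrix: a step may use the
    previous level at a larger rate, uniformly in the ensemble. *)
Definition level k := forall n, exists t0, forall d (T : measurableType d) (P : probability T R) N
  (H : 'I_N -> 'I_N -> T -> CC) (t : R), t0 <= t -> t ^+ q = N%:R -> gen_wigner C Cp P H ->
  forall s, is_profile P H s -> forall E, `|E| <= N%:R ->
  (forall v w, vnorm v <= 1 -> vnorm w <= 1 -> small P t (entry_large H 4 (spec t E k) v w) n) /\
  small P t (inv_fails H t (spec t E k)) n.

Lemma small0 d (T : measurableType d) (P : probability T R) (t : R) (A : set T) n : 0 < t ->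
  (forall om, ~ A om) -> small P t A n.
Proof.
move=> t0 h; exists set0; split => //.
by rewrite measure0 lee_fin invr_ge0 exprn_ge0 // ltW.
Qed.

(** At Im z = N^2 the entries are at most N^-2 while 1 + |z| <= 3 N^2, so the exceptional sets are
    empty. *)
Lemma level0 : level 0.
Proof.
move=> n; exists 2 => d T P N H t t2 tN gw s _ E hE.
have t0 : 0 < t by lra.
have N0 : 0 < N%:R :> R by rewrite -tN exprn_gt0.
have n0 : (0 < N)%N by rewrite -(ltr0n R).
have N1 : 1 <= N%:R :> R by rewrite ler1n.
have N2 : N%:R <= N%:R ^+ 2 :> R by rewrite expr2 ler_peMl // ltW.
have ez : spec t E 0 = (E +i* N%:R ^+ 2)%C by rewrite /spec expr0 divr1 mulnC exprM tN.
rewrite ez; set z := (E +i* _)%C.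
have hz : 0 < complex.Im z by rewrite /= exprn_gt0.
have nz : 1 + normc z <= 3 * N%:R ^+ 2.
  have := normc_le_ReIm z; rewrite /= [`|N%:R ^+ 2|]ger0_norm ?exprn_ge0 ?(ltW N0) //; lra.
have hM om := herm_H (gw_hH gw) om.
split => [v w hv hw|]; apply: small0 => // om /=.
  apply/negP; rewrite -leNgt.
  have h := res_entry_bound (hM om) hz v w.
  set a := normc _ in h *; have a0 : 0 <= a by exact: normc_ge0.
  have h1 : a * N%:R ^+ 2 <= 1.
    by apply: le_trans h _; rewrite mulr_ile1 ?sqrtr_ge0.
  by apply: le_trans (ler_wpM2l a0 nz) _; lra.
apply; apply: inv_start => //; first by rewrite invr_ge0 exprn_ge0 // ltW.
rewrite /= mulrC ler_pdivlMr ?exprn_gt0 // -tN -exprM.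
apply: le_trans (_ : t ^+ 5 <= _); last by apply: ler_weXn2l; [lra | lia].
by rewrite (exprS t 4); apply: ler_wpM2r => //; apply: exprn_ge0; exact: ltW.
Qed.

(** [res_scale] on the three pairs (v, v), (w, w), (v, w); the factor 4 (1 + t) is at most 5 t, and
    the weight 1 + |z| only decreases. *)
Lemma apriori_scale d (T : measurableType d) (P : probability T R) N (H : 'I_N -> 'I_N -> T -> CC) (t E eta eta' : R) n :
  (forall i j w, H j i w = conjc (H i j w)) -> 4 <= t -> 0 < eta' -> eta' <= eta -> eta <= t * eta' ->
  (forall v w, vnorm v <= 1 -> vnorm w <= 1 -> small P t (entry_large H 4 (E +i* eta)%C v w) n.+1) ->
  forall v w, vnorm v <= 1 -> vnorm w <= 1 -> small P t (entry_large H (5 * t) (E +i* eta')%C v w) n.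
Proof.
move=> hH t4 e0 he het h v w hv hw.
have t1 : 1 <= t by lra.
pose A (k : 'cV[CC]_N * 'cV[CC]_N) := entry_large H 4 (E +i* eta)%C k.1 k.2.
apply: (@small_sub _ _ _ _ _ _ [set om | exists2 k, k \in [:: (v, v); (w, w); (v, w)] & A k om]); last first.
  apply: (small_seq t1 (l := 1)); last by rewrite expr1 /=; lra.
  by move=> k; rewrite addn1 !inE => /or3P [] /eqP ->; apply: h.
move=> om hbig; apply: contrapT => hno.
have z1 : 0 < 1 + normc (E +i* eta)%C by have := normc_ge0 (E +i* eta)%C; lra.
have hk k : k \in [:: (v, v); (w, w); (v, w)] ->
    normc (sesq k.1 (res (E +i* eta)%C (rmat H om)) k.2) <= 4 / (1 + normc (E +i* eta)%C).
  move=> hk; rewrite ler_pdivlMr // leNgt; apply/negP => hl; apply: hno.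
  by exists k.
have e1 : 0 < eta by lra.
have := @res_scale _ _ _ (E +i* eta)%C (E +i* eta')%C (herm_H hH om) e0 e1 erefl he t (4 / (1 + normc (E +i* eta)%C)) v w het.
move=> /(_ _ (hk (v, v) _) (hk (w, w) _) (hk (v, w) _)); rewrite !inE !eqxx !orbT.
move=> /(_ _ isT isT isT) hs.
have {hs} : normc (sesq v (res (E +i* eta')%C (rmat H om)) w) <= (1 + t) * (4 / (1 + normc (E +i* eta)%C)).
  by apply: hs; apply: divr_ge0 => //; exact: ltW.
have nz : normc (E +i* eta')%C <= normc (E +i* eta)%C.
  rewrite -(ler_pXn2r (n := 2)) ?nnegrE ?normc_ge0 // !normc_sq /= lerD2l.
  by apply: lerXn2r; rewrite ?nnegrE //; exact: ltW.
move: hbig; rewrite /entry_large /=; set a := normc (sesq _ _ _).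
have a0 : 0 <= a by exact: normc_ge0.
move=> h1 h2; have : a * (1 + normc (E +i* eta)%C) <= (1 + t) * 4.
  by rewrite -ler_pdivlMr // -mulrA.
have : a * (1 + normc (E +i* eta')%C) <= a * (1 + normc (E +i* eta)%C).
  by apply: ler_wpM2l => //; rewrite lerD2l.
by move=> h3 h4; have := lt_le_trans h1 (le_trans h3 h4); lra.
Qed.

(** Returns from 5 t to the constant 4, so that nothing accumulates over the levels: the rough bound
    enters only multiplied by 9 t^-4, and 3 (1 + 1/6 + 1/6) = 4. *)
Lemma apriori_iso d (T : measurableType d) (P : probability T R) N (H : 'I_N -> 'I_N -> T -> CC) (t : R) s z n :
  gen_wigner C Cp P H -> is_profile P H s -> (0 < N)%N -> 0 < complex.Im z ->
  t ^+ q = N%:R -> 2 <= t -> 270 * C <= t ->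
  (forall x y, vnorm x <= 1 -> vnorm y <= 1 -> small P t (entry_large H (5 * t) z x y) (n.+2 + q)) ->
  small P t (inv_fails H t z) n.+1 ->
  forall v w, vnorm v <= 1 -> vnorm w <= 1 ->
  small P t [set om | (t ^+ 8)^-1 < normc (fD z s v w (res z (rmat H om)))] n.+2 ->
  small P t (entry_large H 4 z v w) n.
Proof.
move=> gw [hs sC s_sym s_sum] n0 hz tN t2 tC hap hinv v w hv hw hfd.
have t1 : 1 <= t by lra.
have C1 := C_ge1 C0 n0 gw.
pose y l := (C^-1)%:C%C *: lv s v l.
have hy l : vnorm (y l) <= 1.
  rewrite /y vnormZ normc_real gtr0_norm ?invr_gt0 // ler_pdivrMl // mulr1.
  apply: (@le_trans _ _ (C * vnorm v)); last by rewrite ger_pMr.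
  apply: lvec_norm => [|k]; first exact: ltW.
  rewrite normc_real ger0_norm; first by have /andP [] := sC k l.
  apply: le_trans (_ : C^-1 <= _); first by rewrite invr_ge0 ltW.
  by have /andP [] := sC k l.
have hl : small P t [set om | exists2 l, l \in ord_enum N & entry_large H (5 * t) z (y l) w om] n.+2.
  apply: (small_seq t1 (l := q)); first by move=> l _; apply: hap.
  by rewrite -(size_map val) val_ord_enum size_iota tN.
apply: small_sub (smallU t1 t2 hinv (smallU t1 t2 hfd hl)) => om hlarge.
apply: contrapT => /not_orP [/contrapT hi /not_orP [/negP h1 h2]].
rewrite -leNgt in h1.
have hK l : normc (sesq (lv s v l) (res z (rmat H om)) w) <= C * (5 * t).
  have e : lv s v l = C%:C%C *: y l.
    by rewrite /y scalerA -rmorphM /= divff ?gt_eqF // scale1r.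
  rewrite e sesqZl normcM normc_conj normc_real gtr0_norm //.
  apply: ler_wpM2l; first exact: ltW.
  rewrite leNgt; apply/negP => hh; apply: h2; exists l; first exact: mem_ord_enum.
  rewrite /entry_large /=; apply: lt_le_trans hh _.
  by rewrite ler_peMr ?normc_ge0 // lerDl normc_ge0.
have Th0 : 0 <= (t ^+ 4)^-1 by rewrite invr_ge0 exprn_ge0 //; lra.
have K0 : 0 <= C * (5 * t) by rewrite mulr_ge0 ?(ltW C0) //; lra.
have := iso_bound n0 s_sum Th0 hz hv hw K0 hi h1 hK.
move: hlarge; rewrite /entry_large /= => h3 h4.
have t0 : 0 < t by lra.
have t3 : t <= t ^+ 3 by apply: ler_eXnr => //; lra.
have t8 : t <= t ^+ 8 by apply: ler_eXnr => //; lra.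
have e1 : (t ^+ 8)^-1 <= 1 / 6.
  by rewrite mul1r lef_pV2 ?posrE ?exprn_gt0 //; lra.
have e2 : 9 * (t ^+ 4)^-1 * (C * (5 * t)) <= 1 / 6.
  have -> : 9 * (t ^+ 4)^-1 * (C * (5 * t)) = 45 * C / t ^+ 3 by field; rewrite gt_eqF.
  by rewrite ler_pdivrMr ?exprn_gt0 //; lra.
by have := lt_le_trans h3 h4; lra.
Qed.

(** The condition on k says that N Im z >= t^96 at the new level, the range in which [fD_small]
    applies. *)
Lemma level_step k : (k.+1 + 96 <= 3 * q)%N -> level k -> level k.+1.
Proof.
move=> hk IH n.
(* The rate covers (N^5 + 1) N <= t^(6q+1) events, one for each grid point and each diagonal
   entry. *)
have [n' [ta hfD]] := fD_small Cp C0 (leq_trans (isT : (36 <= 200)%N) q200) (n + 6 * q + 4).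
have w1 : (96 + k.+1 <= 2 * q + q)%N by lia.
have w2 : ((n' + n + q + 9).+1 <= n' + n + q + 10)%N by lia.
have w3 : (n' <= n' + n + q + 9)%N by lia.
have w4 : (n.+3 + (6 * q).+1 <= n + 6 * q + 4)%N by lia.
have w5 : (n.+2 <= n' + n + q + 10)%N by lia.
have w6 : (n.+2 + q <= n' + n + q + 9)%N by lia.
have w7 : (n.+2 <= n + 6 * q + 4)%N by lia.
have [tb hlev] := IH (n' + n + q + 10)%N.
exists (`|ta| + `|tb| + 200 + 270 * C).
move=> d T P N H t ht tN gw s hprof E hE.
have a1 := normr_ge0 ta; have a2 := normr_ge0 tb; have a3 := ler_norm ta; have a4 := ler_norm tb.
have C0' := C0.
have tta : ta <= t by lra.
have ttb : tb <= t by lra.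
have t200 : 200 <= t by lra.
have tC : 270 * C <= t by lra.
have {a1 a2 a3 a4 ht} t2 : 2 <= t by lra.
have t1 : 1 <= t by lra.
have t4 : 4 <= t by lra.
have t0 : 0 < t by lra.
have N0 : 0 < N%:R :> R by rewrite -tN exprn_gt0.
have n0 : (0 < N)%N by rewrite -(ltr0n R).
have N1 : 1 <= N%:R :> R by rewrite ler1n.
have C1 := C_ge1 C0 n0 gw.
have [hs sC s_sym s_sum] := hprof.
have sC1 i j : C^-1 <= s i j by have /andP [] := sC i j.
have sC2 i j : `|s i j| <= C.
  rewrite ger0_norm; first by have /andP [] := sC i j.
  by apply: le_trans (sC1 i j); rewrite invr_ge0 ltW.
have [hent hinv] := hlev _ _ _ _ _ _ ttb tN gw s hprof E hE.
set eta := t ^+ (2 * q) / t ^+ k; set eta' := t ^+ (2 * q) / t ^+ k.+1.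
have tk0 : 0 < t ^+ k by rewrite exprn_gt0.
have ee : eta = t * eta' by rewrite /eta /eta' exprS; field; rewrite !gt_eqF.
have e0 : 0 < eta' by rewrite divr_gt0 ?exprn_gt0.
have e1 : eta' <= eta by rewrite ee ler_peMl // ltW.
have eN : t ^+ 96 <= eta' * N%:R.
  rewrite -tN /eta' mulrAC -exprD ler_pdivlMr ?exprn_gt0 // -exprD.
  exact: ler_weXn2l.
have eN1 : 1 <= eta' * N%:R by apply: le_trans eN; rewrite exprn_ege1.
have eN2 : eta <= N%:R ^+ 2.
  rewrite -tN -exprM mulnC /eta ler_pdivrMr // ler_peMr ?exprn_ege1 //.
  by rewrite exprn_ge0 // ltW.
(* Stated for all x between the two levels, as the error has to be controlled at every grid point in
   between. *)
have hap x : eta' <= x -> x <= eta -> forall v w, vnorm v <= 1 -> vnorm w <= 1 ->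
    small P t (entry_large H (5 * t) (E +i* x)%C v w) (n' + n + q + 9).
  move=> x1 x2; apply: (apriori_scale (gw_hH gw) t4 (lt_le_trans e0 x1) x2).
    by rewrite ee; apply: ler_wpM2l => //; exact: ltW.
  by move=> v w hv hw; apply: small_le (hent v w hv hw) => //.
have hf x : eta' <= x -> x <= eta -> forall v w, vnorm v <= 1 -> vnorm w <= 1 ->
    small P t [set om | (t ^+ 8)^-1 < normc (fD (E +i* x)%C s v w (res (E +i* x)%C (rmat H om)))] (n + 6 * q + 4).
  move=> x1 x2; have x0 : 0 < x by lra.
  apply: (hfD _ _ _ _ _ _ tta tN gw s hs sC2 (E +i* x)%C x0).
  - by apply: le_trans eN _; apply: ler_wpM2r => //; exact: ltW.
  - apply: le_trans (normc_le_ReIm _) _; rewrite /= [`|x|]gtr0_norm //.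
    have : N%:R <= N%:R ^+ 2 :> R by rewrite expr2 ler_peMl // ltW.
    lra.
  by move=> u u' hu hu'; apply: small_le (hap x x1 x2 u u' hu hu') => //.
pose A (ji : nat * 'I_N) := [set om | (t ^+ 8)^-1 <
  normc (fD (grid_pt N E eta eta' ji.1) s (basis R ji.2) (basis R ji.2) (res (grid_pt N E eta eta' ji.1) (rmat H om)))].
pose L := [seq (j, i) | j <- iota 0 (N ^ 5).+1, i <- ord_enum N].
have hgrid : small P t [set om | exists2 ji, ji \in L & A ji om] n.+3.
  apply: (small_seq t1 (l := (6 * q).+1)).
    move=> [j i] /allpairsP [[j' i'] [hj _ [-> ->]]].
    have {}hj : (j' <= N ^ 5)%N by move: (hj : j' \in iota 0 (N ^ 5).+1); rewrite mem_iota.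
    have N50 : 0 < N%:R ^+ 5 :> R by rewrite exprn_gt0.
    have hh : 0 <= (eta - eta') / N%:R ^+ 5 by rewrite divr_ge0 ?subr_ge0 // ltW.
    apply: small_le (hf (eta - j'%:R * ((eta - eta') / N%:R ^+ 5)) _ _ _ _ _ _).
    - exact: t1.
    - exact: w4.
    - have : j'%:R * ((eta - eta') / N%:R ^+ 5) <= N%:R ^+ 5 * ((eta - eta') / N%:R ^+ 5).
        by apply: ler_wpM2r => //; rewrite -natrX ler_nat.
      by rewrite [X in _ <= X]mulrC divfK ?gt_eqF //; lra.
    - by rewrite lerBlDr lerDl mulr_ge0.
    - by rewrite vnorm_basis.
    - by rewrite vnorm_basis.
  rewrite size_allpairs size_iota -(size_map val (ord_enum N)) val_ord_enum size_iota.
  rewrite natrM mulrSr natrX (exprS t) [(6 * q)%N]mulnC exprM tN.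
  have -> : t * N%:R ^+ 6 = t * N%:R ^+ 5 * N%:R by ring.
  apply: ler_wpM2r; first exact: ltW.
  have : 1 <= N%:R ^+ 5 :> R by rewrite exprn_ege1.
  have : 2 * N%:R ^+ 5 <= t * N%:R ^+ 5 by apply: ler_wpM2r => //; apply: exprn_ge0; exact: ltW.
  lra.
have hinv' : small P t (inv_fails H t (spec t E k.+1)) n.+1.
  apply: small_sub (smallU t1 t2 (small_le t1 w5 hinv) (small_le t1 (leqnSn n.+2) hgrid)).
  move=> om hno; apply: contrapT => /not_orP [/contrapT h1 h2]; apply: hno.
  apply: (inv_grid n0 C1 sC1 s_sym s_sum (leq_trans (isT : (5 <= 200)%N) q200) t2 _ tN (herm_H (gw_hH gw) om) eN1 e1 eN2) => //.
    by have := C1; lra.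
  move=> j i hj /=; rewrite leNgt; apply/negP => hl; apply: h2; exists (j, i) => //.
  by apply/allpairsP; exists (j, i); rewrite mem_iota add0n ltnS hj mem_ord_enum.
split; last first.
  exact: (small_le t1 (leqnSn n) hinv').
move=> v w hv hw.
apply: (apriori_iso gw hprof n0 _ tN t2 tC _ hinv' hv hw) => //.
- by move=> x y hx hy; exact: (small_le t1 w6 (hap eta' (lexx _) e1 x y hx hy)).
exact: (small_le t1 w7 (hf eta' (lexx _) e1 v w hv hw)).
Qed.

Lemma level_all k : (k + 96 <= 3 * q)%N -> level k.
Proof.
elim: k => [|k IH] hk; first exact: level0.
by apply: level_step => //; apply: IH; exact: ltnW.
Qed.

End Bootstrap.

(** * Delocalization *)

Section Eigenvectors.
Context (R : realType) (N : nat).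
Local Notation CC := R[i].
Variables (M : 'M[CC]_N) (lam : R) (u : 'cV[CC]_N).
Hypothesis hM : hermm M.
Hypothesis hu : M *m u = lam%:C%C *: u.
Hypothesis u1 : sqn u = 1.

Lemma eigen_overlap (z : CC) v : 0 < complex.Im z ->
  normc ((adjm u *m v) 0 0) ^+ 2 * complex.Im z <= normc (lam%:C%C - z) ^+ 2 * complex.Im (sesq v (res z M) v).
Proof.
move=> hz.
have e : adjm u *m (M - z%:M) = (lam%:C%C - z) *: adjm u.
  have h : adjm u *m M = lam%:C%C *: adjm u.
    have := congr1 (@adjm R N 1) hu; rewrite adjmM adjmZ (hM : adjm M = M) => ->.
    by congr (_ *: _); rewrite /= oppr0.
  by rewrite mulmxBr h scalerBl mul_mx_scalar.
have -> : (adjm u *m v) 0 0 = (lam%:C%C - z) * (adjm u *m (res z M *m v)) 0 0.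
  have -> : (lam%:C%C - z) * (adjm u *m (res z M *m v)) 0 0 = ((lam%:C%C - z) *: adjm u *m (res z M *m v)) 0 0.
    by rewrite -scalemxAl [RHS]mxE.
  by rewrite -e -mulmxA (mulmxA (M - _)) mul_res // mul1mx.
rewrite -ward // normcM exprMn -mulrA; apply: ler_wpM2l; first exact: exprn_ge0 (normc_ge0 _).
apply: ler_wpM2r; first exact: ltW.
have := dot_le u (res z M *m v); rewrite u1 sqrtr1 mul1r => h.
rewrite -vnorm_sq; apply: lerXn2r; rewrite ?nnegrE //; [exact: normc_ge0 | exact: vnorm_ge0].
Qed.

(** Cauchy-Schwarz in each row. This crude bound serves only to confine the random eigenvalue to
    [-N, N]. *)
Lemma eigen_le (rho : R) : 0 <= rho -> (forall i j, normc (M i j) <= rho) -> `|lam| <= N%:R * rho.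
Proof.
move=> rho0 hr.
have h : (lam%:C%C *: u) = M *m u by [].
have e : lam ^+ 2 = sqn (M *m u).
  by rewrite -h sqnZ u1 mulr1 normc_real -[RHS]normrX ger0_norm // sqr_ge0.
rewrite -(ler_pXn2r (n := 2)) ?nnegrE ?mulr_ge0 // real_normK ?num_real // e.
have row i : normc ((M *m u) i 0) ^+ 2 <= N%:R * rho ^+ 2.
  rewrite mxE; apply: le_trans (_ : (\sum_j normc (M i j) * normc (u j 0)) ^+ 2 <= _).
    apply: lerXn2r; rewrite ?nnegrE ?normc_ge0 //.
      by apply: sumr_ge0 => j _; rewrite mulr_ge0 ?normc_ge0.
    by apply: le_trans (normc_sum _ _ _) _; apply: ler_sum => j _; rewrite normcM.
  apply: le_trans (CS_sum _ _) _; rewrite [X in _ * X](_ : _ = 1); last exact: u1.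
  rewrite mulr1 -[N in N%:R]card_ord mulr_natl -sumr_const; apply: ler_sum => j _.
  by apply: lerXn2r; rewrite ?nnegrE ?normc_ge0.
apply: le_trans (_ : \sum_(i < N) N%:R * rho ^+ 2 <= _); first by apply: ler_sum => i _; exact: row.
by rewrite sumr_const card_ord -[_ *+ N]mulr_natl exprMn expr2 mulrA.
Qed.

End Eigenvectors.

(** * Eigenvector bound in terms of t *)

Section Delocalization.
Context (R : realType) (C : R) (Cp : nat -> R) (q : nat).
Hypothesis C0 : 0 < C.
Hypothesis q200 : (200 <= q)%N.
Local Notation CC := R[i].

(** At Im z = eta = t^96 / N and within eta of the eigenvalue, the overlap is at most 2 eta^2 * 4 /
    eta = 8 eta <= t^97 / N. *)
Theorem delocalization n : exists t0, forall d (T : measurableType d) (P : probability T R) N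
  (H : 'I_N -> 'I_N -> T -> CC) (t : R), t0 <= t -> t ^+ q = N%:R -> gen_wigner C Cp P H ->
  forall (lam : T -> R) (u : T -> 'cV[CC]_N),
  (forall om, rmat H om *m u om = (lam om)%:C%C *: u om) -> (forall om, sqn (u om) = 1) ->
  forall v, vnorm v <= 1 ->
  small P t [set om | t ^+ 97 / N%:R < normc ((adjm (u om) *m v) 0 0) ^+ 2] n.
Proof.
have w1 : (3 * q - 96 + 96 <= 3 * q)%N by lia.
have [tb hlev] := level_all Cp C0 q200 w1 (n + 2 * q + 2)%N.
have w2 : (n.+1 + (2 * q).+1 <= n + 2 * q + 2)%N by lia.
have w3 : (q <= 2 * q + 3 * q - 96)%N by lia.
have w4 : (96 + (3 * q - 96) = 2 * q + q)%N by lia.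
have w5 : (2 + 96 <= q)%N by apply: leq_trans q200.
exists (`|tb| + 200 + `|Cp (n.+1 + 2 * q).+1|).
move=> d T P N H t ht tN gw lam u hu u1 v hv.
have a1 := normr_ge0 tb; have a2 := ler_norm tb.
have a3 := normr_ge0 (Cp (n.+1 + 2 * q).+1); have a4 := ler_norm (Cp (n.+1 + 2 * q).+1).
have ttb : tb <= t by lra.
have tCp : Cp (n.+1 + 2 * q).+1 <= t by lra.
have {a1 a2 a3 a4 ht} t200 : 200 <= t by lra.
have t1 : 1 <= t by lra.
have t2 : 2 <= t by lra.
have t0 : 0 < t by lra.
have N0 : 0 < N%:R :> R by rewrite -tN exprn_gt0.
have n0 : (0 < N)%N by rewrite -(ltr0n R).
have N1 : 1 <= N%:R :> R by rewrite ler1n.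
have [s [hs _ sC s_sym s_sum]] := gw_var n0 gw.
have hprof : is_profile C P H s by split.
have hh := hlev _ _ _ _ _ _ ttb tN gw s hprof.
pose eta := t ^+ 96 / N%:R.
have eeta E : spec q t E (3 * q - 96) = (E +i* eta)%C.
  rewrite /spec /eta -tN; congr (_ +i* _)%C.
  have tpn k : t ^+ k != 0 by rewrite gt_eqF // exprn_gt0.
  by apply/eqP; rewrite eqr_div // -!exprD w4.
have e0 : 0 < eta by rewrite divr_gt0 ?exprn_gt0.
have eN : N%:R^-1 <= eta by rewrite /eta ler_peMl ?invr_ge0 ?(ltW N0) // exprn_ege1.
pose rN : R := Num.sqrt N%:R.
have rN0 : 0 < rN by rewrite sqrtr_gt0.
have rN2 : rN ^+ 2 = N%:R by rewrite sqr_sqrtr // ltW.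
(* The eigenvalue is random while the resolvent bound holds at fixed z, so it is required at once on
   a net of energies of mesh 1/N <= eta. *)
pose Ej (j : nat) : R := - N%:R + j%:R / N%:R.
have hgrid : small P t [set om | exists2 j, j \in iota 0 (2 * N ^ 2).+1 &
    entry_large H 4 (Ej j +i* eta)%C v v om] n.+1.
  apply: (small_seq t1 (l := (2 * q).+1)).
    move=> j; rewrite mem_iota add0n ltnS /= => hj.
    have hE : `|Ej j| <= N%:R.
      have : j%:R / N%:R <= 2 * N%:R :> R.
        by rewrite ler_pdivrMr // -mulrA -expr2 -natrX -natrM ler_nat.
      have : 0 <= j%:R / N%:R :> R by rewrite divr_ge0 // ltW.
      rewrite ler_norml /Ej; move: (j%:R / N%:R) => x x0 x1; apply/andP; split; lra.
    have [h _] := hh _ hE; rewrite -eeta; exact: (small_le t1 w2 (h v v hv hv)).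
  rewrite size_iota mulrSr natrM natrX (exprS t) mulnC exprM tN.
  have : 3 * N%:R ^+ 2 <= t * N%:R ^+ 2 by apply: ler_wpM2r; [apply: exprn_ge0; exact: ltW | lra].
  have : 1 <= N%:R ^+ 2 :> R by rewrite exprn_ege1.
  lra.
have hbig : small P t [set om | exists2 ij, ij \in [seq (i, j) | i <- ord_enum N, j <- ord_enum N] &
    big_entry H (t / rN) ij.1 ij.2 om] n.+1.
  apply: (small_seq t1 (l := 2 * q)).
    move=> [i j] _; exists (big_entry H (t / rN) i j); split => //; first exact: mbig (gw_mH gw) _ _ _.
    rewrite -[P _]fineK; last by apply: fin_num_measure; exact: mbig (gw_mH gw) _ _ _.
    rewrite lee_fin; apply: le_trans (gw_tail n0 gw i j t0 (ltn0Sn (n.+1 + 2 * q))) _.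
    by rewrite exprS invfM mulrA ler_piMl ?invr_ge0 ?exprn_ge0 ?(ltW t0) // ler_pdivrMr // mul1r.
  rewrite size_allpairs -(size_map val (ord_enum N)) val_ord_enum size_iota natrM mulnC exprM tN.
  by rewrite expr2.
apply: small_sub (smallU t1 t2 hbig hgrid) => om hlarge.
rewrite /= in hlarge.
apply: contrapT => /not_orP [h1 h2].
have hM := herm_H (gw_hH gw) om.
have hlam : `|lam om| <= N%:R.
  apply: le_trans (eigen_le (hu om) (u1 om) (rho := t / rN) _ _) _.
  - by rewrite divr_ge0 // ltW.
  - move=> i j; rewrite mxE leNgt; apply/negP => hl; apply: h1; exists (i, j) => //.
    by apply/allpairsP; exists (i, j); rewrite !mem_ord_enum.
  rewrite -rN2 mulrA ler_pdivrMr //; apply: ler_wpM2l; first by rewrite exprn_ge0 // ltW.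
  rewrite -(ler_pXn2r (n := 2)) ?nnegrE ?(ltW t0) ?(ltW rN0) // rN2 -tN.
  by apply: ler_weXn2l => //; apply: leq_trans q200.
pose x := (lam om + N%:R) * N%:R.
have lamb : - N%:R <= lam om <= N%:R by rewrite -ler_norml.
have x0 : 0 <= x by rewrite mulr_ge0 ?(ltW N0) //; lra.
have /andP [j1 j2] := truncn_itv x0.
set j := Num.trunc x in j1 j2.
have hj : (j <= 2 * N ^ 2)%N.
  rewrite -(ler_nat R) natrM natrX; apply: le_trans j1 _; rewrite /x expr2 mulrA.
  by apply: ler_wpM2r; [exact: ltW | lra].
pose z : CC := (Ej j +i* eta)%C.
have dE : `|lam om - Ej j| <= eta.
  apply: le_trans eN; have -> : lam om - Ej j = (x - j%:R) / N%:R.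
    by rewrite /Ej /x; field; rewrite gt_eqF.
  rewrite normrM [`|N%:R^-1|]gtr0_norm ?invr_gt0 // ler_piMl ?invr_ge0 ?(ltW N0) //.
  rewrite ger0_norm ?subr_ge0 //; move: j2; rewrite mulrSr; lra.
have hG : normc (sesq v (res z (rmat H om)) v) <= 4.
  apply: (@le_trans _ _ (normc (sesq v (res z (rmat H om)) v) * (1 + normc z))).
    by rewrite ler_peMr ?normc_ge0 // lerDl normc_ge0.
  rewrite leNgt; apply/negP => hl; apply: h2; exists j => //.
  by rewrite mem_iota add0n ltnS hj.
have h3 := eigen_overlap hM (hu om) (u1 om) v (e0 : 0 < complex.Im z).
have h4 : complex.Im (sesq v (res z (rmat H om)) v) <= 4.
  by apply: le_trans (ler_norm _) _; apply: le_trans (Im_le_normc _) _.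
have h5 : normc ((lam om)%:C%C - z) ^+ 2 <= 2 * eta ^+ 2.
  rewrite normc_sq /= sub0r sqrrN.
  have : (lam om - Ej j) ^+ 2 <= eta ^+ 2.
    by rewrite -(real_normK (num_real (lam om - Ej j))); apply: lerXn2r; rewrite ?nnegrE // ltW.
  lra.
have h6 : normc ((adjm (u om) *m v) 0 0) ^+ 2 * eta <= 8 * eta * eta.
  apply: le_trans h3 _; apply: (@le_trans _ _ (normc ((lam om)%:C%C - z) ^+ 2 * 4)).
    by apply: ler_wpM2l => //; exact: exprn_ge0 (normc_ge0 _).
  have -> : 8 * eta * eta = 2 * eta ^+ 2 * 4 by ring.
  by apply: ler_wpM2r.
rewrite ler_pM2r // in h6.
have : t ^+ 97 / N%:R = t * eta by rewrite /eta (exprS t 96) mulrA.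
have : 8 * eta <= t * eta by apply: ler_wpM2r; [exact: ltW | lra].
move: hlarge h6; set a := normc _ ^+ 2; move=> b1 b2 b3 b4.
by have := lt_le_trans b1 b2; rewrite b4; lra.
Qed.

End Delocalization.

Theorem mainTheorem17 (R : realType) (C : R) (Cp : nat -> R) (eps D : R) :
  0 < C -> 0 < eps -> 0 < D ->
  exists N0 : nat, forall N : nat, (N0 <= N)%N ->
  forall (d : measure_display) (T : measurableType d) (P : probability T R)
    (H : 'I_N -> 'I_N -> T -> R[i]) (lam : 'I_N -> T -> R)
    (u : 'I_N -> T -> 'cV[R[i]]_N),
  gen_wigner C Cp P H -> eigen_decomp H lam u ->
  forall (alpha : 'I_N) (v : 'cV[R[i]]_N), unit_cvec v ->
  exists A : set T,
    [/\ measurable A,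
        [set w | (N%:R `^ eps) * (N%:R)^-1 < abs2 (cinner (u alpha w) v)] `<=` A
      & (P A <= (N%:R `^ (- D))%:E)%E].
Proof.
move=> C0 eps0 D0.
(* With t = N^(1/q), the choice of q gives t^97 <= N^eps, and that of n gives t^-n <= N^-D. *)
pose q := (200 + (Num.trunc (97 / eps)).+1)%N.
pose n := (Num.trunc (q%:R * D)).+1.
have q200 : (200 <= q)%N by rewrite leq_addr.
have q0 : 0 < q%:R :> R by rewrite ltr0n (leq_trans _ q200).
have qe : 97 / q%:R <= eps.
  rewrite ler_pdivrMr // mulrC -ler_pdivrMr //.
  have /andP [_ /ltW h] := truncn_itv (divr_ge0 (ler0n R 97) (ltW eps0)).
  by apply: le_trans h _; rewrite ler_nat leq_addl.
have nD : D <= n%:R / q%:R.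
  rewrite ler_pdivlMr // mulrC.
  by have /andP [_ /ltW] := truncn_itv (mulr_ge0 (ltW q0) (ltW D0)).
have [t0 h0] := delocalization Cp C0 q200 n.
pose B := `|t0| + 1.
have B0 : 0 <= B by rewrite addr_ge0.
(* N >= B^q guarantees N^(1/q) >= B >= t0. *)
exists (Num.trunc (B ^+ q)).+1 => N hN d T P H lam u gw [_ hu ho] alpha v hv.
have BN : B ^+ q <= N%:R.
  have /andP [_ /ltW h] := truncn_itv (exprn_ge0 q B0).
  by apply: le_trans h _; rewrite ler_nat.
have n0 : (0 < N)%N by apply: leq_ltn_trans hN.
have N0 : 0 < N%:R :> R by rewrite ltr0n.
have N1 : 1 <= N%:R :> R by rewrite ler1n.
pose t : R := N%:R `^ q%:R^-1.
have tge : 0 <= t by exact: powR_ge0.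
have tp k : t ^+ k = N%:R `^ (k%:R / q%:R).
  by rewrite -powR_mulrn // /t -powRrM mulrC.
have tN : t ^+ q = N%:R by rewrite tp divff ?gt_eqF // powRr1 // ltW.
have Bt : B <= t.
  rewrite leNgt; apply/negP => h.
  have : t ^+ q < B ^+ q by apply: ltrXn2r; rewrite ?nnegrE // -lt0n (leq_trans _ q200).
  by rewrite tN ltNge BN.
have tt : t0 <= t by apply: le_trans Bt; have := ler_norm t0; rewrite /B; lra.
have dotE (a b : 'cV[R[i]]_N) : cinner a b = (adjm a *m b) 0 0.
  by rewrite mxE; apply: eq_bigr => i _; rewrite adjmE.
have u1 om : sqn (u alpha om) = 1.
  have := ho om alpha alpha; rewrite eqxx dotE sqnE => h.
  by have := congr1 (@complex.Re R) h.
have v1 : vnorm v <= 1.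
  have e : sqn v = 1.
    by rewrite -[RHS]hv; apply: eq_bigr => i _; rewrite normc_sq.
  by rewrite /vnorm e sqrtr1.
have [A [mA hA PA]] := h0 _ _ _ _ _ _ tt tN gw (lam alpha) (u alpha) (fun om => hu om alpha) u1 v v1.
exists A; split => //.
  move=> om /= hom; apply: hA => /=.
  have -> : normc ((adjm (u alpha om) *m v) 0 0) ^+ 2 = abs2 (cinner (u alpha om) v).
    by rewrite dotE normc_sq.
  apply: le_lt_trans hom; apply: ler_wpM2r; first by rewrite invr_ge0 ltW.
  by rewrite tp; apply: ler_powR.
apply: le_trans PA _; rewrite lee_fin powRN lef_pV2 ?posrE ?powR_gt0 //.
  by rewrite tp; apply: ler_powR.
by rewrite tp powR_gt0.
Qed.
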